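(* Let $u_0\in L^2(\mathbb{R}^n)$. Then the decay character of $u_0$ exists and $r^*=r^*(u_0)\in(-n/2,\infty)$ if and only if there is $\sigma^*>0$ such that $u_0\in\dot{\mathcal{A}}^{-\sigma^*}_{2,\infty}$. In this case, $\sigma^*=\sigma(u_0)$ and $r^*(u_0)+n/2=\sigma(u_0)$.
   Context: Littlewood--Paley blocks: let $\varphi$ be a smooth radial function on $\mathbb{R}^n$ with support in $\{3/4\le|\xi|\le8/3\}$ such that $\sum_{j\in\mathbb{Z}}\varphi(2^{-j}\xi)=1$ for all $\xi\ne0$; set $\widehat{\Delta_jf}=\varphi(2^{-j}\cdot)\widehat f$. For $s\ge0$, $\dot B^{-s}_{2,\infty}$ is the set of $f\in\mathcal{S}'(\mathbb{R}^n)$ with $f=\sum_{j\in\mathbb{Z}}\Delta_jf$ convergent in $\mathcal{S}'(\mathbb{R}^n)$ and $\sup_j2^{-js}\|\Delta_jf\|_{L^2}<\infty$. For $s>0$, $\dot{\mathcal{A}}^{-s}_{2,\infty}$ is the set of $f\in\dot B^{-s}_{2,\infty}$ for which there exist $c,C>0$ and a sequence $(j_k)_{k\in\mathbb{N}}\subset\mathbb{Z}$ with $j_k\to-\infty$ and $(j_k-j_{k+1})_k\in\ell^\infty(\mathbb{N})$, such that $\|\Delta_jf\|_{L^2}\le C2^{sj}$ for all $j\in\mathbb{Z}$ and $\|\Delta_{j_k}f\|_{L^2}\ge c2^{sj_k}$ for all $k\in\mathbb{N}$. For $u_0\in L^2(\mathbb{R}^n)$, $\sigma(u_0)=\sup\{\sigma\ge0: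 u_0\in\dot B^{-\sigma}_{2,\infty}\}\in[0,+\infty]$. Decay indicators: for $r\in\mathbb{R}$, with $B_\rho=\{|\xi|\le\rho\}$, $$P_r(u_0)_-=\liminf_{\rho\to0^+}\rho^{-2r-n}\int_{B_\rho}|\widehat u_0(\xi)|^2d\xi,\qquad P_r(u_0)_+=\limsup_{\rho\to0^+}\rho^{-2r-n}\int_{B_\rho}|\widehat u_0(\xi)|^2d\xi.$$ Decay character: $u_0$ has a decay character $r^*(u_0)\in(-n/2,\infty)$ if there is a number $r^*(u_0)\in(-n/2,\infty)$ with $$r^*(u_0)=\max\{r\in\mathbb{R}: P_r(u_0)_+<\infty\}=\min\{r\in\mathbb{R}: P_r(u_0)_->0\}$$ (both the maximum and the minimum being attained). *)

(* Defs.v *)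
From HB Require Import structures.
From mathcomp Require Import all_boot all_order all_algebra.
From mathcomp Require Import complex.
From mathcomp Require Import all_classical all_reals all_analysis.

Set Implicit Arguments.
Unset Strict Implicit.
Unset Printing Implicit Defensive.

Import Order.TTheory GRing.Theory Num.Theory.
Import numFieldNormedType.Exports.
Import ComplexField.

Local Open Scope classical_set_scope.
Local Open Scope complex_scope.
Local Open Scope ring_scope.

Definition measure_rV_display : measure_display -> measure_display.
Proof. exact. Qed.

Section measurable_rV.
Context {R : realType} (n : nat).

Let coord (i : 'I_n) (x : 'rV[R]_n) : measurableTypeR R := x ord0 i.

Let rV_set0 : g_sigma_preimage coord set0.
Proof. exact: sigma_algebra0. Qed.

Let rV_setC A : g_sigma_preimage coord A -> g_sigma_preimage coord (~` A).
Proof. exact: sigma_algebraC. Qed.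

Let rV_bigcup (F : (set 'rV[R]_n)^nat) :
  (forall i, g_sigma_preimage coord (F i)) ->
  g_sigma_preimage coord (\bigcup_i (F i)).
Proof. exact: sigma_algebra_bigcup. Qed.

(* The sigma-algebra generated by the coordinates, i.e. the Borel sets of R^n. *)
HB.instance Definition _ :=
  @isMeasurable.Build (measure_rV_display R.-ocitv.-measurable.-sigma)
    'rV[R]_n (g_sigma_preimage coord) rV_set0 rV_setC rV_bigcup.

Lemma measurable_coord (i : 'I_n) :
  measurable_fun [set: 'rV[R]_n]
    ((fun x => x ord0 i) : 'rV[R]_n -> measurableTypeR R).
Proof.
move=> _ Y mY; rewrite setTI; apply: sub_sigma_algebra => /=.
rewrite -bigcup_seq/=; exists i => /=; first by rewrite mem_index_enum.
by exists Y => //; rewrite setTI.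
Qed.

Lemma measurable_fun_coordP d (T : measurableType d) (f : T -> 'rV[R]_n) :
  (forall i, measurable_fun [set: T]
     ((fun x => f x ord0 i) : T -> measurableTypeR R)) ->
  measurable_fun [set: T] f.
Proof.
move=> mf.
suff H : preimage_set_system [set: T] f (g_sigma_preimage coord) `<=` measurable.
  by move=> _ Y mY; apply: H; exists Y.
rewrite /g_sigma_preimage -g_sigma_preimageE.
apply: smallest_sub; first exact: sigma_algebra_measurable.
move=> _ [B + <-]; rewrite -bigcup_seq => -[i _] [C mC <-].
by rewrite !setTI; have := mf i measurableT _ mC; rewrite setTI.
Qed.

End measurable_rV.

Section lebesgue_rV.
Context {R : realType}.

Definition rV_cons n (p : measurableTypeR R * 'rV[R]_n) : 'rV[R]_n.+1 :=
  \row_i (if unlift ord0 i is Some j then p.2 ord0 j else p.1).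

Lemma measurable_rV_cons n : measurable_fun setT (@rV_cons n).
Proof.
apply: measurable_fun_coordP => i.
case: (unliftP ord0 i) => [j ->|->].
  rewrite (_ : (fun _ => _) = (fun x : 'rV[R]_n => x ord0 j) \o snd); last first.
    by apply/funext => p /=; rewrite mxE liftK.
  by apply: measurableT_comp => //; exact: measurable_coord.
rewrite (_ : (fun _ => _) = fst) //.
by apply/funext => p /=; rewrite mxE unlift_none.
Qed.

Definition rV_uncons n (x : 'rV[R]_n.+1) : measurableTypeR R * 'rV[R]_n :=
  (x ord0 ord0, \row_j x ord0 (lift ord0 j)).

Lemma rV_consK n : cancel (@rV_cons n) (@rV_uncons n).
Proof.
move=> [t x]; rewrite /rV_uncons /rV_cons mxE unlift_none; congr pair.
by apply/rowP => j; rewrite !mxE liftK.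
Qed.

Lemma measurable_rV_uncons n : measurable_fun setT (@rV_uncons n).
Proof.
apply: measurable_fun_pair; first exact: measurable_coord.
apply: measurable_fun_coordP => j.
rewrite (_ : (fun _ => _) = (fun x : 'rV[R]_n.+1 => x ord0 (lift ord0 j))).
  exact: measurable_coord.
by apply/funext => x; rewrite mxE.
Qed.

Section step.
Context n (m : {sigma_finite_measure set 'rV[R]_n -> \bar R}).

Definition rV_prod : set 'rV[R]_n.+1 -> \bar R :=
  pushforward (@lebesgue_measure R \x m)%E (@rV_cons n).

Let rV_prod0 : rV_prod set0 = 0%E.
Proof. by rewrite /rV_prod /pushforward preimage_set0 measure0. Qed.

Let rV_prod_ge0 A : (0 <= rV_prod A)%E.
Proof. by rewrite /rV_prod /pushforward measure_ge0. Qed.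

Let rV_prod_sigma_additive : semi_sigma_additive rV_prod.
Proof.
have mc A : measurable A -> measurable (@rV_cons n @^-1` A).
  by move=> mA; rewrite -[X in measurable X]setTI; exact: measurable_rV_cons.
move=> F mF tF mUF; rewrite /rV_prod /pushforward preimage_bigcup.
apply: measure_semi_sigma_additive.
- by move=> k; exact: mc.
- apply/trivIsetP => /= i j _ _ ij; rewrite -preimage_setI.
  by move/trivIsetP : tF => /(_ _ _ _ _ ij) ->//; rewrite preimage_set0.
- by rewrite -preimage_bigcup; exact: mc.
Qed.

HB.instance Definition _ := isMeasure.Build _ _ _ rV_prod
  rV_prod0 rV_prod_ge0 rV_prod_sigma_additive.

Let rV_prod_sigma_finite : sigma_finite setT rV_prod.
Proof.
have /sigma_finiteP[F [TF ndF Foo]] := sigma_finiteT (@lebesgue_measure R).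
have /sigma_finiteP[G [TG ndG Goo]] := sigma_finiteT m.
exists (fun k => @rV_uncons n @^-1` (F k `*` G k)).
  apply/esym; rewrite -preimage_bigcup (_ : \bigcup_k _ = setT) ?preimage_setT//.
  apply/seteqP; split => // -[t x] _.
  have [k _ Fkt] : (\bigcup_i F i) t by rewrite -TF.
  have [l _ Glx] : (\bigcup_i G i) x by rewrite -TG.
  exists (maxn k l) => //; split => /=.
  - by move: t Fkt; exact/subsetPset/ndF/leq_maxl.
  - by move: x Glx; exact/subsetPset/ndG/leq_maxr.
move=> k; have [mF Fk] := Foo k; have [mG Gk] := Goo k; split.
  rewrite -[X in measurable X]setTI; apply: measurable_rV_uncons => //.
  exact: measurableX.
rewrite /rV_prod /pushforward -comp_preimage (_ : _ \o _ = id) ?preimage_id.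
  by rewrite product_measure1E// lte_mul_pinfty// ge0_fin_numE.
exact/funext/rV_consK.
Qed.

HB.instance Definition _ := Measure_isSigmaFinite.Build _ _ _ rV_prod
  rV_prod_sigma_finite.

End step.

(* R^0 is a point, and Lebesgue measure on R^n.+1 is that of R times that of
   R^n. *)
Fixpoint lebesgue_rV n : {sigma_finite_measure set 'rV[R]_n -> \bar R} :=
  if n is n'.+1 then rV_prod (lebesgue_rV n') else \d_(0 : 'rV[R]_0).

End lebesgue_rV.

Lemma lebesgue_rV_box (R : realType) n (A : 'I_n -> set (measurableTypeR R)) :
  (forall i, measurable (A i)) ->
  lebesgue_rV n [set x | forall i, A i (x ord0 i)] =
  (\prod_(i < n) lebesgue_measure (A i))%E.
Proof.
elim: n A => [|n IHn] A mA.
  by rewrite big_ord0 /= diracE mem_set// => -[].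
rewrite big_ord_recl -IHn; last by move=> i; exact: mA.
have mB : measurable [set x : 'rV[R]_n | forall i, A (lift ord0 i) (x ord0 i)].
  rewrite (_ : [set _ | _] = \bigcap_(i in [set: 'I_n])
      ((fun x : 'rV[R]_n => x ord0 i) @^-1` A (lift ord0 i))).
    apply: fin_bigcap_measurable => // i _.
    by rewrite -[X in measurable X]setTI; exact: measurable_coord.
  by apply/seteqP; split => x Ax i => [_|]; exact: Ax.
rewrite /= /rV_prod /pushforward -product_measure1E//.
congr product_measure1; apply/seteqP; split => -[t x] /= H.
  split=> [|i]; first by have := H ord0; rewrite mxE unlift_none.
  by have := H (lift ord0 i); rewrite mxE liftK.
by move=> i; rewrite mxE; case: unliftP => [j ->|->]; case: H.
Qed.

Section fourier.
Context {R : realType} (n : nat).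
Local Notation E := 'rV[R]_n.
Local Notation mu := (@lebesgue_rV R n).

Implicit Types (f g psi u v : E -> R[i]) (x xi : E).

Definition dotr x xi : R := \sum_(i < n) x ord0 i * xi ord0 i.

(* The Euclidean norm; `|x| is the (equivalent) sup norm. *)
Definition enorm x : R := Num.sqrt (dotr x x).

Definition cabs (z : R[i]) : R := Normc.normc z.

Definition ReF f : E -> R := fun x => complex.Re (f x).
Definition ImF f : E -> R := fun x => complex.Im (f x).

(* d^alpha h, where the multi-index alpha is given by listing the indices of
   the successive partial derivatives. *)
Definition partial (alpha : seq 'I_n) (h : E -> R) : E -> R :=
  foldr (fun i k x => 'D_(delta_mx ord0 i) k x) h alpha.

Definition cpartial alpha f : E -> R[i] :=
  fun x => partial alpha (ReF f) x +i* partial alpha (ImF f) x.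

Definition smooth f :=
  forall alpha x, differentiable (partial alpha (ReF f)) x /\
                  differentiable (partial alpha (ImF f)) x.

Definition schwartz_norm (N : nat) f : \bar R :=
  ereal_sup [set r | exists alpha x, (size alpha <= N)%N /\
    r = ((1 + enorm x) ^+ N * cabs (cpartial alpha f x))%:E].

Definition schwartz f :=
  smooth f /\ forall N, (schwartz_norm N f < +oo)%E.

(* A distribution is given as a functional on all functions, of which only
   the values on Schwartz functions are meaningful; transposed operators need
   then no proof that they preserve the Schwartz space. *)
Definition dist := (E -> R[i]) -> R[i].

Definition tempered (T : dist) :=
  (forall (a : R[i]) f g, schwartz f -> schwartz g ->
     T (fun x => a * f x + g x) = a * T f + T g) /\
  (exists N (C : R), forall f, schwartz f ->
     ((cabs (T f))%:E <= C%:E * schwartz_norm N f)%E).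

Definition cintegral f : R[i] :=
  Rintegral mu setT (ReF f) +i* Rintegral mu setT (ImF f).

Definition L2norm f : \bar R := Lnorm mu 2%:E (fun x => (cabs (f x))%:E).

Definition L2 f :=
  [/\ measurable_fun setT (ReF f), measurable_fun setT (ImF f) &
      (L2norm f < +oo)%E].

Definition dist_of f : dist := fun psi => cintegral (fun x => f x * psi x).

Definition represents f (T : dist) :=
  forall psi, schwartz psi -> dist_of f psi = T psi.

(* The L^2 norm of a distribution: +oo when it is not an L^2 function. *)
Definition dist_L2norm (T : dist) : \bar R :=
  ereal_inf [set L2norm g | g in [set g | L2 g /\ represents g T]].

Definition cis (t : R) : R[i] := cos t +i* sin t.

Definition fourier f : E -> R[i] :=
  fun xi => cintegral (fun x => cis (- dotr x xi) * f x).

Definition fourier_inv f : E -> R[i] :=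
  fun x => (((2 * pi) ^- n)%:C : R[i]) *
           cintegral (fun xi => cis (dotr x xi) * f xi).

Definition dist_fourier (T : dist) : dist := fun psi => T (fourier psi).

Definition dist_fourier_inv (T : dist) : dist := fun psi => T (fourier_inv psi).

Definition dist_mul f (T : dist) : dist := fun psi => T (fun x => f x * psi x).

(* The Fourier transform of u in L^2: the L^2 function, unique a.e., which
   represents the Fourier transform of u as a tempered distribution. *)
Definition L2_fourier u : E -> R[i] :=
  xget (fun=> 0) [set v | L2 v /\ represents v (dist_fourier (dist_of u))].

Definition LP_cutoff (phi : E -> R[i]) :=
  [/\ smooth phi,
      (forall x xi, enorm x = enorm xi -> phi x = phi xi),
      closure [set xi | phi xi != 0] `<=` [set xi | 3 / 4 <= enorm xi <= 8 / 3] &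
      forall xi, xi != 0 ->
        \sum_(j \in [set: int]) phi ((2 : R) ^ (- j) *: xi) = 1].

Definition LP_block (phi : E -> R[i]) (j : int) (T : dist) : dist :=
  dist_fourier_inv
    (dist_mul (fun xi => phi ((2 : R) ^ (- j) *: xi)) (dist_fourier T)).

(* The two-sided series with terms F j converges to T in S', i.e. pointwise
   on S: sums over -p <= j < q, with p and q going independently to infinity. *)
Definition dist_series_cvg (F : int -> dist) (T : dist) :=
  forall psi, schwartz psi ->
    cabs (\sum_(0 <= k < pq.1) F (- k.+1%:Z) psi +
          \sum_(0 <= k < pq.2) F k%:Z psi - T psi)
      @[pq --> filter_prod \oo \oo] --> (0 : R).

(* \dot B^{-s}_{2,oo}: the regularity is - s. *)
Definition besov (phi : E -> R[i]) (s : R) (T : dist) :=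
  [/\ tempered T,
      dist_series_cvg (fun j => LP_block phi j T) T &
      (ereal_sup [set (2 `^ (- (j%:~R * s)))%:E * dist_L2norm (LP_block phi j T)
                  | j in [set: int]] < +oo)%E].

(* \dot A^{-s}_{2,oo}, for s > 0. *)
Definition sharp_besov (phi : E -> R[i]) (s : R) (T : dist) :=
  besov phi s T /\
  exists (c C : R) (jk : nat -> int),
    [/\ 0 < c /\ 0 < C,
        ((jk k)%:~R : R) @[k --> \oo] --> -oo,
        (exists M : int, forall k, `|jk k - jk k.+1| <= M),
        (forall j, (dist_L2norm (LP_block phi j T) <=
                    (C * 2 `^ (s * j%:~R))%:E)%E) &
        (forall k, ((c * 2 `^ (s * (jk k)%:~R))%:E <=
                    dist_L2norm (LP_block phi (jk k) T))%E)].

Definition besov_index (phi : E -> R[i]) u : \bar R :=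
  ereal_sup [set s%:E | s in [set s : R | 0 <= s /\ besov phi s (dist_of u)]].

Definition eball (rho : R) : set E := [set xi | enorm xi <= rho].

Definition decay_quotient u (r rho : R) : \bar R :=
  ((rho `^ (- 2 * r - n%:R))%:E *
   \int[mu]_(xi in eball rho) ((cabs (L2_fourier u xi)) ^+ 2)%:E)%E.

(* P_r(u)_- and P_r(u)_+. *)
Definition decay_inf u (r : R) : \bar R :=
  limf_einf (decay_quotient u r) (0^'+ : set_system R).

Definition decay_sup u (r : R) : \bar R :=
  limf_esup (decay_quotient u r) (0^'+ : set_system R).

Definition is_max (A : set R) (r : R) := A r /\ ubound A r.

Definition is_min (A : set R) (r : R) := A r /\ lbound A r.

Definition is_decay_character u (r : R) :=
  [/\ - (n%:R / 2) < r,
      is_max [set q | (decay_sup u q < +oo)%E] r &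
      is_min [set q | (0 < decay_inf u q)%E] r].

End fourier.

(* Main.v *)
(* By Plancherel the L^2 norm of the block of index j is, up to a constant, the
   norm of phi(2^-j xi) times the Fourier transform v of u_0, hence it is
   comparable with the energy of v on the dyadic shell |xi| ~ 2^j.  Both the
   decay character and the sharp Besov condition thus say that the energy M(rho)
   of v in the ball of radius rho has exact order rho^(2s) near 0, with
   s = r + n/2: an upper bound on M follows by summing shells, and two-sided
   bounds on M force, by pigeonhole, a large block in every window of
   sufficiently many consecutive shells; conversely, a large block makes M large
   at its scale and, the gaps being bounded, at every smaller scale.

   Schwartz functions are only used as test functions, so that invariance of the
   Schwartz class under the Fourier transform is never needed.  Plancherel is
   proved on L^1 /\ L^2 by density of the indicators of boxes, for which it
   reduces to the one-dimensional integral of (1 - cos(tx)) / x^2.  Gaussian wave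
   packets are Schwartz functions, and an L^2 function orthogonal to all of them
   vanishes a.e., whence the uniqueness of L^2 representatives of
   distributions. *)
From HB Require Import structures.
From mathcomp Require Import all_boot all_order all_algebra.
From mathcomp Require Import complex ring lra zify.
From mathcomp Require Import all_classical all_reals all_analysis.
From mathcomp Require Import measurable_realfun.
Require Import Defs.

Set Implicit Arguments.
Unset Strict Implicit.
Unset Printing Implicit Defensive.

Import Order.TTheory GRing.Theory Num.Theory.
Import numFieldNormedType.Exports.
Import ComplexField.

Local Open Scope classical_set_scope.
Local Open Scope complex_scope.
Local Open Scope ring_scope.

(** * Complex-valued integrals *)

Section complex_modulus.
Context {R : realType}.
Implicit Types (z w : R[i]) (t : R).

(** Norms enter squared, as extended reals. The weighted inequality |a + b|^2 <= (1 + e) |a|^2 + (1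
    + 1/e) |b|^2 takes the place of Minkowski's inequality, and 2 |a b| <= |a|^2 / e + e |b|^2 that
    of Cauchy-Schwarz; the free weight e lets limits keep the sharp constant. Test functions range
    over L^1 /\ L^2, a class that contains the Schwartz functions and the products of a cutoff with
    an L^2 function. For the transform v of u in L^2 two identities are proved on this class: v
    paired with chi is u paired with the transform of chi, and v paired with the inverse transform
    of psi is u paired with psi. The second comes from Parseval; it does the work of an inversion
    theorem and brings the series of blocks back to u. What the comparison of exponents uses of the
    energies is that M is monotone, bounded and tends to 0 at 0, that its increase over a shell is
    at most three times the sum of three block energies, and that a block energy is at most a
    constant times M at four times its scale. The rest concerns two real sequences indexed by the
    integers. *)

Lemma cabs_sqr z : cabs z ^+ 2 = complex.Re z ^+ 2 + complex.Im z ^+ 2.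
Proof. by case: z => a b; rewrite /cabs /= sqr_sqrtr// addr_ge0// sqr_ge0. Qed.

Lemma cabs_ge0 z : 0 <= cabs z.
Proof. by case: z => a b; exact: sqrtr_ge0. Qed.

Lemma cabsM z w : cabs (z * w) = cabs z * cabs w.
Proof. exact: Normc.normcM. Qed.

Lemma ler_cabsD z w : cabs (z + w) <= cabs z + cabs w.
Proof. exact: le_normcD. Qed.

Lemma cabsN z : cabs (- z) = cabs z.
Proof. exact: normcN. Qed.

Lemma cabs0 : cabs (0 : R[i]) = 0.
Proof. exact: Normc.normc0. Qed.

Lemma cabs_eq0 z : cabs z = 0 -> z = 0.
Proof. exact: Normc.eq0_normc. Qed.

Lemma cabsB z w : cabs (z - w) = cabs (w - z).
Proof. by rewrite -cabsN opprB. Qed.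

Lemma cabs_conj z : cabs z^*%C = cabs z.
Proof. by case: z => a b; rewrite /cabs /= sqrrN. Qed.

Lemma cabs_real t : cabs (t%:C) = `|t|.
Proof. by rewrite /cabs /= expr0n /= addr0 sqrtr_sqr. Qed.

Lemma cabs_cis t : cabs (cis t) = 1.
Proof. by rewrite /cabs /= cos2Dsin2 sqrtr1. Qed.

Lemma normr_Re z : `|complex.Re z| <= cabs z.
Proof.
by rewrite -sqrtr_sqr; case: z => a b /=; apply: ler_wsqrtr; rewrite lerDl sqr_ge0.
Qed.

Lemma normr_Im z : `|complex.Im z| <= cabs z.
Proof.
by rewrite -sqrtr_sqr; case: z => a b /=; apply: ler_wsqrtr; rewrite lerDr sqr_ge0.
Qed.

Lemma cabs_le_ReIm z : cabs z <= `|complex.Re z| + `|complex.Im z|.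
Proof.
rewrite -(@ler_sqr _ (cabs z)) ?nnegrE ?cabs_ge0 ?addr_ge0//.
rewrite cabs_sqr sqrrD !real_normK ?num_real// lerD2r lerDl.
by rewrite mulrn_wge0// mulr_ge0.
Qed.

Lemma cabs_mul_le z w : cabs (z * w) <= cabs z ^+ 2 + cabs w ^+ 2.
Proof.
rewrite cabsM; have := cabs_ge0 z; have := cabs_ge0 w.
set a := cabs z; set b := cabs w => b0 a0; nra.
Qed.

(** The right side exceeds (a + b)^2 by the square e^-1 (e a - b)^2. A small e keeps the coefficient
    of the main term close to 1. *)
Lemma cabs_sqrD (e : R) z w : 0 < e ->
  cabs (z + w) ^+ 2 <= (1 + e) * cabs z ^+ 2 + (1 + e^-1) * cabs w ^+ 2.
Proof.
move=> e0; have := ler_cabsD z w; have := cabs_ge0 z; have := cabs_ge0 w.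
have := cabs_ge0 (z + w).
set a := cabs z; set b := cabs w; set c := cabs _ => c0 b0 a0 cab.
have -> : (1 + e) * a ^+ 2 + (1 + e^-1) * b ^+ 2 =
  (a + b) ^+ 2 + e^-1 * (e * a - b) ^+ 2 by field; rewrite gt_eqF.
apply: (@le_trans _ _ ((a + b) ^+ 2)).
  by rewrite lerXn2r ?nnegrE// addr_ge0.
by rewrite lerDl mulr_ge0 ?sqr_ge0// invr_ge0 ltW.
Qed.

Lemma Re_mul z w :
  complex.Re (z * w) = complex.Re z * complex.Re w - complex.Im z * complex.Im w.
Proof. by case: z w => [a b] [c d]. Qed.

Lemma Im_mul z w :
  complex.Im (z * w) = complex.Re z * complex.Im w + complex.Im z * complex.Re w.
Proof. by case: z w => [a b] [c d]. Qed.

Lemma Re_add z w : complex.Re (z + w) = complex.Re z + complex.Re w.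
Proof. by case: z w => [a b] [c d]. Qed.

Lemma Im_add z w : complex.Im (z + w) = complex.Im z + complex.Im w.
Proof. by case: z w => [a b] [c d]. Qed.

Lemma Re_opp z : complex.Re (- z) = - complex.Re z.
Proof. by case: z => [a b]. Qed.

Lemma Im_opp z : complex.Im (- z) = - complex.Im z.
Proof. by case: z => [a b]. Qed.

Lemma complex_ext z w : complex.Re z = complex.Re w ->
  complex.Im z = complex.Im w -> z = w.
Proof. by case: z w => [a b] [c d] /= -> ->. Qed.

Lemma mul_conj_cabs z : z * z^*%C = ((cabs z ^+ 2)%:C : R[i]).
Proof.
apply: complex_ext; rewrite ?Re_mul ?Im_mul cabs_sqr; case: z => a b /=; ring.
Qed.

Lemma cisD (s t : R) : cis (s + t) = cis s * cis t.
Proof.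
by apply: complex_ext; rewrite ?Re_mul ?Im_mul /= ?cosD ?sinD// addrC mulrC.
Qed.

Lemma conj_cis t : (cis t)^*%C = cis (- t).
Proof. by rewrite /cis /= cosN sinN. Qed.

Lemma cis0 : cis (0 : R) = 1.
Proof. by rewrite /cis cos0 sin0. Qed.

End complex_modulus.

Section complex_integral.
Context d (T : measurableType d) (R : realType).
Implicit Types (f g h : T -> R[i]).

Definition cmeas f := measurable_fun setT (fun x => complex.Re (f x)) /\
  measurable_fun setT (fun x => complex.Im (f x)).

Lemma cmeasD f g : cmeas f -> cmeas g -> cmeas (fun x => f x + g x).
Proof.
move=> [f1 f2] [g1 g2]; split.
  under eq_fun do rewrite Re_add; exact: measurable_funD.
under eq_fun do rewrite Im_add; exact: measurable_funD.
Qed.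

Lemma cmeasN f : cmeas f -> cmeas (fun x => - f x).
Proof.
move=> [f1 f2]; split.
  under eq_fun do rewrite Re_opp; exact: measurableT_comp.
under eq_fun do rewrite Im_opp; exact: measurableT_comp.
Qed.

Lemma cmeasB f g : cmeas f -> cmeas g -> cmeas (fun x => f x - g x).
Proof. by move=> mf mg; apply: cmeasD => //; exact: cmeasN. Qed.

Lemma cmeasM f g : cmeas f -> cmeas g -> cmeas (fun x => f x * g x).
Proof.
move=> [f1 f2] [g1 g2]; split.
  by under eq_fun do rewrite Re_mul; apply: measurable_funB; exact: measurable_funM.
by under eq_fun do rewrite Im_mul; apply: measurable_funD; exact: measurable_funM.
Qed.

Lemma cmeas_cst (a : R[i]) : cmeas (fun=> a).
Proof. by split; exact: measurable_cst. Qed.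

Lemma cmeas_conj f : cmeas f -> cmeas (fun x => (f x)^*%C).
Proof.
move=> [f1 f2]; split.
  by rewrite (_ : (fun _ => _) = (fun x => complex.Re (f x)))//;
    apply/funext => x; case: (f x).
rewrite (_ : (fun _ => _) = (fun x => - complex.Im (f x))).
  exact: measurableT_comp.
by apply/funext => x; case: (f x).
Qed.

Lemma cmeas_real (f : T -> R) : measurable_fun setT f ->
  cmeas (fun x => (f x)%:C).
Proof. by move=> mf; split => //=; exact: measurable_cst. Qed.

Lemma cmeas_cis (f : T -> R) : measurable_fun setT f -> cmeas (fun x => cis (f x)).
Proof.
move=> mf; split => /=; apply: (measurableT_comp _ mf).
- by apply: continuous_measurable_fun; exact: continuous_cos.
- by apply: continuous_measurable_fun; exact: continuous_sin.
Qed.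

Lemma cmeas_cabs f : cmeas f -> measurable_fun setT (fun x => cabs (f x)).
Proof.
move=> [f1 f2].
rewrite (_ : (fun _ => _) = Num.sqrt \o (fun x =>
    complex.Re (f x) ^+ 2 + complex.Im (f x) ^+ 2)); last first.
  by apply/funext => x /=; case: (f x).
apply: measurableT_comp.
  by apply: continuous_measurable_fun; exact: sqrt_continuous.
by apply: measurable_funD; exact: measurable_funX.
Qed.

Lemma cmeas_cabs2 f : cmeas f -> measurable_fun setT (fun x => cabs (f x) ^+ 2).
Proof. by move=> mf; apply: measurable_funX; exact: cmeas_cabs. Qed.

Lemma cmeas_indic (A : set T) f : measurable A -> cmeas f ->
  cmeas (fun x => (\1_A x)%:C * f x).
Proof. by move=> mA mf; apply: cmeasM => //; exact: cmeas_real. Qed.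

Lemma cmeas_sum (I : Type) (s : seq I) (F : I -> T -> R[i]) :
  (forall i, cmeas (F i)) -> cmeas (fun x => \sum_(i <- s) F i x).
Proof.
move=> mF; elim: s => [|a s IH].
  by under eq_fun do rewrite big_nil; exact: cmeas_cst.
by under eq_fun do rewrite big_cons; exact: cmeasD.
Qed.

Variable mu : {measure set T -> \bar R}.

(** [cintegral] is the instance of this at Lebesgue measure on R^n, by conversion. A general measure
    is needed for the real line and for product measures. *)
Definition cint f : R[i] :=
  Rintegral mu setT (fun x => complex.Re (f x)) +i*
  Rintegral mu setT (fun x => complex.Im (f x)).

Definition memL1 f := cmeas f /\ (\int[mu]_x (cabs (f x))%:E < +oo)%E.

(** The square of the L^2 norm, possibly infinite. Working with squares avoids roots, and [N2D]
    serves as triangle inequality. *)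
Definition N2 f : \bar R := (\int[mu]_x ((cabs (f x)) ^+ 2)%:E)%E.

Definition memL2 f := cmeas f /\ (N2 f < +oo)%E.

Lemma N2_ge0 f : (0 <= N2 f)%E.
Proof. by apply: integral_ge0 => x _; rewrite lee_fin sqr_ge0. Qed.

Lemma memL1_cabs f : memL1 f -> mu.-integrable setT (fun x => (cabs (f x))%:E).
Proof.
move=> [mf fi]; apply/integrableP; split.
  by apply/measurable_EFinP; exact: cmeas_cabs.
by under eq_integral do rewrite gee0_abs ?lee_fin ?cabs_ge0//.
Qed.

Lemma memL1_le f (g : T -> R) : cmeas f -> mu.-integrable setT (EFin \o g) ->
  (forall x, cabs (f x) <= g x) -> memL1 f.
Proof.
move=> mf gi fg; split => //.
have /integrableP[mg goo] := gi; apply: le_lt_trans goo.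
apply: ge0_le_integral => //.
- by move=> x _; rewrite lee_fin cabs_ge0.
- by apply/measurable_EFinP; exact: cmeas_cabs.
- exact: measurableT_comp.
- by move=> x _; rewrite lee_fin (le_trans (fg x))// ler_norm.
Qed.

Lemma memL1_Re f : memL1 f ->
  mu.-integrable setT (EFin \o (fun x => complex.Re (f x))).
Proof.
move=> fi; apply: le_integrable (memL1_cabs fi) => //.
  by apply/measurable_EFinP; case: fi => -[].
by move=> x _ /=; rewrite lee_fin (le_trans (normr_Re _))// ler_norm.
Qed.

Lemma memL1_Im f : memL1 f ->
  mu.-integrable setT (EFin \o (fun x => complex.Im (f x))).
Proof.
move=> fi; apply: le_integrable (memL1_cabs fi) => //.
  by apply/measurable_EFinP; case: fi => -[].
by move=> x _ /=; rewrite lee_fin (le_trans (normr_Im _))// ler_norm.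
Qed.

Lemma memL1D f g : memL1 f -> memL1 g -> memL1 (fun x => f x + g x).
Proof.
move=> f1 g1; apply: (@memL1_le _ (fun x => cabs (f x) + cabs (g x))).
- by apply: cmeasD; [case: f1|case: g1].
- exact: integrableD (memL1_cabs f1) (memL1_cabs g1).
- by move=> x; exact: ler_cabsD.
Qed.

Lemma memL1M (a : T -> R[i]) f (C : R) : cmeas a -> memL1 f ->
  (forall x, cabs (a x) <= C) -> memL1 (fun x => a x * f x).
Proof.
move=> ma f1 aC; apply: (@memL1_le _ (fun x => C * cabs (f x))).
- by apply: cmeasM => //; case: f1.
- exact: integrableZl (memL1_cabs f1).
- by move=> x; rewrite cabsM ler_wpM2r ?cabs_ge0.
Qed.

Lemma memL1Z (a : R[i]) f : memL1 f -> memL1 (fun x => a * f x).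
Proof. by move=> f1; apply: (@memL1M _ _ (cabs a)) => //; exact: cmeas_cst. Qed.

Lemma memL1N f : memL1 f -> memL1 (fun x => - f x).
Proof.
by move=> /(memL1Z (-1)); under eq_fun do rewrite mulN1r.
Qed.

Lemma memL1B f g : memL1 f -> memL1 g -> memL1 (fun x => f x - g x).
Proof. by move=> f1 g1; apply: memL1D => //; exact: memL1N. Qed.

Lemma memL1_conj f : memL1 f -> memL1 (fun x => (f x)^*%C).
Proof.
move=> [mf fi]; split; first exact: cmeas_conj.
by under eq_integral do rewrite cabs_conj.
Qed.

Lemma cintD f g : memL1 f -> memL1 g ->
  cint (fun x => f x + g x) = cint f + cint g.
Proof.
move=> f1 g1; apply: complex_ext; rewrite /cint ?Re_add ?Im_add /=.
  under eq_Rintegral do rewrite Re_add.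
  by rewrite RintegralD//; exact: memL1_Re.
under eq_Rintegral do rewrite Im_add.
by rewrite RintegralD//; exact: memL1_Im.
Qed.

Lemma cintZ (a : R[i]) f : memL1 f -> cint (fun x => a * f x) = a * cint f.
Proof.
move=> f1; have fr := memL1_Re f1; have fi := memL1_Im f1.
have I (b : R) (u : T -> R) : mu.-integrable setT (EFin \o u) ->
  mu.-integrable setT (EFin \o (fun x => b * u x)).
  by move=> ui; exact: (integrableZl measurableT b ui).
apply: complex_ext; rewrite /cint ?Re_mul ?Im_mul /=.
  under eq_Rintegral do rewrite Re_mul.
  by rewrite RintegralB ?RintegralZl//; exact: I.
under eq_Rintegral do rewrite Im_mul.
by rewrite RintegralD ?RintegralZl//; exact: I.
Qed.

Lemma cintN f : memL1 f -> cint (fun x => - f x) = - cint f.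
Proof.
by move=> f1; rewrite -mulN1r -cintZ//; congr cint; apply/funext => x; rewrite mulN1r.
Qed.

Lemma cintB f g : memL1 f -> memL1 g ->
  cint (fun x => f x - g x) = cint f - cint g.
Proof. by move=> f1 g1; rewrite cintD ?cintN//; exact: memL1N. Qed.

Lemma cint0 : cint (fun=> 0) = 0.
Proof. by rewrite /cint /= /Rintegral integral0. Qed.

Lemma memL1_0 : memL1 (fun=> 0).
Proof.
split; first exact: cmeas_cst.
by under eq_integral do rewrite cabs0; rewrite integral0.
Qed.

Lemma memL1_sum (I : Type) (s : seq I) (F : I -> T -> R[i]) :
  (forall i, memL1 (F i)) -> memL1 (fun x => \sum_(i <- s) F i x).
Proof.
move=> iF; elim: s => [|a s IH].
  by under eq_fun do rewrite big_nil; exact: memL1_0.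
by under eq_fun do rewrite big_cons; exact: memL1D.
Qed.

Lemma cint_sum (I : Type) (s : seq I) (F : I -> T -> R[i]) :
  (forall i, memL1 (F i)) ->
  cint (fun x => \sum_(i <- s) F i x) = \sum_(i <- s) cint (F i).
Proof.
move=> iF; elim: s => [|a s IH].
  by under eq_fun do rewrite big_nil; rewrite cint0 big_nil.
under eq_fun do rewrite big_cons.
by rewrite cintD ?IH ?big_cons//; exact: memL1_sum.
Qed.

Lemma cint_conj f : memL1 f -> cint (fun x => (f x)^*%C) = (cint f)^*%C.
Proof.
move=> f1; apply: complex_ext => /=.
  by apply: eq_Rintegral => x _; case: (f x).
rewrite -mulN1r -RintegralZl//; last exact: memL1_Im.
by apply: eq_Rintegral => x _; rewrite mulN1r; case: (f x).
Qed.

(* The constant 2 is not sharp, but it comes directly from the bounds on the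
   real and on the imaginary part. *)
Lemma cabs_cint f : memL1 f ->
  ((cabs (cint f))%:E <= 2%:E * \int[mu]_x (cabs (f x))%:E)%E.
Proof.
move=> f1; have fr := memL1_Re f1; have fi := memL1_Im f1.
have ic := memL1_cabs f1.
apply: (@le_trans _ _ (`|complex.Re (cint f)| + `|complex.Im (cint f)|)%:E).
  by rewrite lee_fin cabs_le_ReIm.
have bnd (u : T -> R) : mu.-integrable setT (EFin \o u) ->
   (forall x, `|u x| <= cabs (f x)) ->
   (`|Rintegral mu setT u|%:E <= \int[mu]_x (cabs (f x))%:E)%E.
  move=> iu ule; have /integrableP[mu' _] := iu.
  rewrite -[X in (X <= _)%E]/(`|(\int[mu]_x u x)%:E|)%E /Rintegral fineK; last first.
    exact: integrable_fin_num.
  apply: le_trans (le_abse_integral mu measurableT mu') _.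
  apply: ge0_le_integral => //.
  - exact: measurableT_comp.
  - by case/integrableP : ic.
  - by move=> x _; rewrite lee_fin.
rewrite EFinD (_ : 2%:E = (1 + 1)%E); last by rewrite -EFinD.
rewrite ge0_muleDl ?mul1e//.
apply: leeD; apply: bnd => // x; [exact: normr_Re|exact: normr_Im].
Qed.

Lemma memL1_L2M f g : memL2 f -> memL2 g -> memL1 (fun x => f x * g x).
Proof.
move=> [mf f2] [mg g2]; split; first exact: cmeasM.
apply: (@le_lt_trans _ _ (N2 f + N2 g)%E); last exact: lte_add_pinfty.
rewrite /N2 -ge0_integralD//=; last 4 first.
- by move=> x _; rewrite lee_fin sqr_ge0.
- by apply/measurable_EFinP; exact: cmeas_cabs2.
- by move=> x _; rewrite lee_fin sqr_ge0.
- by apply/measurable_EFinP; exact: cmeas_cabs2.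
apply: ge0_le_integral => //.
- by move=> x _; rewrite lee_fin cabs_ge0.
- by apply/measurable_EFinP; apply: cmeas_cabs; exact: cmeasM.
- by apply: emeasurable_funD; apply/measurable_EFinP; exact: cmeas_cabs2.
- by move=> x _; rewrite -EFinD lee_fin cabs_mul_le.
Qed.

Lemma N2Z (a : R[i]) f : cmeas f ->
  N2 (fun x => a * f x) = ((cabs a ^+ 2)%:E * N2 f)%E.
Proof.
move=> mf; rewrite /N2 -ge0_integralZl//=.
- by under eq_integral do rewrite cabsM exprMn EFinM.
- by apply/measurable_EFinP; exact: cmeas_cabs2.
- by move=> x _; rewrite lee_fin sqr_ge0.
- by rewrite lee_fin sqr_ge0.
Qed.

Lemma le_N2 f g : cmeas f -> cmeas g -> (forall x, cabs (f x) <= cabs (g x)) ->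
  (N2 f <= N2 g)%E.
Proof.
move=> mf mg fg; apply: ge0_le_integral => //.
- by move=> x _; rewrite lee_fin sqr_ge0.
- by apply/measurable_EFinP; exact: cmeas_cabs2.
- by apply/measurable_EFinP; exact: cmeas_cabs2.
- by move=> x _; rewrite lee_fin lerXn2r ?nnegrE ?cabs_ge0.
Qed.

(** In the applications with small e, g is the error term: it absorbs the large factor 1 + 1/e while
    f keeps a factor close to 1. *)
Lemma N2D (e : R) f g : 0 < e -> cmeas f -> cmeas g ->
  (N2 (fun x => (f x + g x)%R) <=
   (1 + e)%:E * N2 f + (1 + e^-1)%:E * N2 g)%E.
Proof.
move=> e0 mf mg; have e1 : 0 <= 1 + e by lra.
have e2 : 0 <= 1 + e^-1 by rewrite addr_ge0// invr_ge0 ltW.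
have m h : cmeas h -> measurable_fun setT (fun x => (cabs (h x) ^+ 2)%:E).
  by move=> mh; apply/measurable_EFinP; exact: cmeas_cabs2.
rewrite /N2 -!ge0_integralZl//=; try exact: m.
rewrite -ge0_integralD//=.
- apply: ge0_le_integral => //.
  + by move=> x _; rewrite lee_fin sqr_ge0.
  + by apply: m; exact: cmeasD.
  + by apply: emeasurable_funD; apply: emeasurable_funM => //; exact: m.
  + by move=> x _; rewrite -!EFinM -EFinD lee_fin cabs_sqrD.
- by move=> x _; rewrite -EFinM lee_fin mulr_ge0// sqr_ge0.
- by apply: emeasurable_funM => //; exact: m.
- by move=> x _; rewrite -EFinM lee_fin mulr_ge0// sqr_ge0.
- by apply: emeasurable_funM => //; exact: m.
- by move=> x _; rewrite lee_fin sqr_ge0.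
- by move=> x _; rewrite lee_fin sqr_ge0.
Qed.

Lemma memL2D f g : memL2 f -> memL2 g -> memL2 (fun x => f x + g x).
Proof.
move=> [mf f2] [mg g2]; split; first exact: cmeasD.
apply: le_lt_trans (N2D (@ltr01 R) mf mg) _.
by rewrite lte_add_pinfty// lte_mul_pinfty// ?lee_fin ?invr1 ?addr_ge0.
Qed.

Lemma memL2M (a : T -> R[i]) f (C : R) : cmeas a -> memL2 f ->
  (forall x, cabs (a x) <= C) -> memL2 (fun x => a x * f x).
Proof.
move=> ma [mf f2] aC; split; first exact: cmeasM.
apply: (@le_lt_trans _ _ (N2 (fun x => C%:C * f x))).
  apply: le_N2; [exact: cmeasM|apply: cmeasM => //; exact: cmeas_cst|move=> x].
  by rewrite !cabsM ler_wpM2r ?cabs_ge0// cabs_real (le_trans (aC x))// ler_norm.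
by rewrite N2Z// lte_mul_pinfty// lee_fin sqr_ge0.
Qed.

Lemma memL2Z (a : R[i]) f : memL2 f -> memL2 (fun x => a * f x).
Proof. by move=> f1; apply: (@memL2M _ _ (cabs a)) => //; exact: cmeas_cst. Qed.

Lemma memL2N f : memL2 f -> memL2 (fun x => - f x).
Proof. by move=> /(memL2Z (-1)); under eq_fun do rewrite mulN1r. Qed.

Lemma memL2B f g : memL2 f -> memL2 g -> memL2 (fun x => f x - g x).
Proof. by move=> f1 g1; apply: memL2D => //; exact: memL2N. Qed.

Lemma memL2_conj f : memL2 f -> memL2 (fun x => (f x)^*%C).
Proof.
move=> [mf fi]; split; first exact: cmeas_conj.
by rewrite /N2; under eq_integral do rewrite cabs_conj.
Qed.

Lemma N2B f g : N2 (fun x => f x - g x) = N2 (fun x => g x - f x).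
Proof. by rewrite /N2; under eq_integral do rewrite cabsB. Qed.

(** The factor 2 of [cabs_cint] is absorbed by 2 a b <= a^2 / e + e b^2. *)
Lemma cint_mul_bound (e : R) f g : 0 < e -> memL2 f -> memL2 g ->
  ((cabs (cint (fun x => f x * g x)))%:E <=
   (e^-1)%:E * N2 f + e%:E * N2 g)%E.
Proof.
move=> e0 f2 g2; have ei0 : 0 <= e^-1 by rewrite invr_ge0 ltW.
have mf := f2.1; have mg := g2.1.
have m h : cmeas h -> measurable_fun setT (fun x => (cabs (h x) ^+ 2)%:E).
  by move=> mh; apply/measurable_EFinP; exact: cmeas_cabs2.
apply: le_trans (cabs_cint (memL1_L2M f2 g2)) _.
have mfg : measurable_fun setT (fun x => (cabs (f x * g x))%:E).
  by apply/measurable_EFinP; apply: cmeas_cabs; exact: cmeasM.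
rewrite /N2 -!ge0_integralZl//=; try exact: m; try by rewrite lee_fin ltW.
  rewrite -ge0_integralD//=.
  - apply: ge0_le_integral => //.
    + by move=> x _; rewrite -EFinM lee_fin mulr_ge0// cabs_ge0.
    + by apply: emeasurable_funM.
    + by apply: emeasurable_funD; apply: emeasurable_funM => //; exact: m.
    + move=> x _; rewrite -!EFinM -EFinD lee_fin cabsM -subr_ge0.
      set a := cabs _; set b := cabs _.
      have -> : e^-1 * a ^+ 2 + e * b ^+ 2 - 2 * (a * b) =
        e^-1 * (a - e * b) ^+ 2 by field; rewrite gt_eqF.
      by rewrite mulr_ge0// sqr_ge0.
  - by move=> x _; rewrite -EFinM lee_fin mulr_ge0// sqr_ge0.
  - by apply: emeasurable_funM => //; exact: m.
  - by move=> x _; rewrite -EFinM lee_fin mulr_ge0// ?sqr_ge0// ltW.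
  - by apply: emeasurable_funM => //; exact: m.
- by move=> x _; rewrite lee_fin cabs_ge0.
- by move=> x _; rewrite lee_fin sqr_ge0.
- by move=> x _; rewrite lee_fin sqr_ge0.
Qed.

Lemma eq_cint f g : (forall x, f x = g x) -> cint f = cint g.
Proof. by move=> /funext ->. Qed.

Lemma cint_L2_cvg (F : nat -> T -> R[i]) f g : (forall k, memL2 (F k)) ->
  memL2 f -> memL2 g -> N2 (fun x => F k x - f x) @[k --> \oo] --> 0%E ->
  cabs (cint (fun x => F k x * g x) - cint (fun x => f x * g x)) @[k --> \oo]
  --> (0 : R).
Proof.
move=> F2 f2 g2 F0; apply/cvgr0Pnorm_lt => e e0.
have Ng : (N2 g \is a fin_num)%E.
  by rewrite ge0_fin_numE ?N2_ge0//; case: g2.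
pose G := fine (N2 g); have G0 : 0 <= G by rewrite fine_ge0// N2_ge0.
(* With this weight the term in [N2 g] is at most e / 2, and the other one is below e / 2 once
   [N2 (F k - f)] is below h e / 2. *)
pose h := e / (2 * (G + 1)).
have h0 : 0 < h by rewrite divr_gt0// mulr_gt0// ltr_wpDl.
have : \forall k \near \oo, (N2 (fun x => F k x - f x)%R < (h * (e / 2))%:E)%E.
  have pos : (0 < (h * (e / 2))%:E)%E by rewrite lte_fin mulr_gt0// divr_gt0.
  apply: (F0 (fun y => (y < (h * (e / 2))%:E)%E)).
  exact: open_ereal_lt'.
apply: filterS => k Fk; rewrite ger0_norm ?cabs_ge0//.
rewrite -cintB; try exact: memL1_L2M.
rewrite (@eq_cint _ (fun x => (F k x - f x) * g x)); last by move=> x; ring.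
rewrite -lte_fin.
have FB2 : memL2 (fun x => F k x - f x) by exact: memL2B.
apply: le_lt_trans (cint_mul_bound h0 FB2 g2) _.
have -> : e%:E = ((h^-1)%:E * (h * (e / 2))%:E + (e/2)%:E)%E.
  by rewrite -EFinM -EFinD; congr EFin; field; rewrite ?gt_eqF// ltr_wpDl.
apply: lte_leD => //.
- by rewrite fin_numM// ge0_fin_numE ?N2_ge0//; case: FB2.
- by rewrite lte_pmul2l// ?lte_fin invr_gt0.
- rewrite -(fineK Ng) -EFinM lee_fin -/G /h.
  rewrite mulrAC ler_pdivrMr ?mulr_gt0 ?ltr_wpDl//; nra.
Qed.

End complex_integral.

(** * Fubini's theorem for complex integrals *)

Section complex_fubini.
Context d1 d2 (T1 : measurableType d1) (T2 : measurableType d2) (R : realType).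
Variable m1 : {sigma_finite_measure set T1 -> \bar R}.
Variable m2 : {sigma_finite_measure set T2 -> \bar R}.
Local Notation m12 := (m1 \x m2)%E.

(** Every section, not only almost every one, is assumed integrable, so that the inner integral is
    finite at each point and [fine] loses nothing. *)
Let Rintegral12 (f : T1 * T2 -> R) : m12.-integrable setT (EFin \o f) ->
  (forall x, m2.-integrable setT (EFin \o (fun y => f (x, y)))) ->
  Rintegral m12 setT f =
  Rintegral m1 setT (fun x => Rintegral m2 setT (fun y => f (x, y))).
Proof.
move=> f1 fx; rewrite /Rintegral; congr fine.
rewrite -(integral12_prod_meas1 f1); apply: eq_integral => x _ /=.
by rewrite /fubini_F fineK//; exact: integrable_fin_num (fx x).
Qed.

Let Rintegral21 (f : T1 * T2 -> R) : m12.-integrable setT (EFin \o f) ->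
  (forall y, m1.-integrable setT (EFin \o (fun x => f (x, y)))) ->
  Rintegral m12 setT f =
  Rintegral m2 setT (fun y => Rintegral m1 setT (fun x => f (x, y))).
Proof.
move=> f1 fy; rewrite /Rintegral; congr fine.
rewrite -(integral21_prod_meas1 f1); apply: eq_integral => y _ /=.
by rewrite /fubini_G fineK//; exact: integrable_fin_num (fy y).
Qed.

Lemma cint12 (f : T1 * T2 -> R[i]) : memL1 m12 f ->
  (forall x, memL1 m2 (fun y => f (x, y))) ->
  cint m12 f = cint m1 (fun x => cint m2 (fun y => f (x, y))).
Proof.
move=> f1 fx; apply: complex_ext => /=.
  by apply: Rintegral12; [exact: memL1_Re|move=> x; exact: memL1_Re (fx x)].
by apply: Rintegral12; [exact: memL1_Im|move=> x; exact: memL1_Im (fx x)].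
Qed.

Lemma cint21 (f : T1 * T2 -> R[i]) : memL1 m12 f ->
  (forall y, memL1 m1 (fun x => f (x, y))) ->
  cint m12 f = cint m2 (fun y => cint m1 (fun x => f (x, y))).
Proof.
move=> f1 fx; apply: complex_ext => /=.
  by apply: Rintegral21; [exact: memL1_Re|move=> x; exact: memL1_Re (fx x)].
by apply: Rintegral21; [exact: memL1_Im|move=> x; exact: memL1_Im (fx x)].
Qed.

Lemma cmeas_comp d (T : measurableType d) d' (T' : measurableType d')
  (f : T' -> R[i]) (g : T -> T') : measurable_fun setT g -> cmeas f ->
  cmeas (fun x => f (g x)).
Proof.
by move=> mg [f1 f2]; split; [exact: measurableT_comp f1 mg|exact: measurableT_comp f2 mg].
Qed.

Lemma memL1_prod (f : T1 -> R[i]) (g : T2 -> R[i]) : memL1 m1 f -> memL1 m2 g ->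
  memL1 m12 (fun z => f z.1 * g z.2).
Proof.
move=> [mf fi] [mg gi].
have mfg : cmeas (fun z : T1 * T2 => f z.1 * g z.2).
  by apply: cmeasM; [exact: cmeas_comp|exact: cmeas_comp].
split => //.
rewrite fubini_tonelli1//; last 2 first.
- by apply/measurable_EFinP; exact: cmeas_cabs.
- by move=> z; rewrite lee_fin cabs_ge0.
rewrite /fubini_F /=.
under eq_integral.
  move=> x _.
  under eq_integral do rewrite cabsM EFinM.
  rewrite ge0_integralZl//=; last 3 first.
  - by apply/measurable_EFinP; exact: cmeas_cabs.
  - by move=> y _; rewrite lee_fin cabs_ge0.
  - by rewrite lee_fin cabs_ge0.
  over.
rewrite ge0_integralZr//=; last 3 first.
- by apply/measurable_EFinP; exact: cmeas_cabs.
- by move=> y _; rewrite lee_fin cabs_ge0.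
- by apply: integral_ge0 => y _; rewrite lee_fin cabs_ge0.
rewrite lte_mul_pinfty//.
- by apply: integral_ge0 => y _; rewrite lee_fin cabs_ge0.
- rewrite ge0_fin_numE//.
  by apply: integral_ge0 => y _; rewrite lee_fin cabs_ge0.
Qed.

End complex_fubini.

(** * Integration over R^n one coordinate at a time *)

Section integral_rV.
Context {R : realType}.
Local Notation leb := (@lebesgue_measure R).

Lemma ge0_integral_rV_cons n (f : 'rV[R]_n.+1 -> \bar R) :
  measurable_fun setT f -> (forall x, 0 <= f x)%E ->
  (\int[lebesgue_rV n.+1]_x f x =
   \int[(leb \x lebesgue_rV n)%E]_p f (rV_cons p))%E.
Proof.
move=> mf f0.
rewrite (eq_measure_integral
  (pushforward (leb \x lebesgue_rV n)%E (@rV_cons R n))) //.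
  exact: measurable_rV_cons.
by move=> mc; rewrite ge0_integral_pushforward.
Qed.

Lemma integrable_rV_cons n (f : 'rV[R]_n.+1 -> R) : measurable_fun setT f ->
  (leb \x lebesgue_rV n)%E.-integrable setT (EFin \o (fun p => f (rV_cons p))) ->
  Rintegral (lebesgue_rV n.+1) setT f =
  Rintegral (leb \x lebesgue_rV n)%E setT (fun p => f (rV_cons p)).
Proof.
move=> mf fi; rewrite /Rintegral; congr fine.
rewrite (eq_measure_integral
  (pushforward (leb \x lebesgue_rV n)%E (@rV_cons R n))) //.
  exact: measurable_rV_cons.
by move=> mc; rewrite integral_pushforward//; exact/measurable_EFinP.
Qed.

Lemma memL1_rV_cons n (f : 'rV[R]_n.+1 -> R[i]) : cmeas f ->
  memL1 (leb \x lebesgue_rV n)%E (fun p => f (rV_cons p)) ->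
  memL1 (lebesgue_rV n.+1) f /\ cint (lebesgue_rV n.+1) f =
  cint (leb \x lebesgue_rV n)%E (fun p => f (rV_cons p)).
Proof.
move=> mf fi; split.
  split => //; rewrite ge0_integral_rV_cons//; first by case: fi.
    by apply/measurable_EFinP; exact: cmeas_cabs.
  by move=> x; rewrite lee_fin cabs_ge0.
apply: complex_ext => /=; apply: integrable_rV_cons; first by case: mf.
- exact: memL1_Re.
- by case: mf.
- exact: memL1_Im.
Qed.

Lemma rV_cons0 n (t : R) (x : 'rV[R]_n) : rV_cons (t, x) ord0 ord0 = t.
Proof. by rewrite /rV_cons mxE unlift_none. Qed.

Lemma rV_consS n (t : R) (x : 'rV[R]_n) i :
  rV_cons (t, x) ord0 (lift ord0 i) = x ord0 i.
Proof. by rewrite /rV_cons mxE liftK. Qed.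

Lemma cmeas_rV_prod n (h : 'I_n -> R -> R[i]) : (forall i, cmeas (h i)) ->
  cmeas (fun x : 'rV[R]_n => \prod_(i < n) h i (x ord0 i)).
Proof.
move=> mh; elim: (index_enum _) => [|i s IH].
  by under eq_fun do rewrite big_nil; exact: cmeas_cst.
under eq_fun do rewrite big_cons; apply: cmeasM => //.
have [h1 h2] := mh i.
by split; [exact: measurableT_comp h1 (measurable_coord i)|
           exact: measurableT_comp h2 (measurable_coord i)].
Qed.

(** Separation of variables, by induction on the dimension; in dimension 0 the measure is a Dirac
    mass and both sides are empty products. It carries the computations on the line over to boxes
    and to [weight]. *)
Lemma cint_rV_prod n (h : 'I_n -> R -> R[i]) : (forall i, memL1 leb (h i)) ->
  memL1 (lebesgue_rV n) (fun x : 'rV[R]_n => \prod_(i < n) h i (x ord0 i)) /\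
  cint (lebesgue_rV n) (fun x : 'rV[R]_n => \prod_(i < n) h i (x ord0 i)) =
  \prod_(i < n) cint leb (h i).
Proof.
elim: n h => [|n IH] h h1.
  have E0 : (fun x : 'rV[R]_0 => \prod_(i < 0) h i (x ord0 i)) = cst 1.
    by apply/funext => x; rewrite big_ord0.
  rewrite big_ord0 E0; split.
    split; first exact: cmeas_cst.
    by rewrite integral_dirac//= diracT mul1e ltry.
  by apply: complex_ext; rewrite /cint /Rintegral /= integral_dirac// diracT mul1e.
have [i1 c1] := IH (fun i => h (lift ord0 i)) (fun i => h1 (lift ord0 i)).
have mh : cmeas (fun x : 'rV[R]_n.+1 => \prod_(i < n.+1) h i (x ord0 i)).
  by apply: cmeas_rV_prod => i; case: (h1 i).
have E : (fun p : measurableTypeR R * 'rV[R]_n =>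
      \prod_(i < n.+1) h i (rV_cons p ord0 i)) =
    (fun p => h ord0 p.1 * \prod_(i < n) h (lift ord0 i) (p.2 ord0 i)).
  apply/funext => -[t x]; rewrite big_ord_recl rV_cons0; congr (_ * _).
  by apply: eq_bigr => i _; rewrite rV_consS.
have iE := memL1_prod (h1 ord0) i1.
have [|i2 c2] := memL1_rV_cons mh; first by rewrite E.
split=> //; rewrite c2 E cint12//=; last by move=> t; exact: memL1Z.
under eq_cint do rewrite cintZ// c1 mulrC.
by rewrite cintZ// big_ord_recl mulrC.
Qed.

End integral_rV.

(** * Plancherel for intervals *)

Section sinc_squared.
Context {R : realType}.
Local Notation leb := (@lebesgue_measure R).
Implicit Types s t x y : R.

(** At x = 0 the value is 0 instead of the limit t^2 / 2, the inverse of 0 being 0. The function is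
    thus discontinuous there, and the identities below are stated for x != 0. *)
Definition cosquot t x : R := (1 - cos (t * x)) / x ^+ 2.

Lemma cosquot_ge0 t x : 0 <= cosquot t x.
Proof. by rewrite divr_ge0 ?sqr_ge0// subr_ge0 cos_le1. Qed.

Lemma measurable_cos_mul t : measurable_fun setT (fun x => cos (t * x)).
Proof.
apply: continuous_measurable_fun => x; apply: continuous_comp.
  exact: mulrl_continuous.
exact: continuous_cos.
Qed.

Lemma measurable_sqrV : measurable_fun setT (fun x => (x ^+ 2)^-1 : R).
Proof.
rewrite -(setUv [set 0 : R]); apply/measurable_funU => //.
  exact: measurableC.
split; first exact: measurable_fun_set1.
apply: open_continuous_measurable_fun.
  exact/closed_openC/accessible_closed_set1/hausdorff_accessible/Rhausdorff.
move=> x /set_mem /= /eqP x0; apply: cvgV; first by rewrite expf_neq0.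
exact: exprn_continuous.
Qed.

Lemma measurable_cosquot t : measurable_fun setT (cosquot t).
Proof.
apply: measurable_funM; last exact: measurable_sqrV.
by apply: measurable_funB => //; exact: measurable_cos_mul.
Qed.

Lemma cvg_expRN_mul x : 0 < x -> expR (- (x * s)) @[s --> +oo] --> (0 : R).
Proof.
move=> x0; rewrite (_ : (fun s => _) = (fun z => expR (- z)) \o (fun z => x * z))//.
apply: (@cvg_comp _ _ _ _ _ _ (pinfty_nbhs R)); last exact: cvgr_expR.
exact: gt0_cvgMry.
Qed.

(** Half of the exponent absorbs the factor s, because y <= e^y at y = x s / 2. *)
Lemma cvg_mul_expRN x : 0 < x -> s * expR (- (x * s)) @[s --> +oo] --> (0 : R).
Proof.
move=> x0; have x2 : 0 < x / 2 by rewrite divr_gt0.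
apply: (@squeeze_cvgr _ _ _ _ (fun=> 0) (fun s => (x / 2)^-1 * expR (- (x / 2 * s)))).
- near=> s; have s0 : 0 <= s by near: s; exact: nbhs_pinfty_ge.
  rewrite mulr_ge0 ?expR_ge0//= [X in expR (- X)](_ : _ = x / 2 * s + x / 2 * s).
    rewrite opprD expRD mulrA ler_wpM2r ?expR_ge0// expRN ler_pdivrMr ?expR_gt0//.
    rewrite ler_pdivlMl//; apply: le_trans (expR_ge1Dx _); lra.
  by rewrite -mulrDl -splitr.
- exact: cvg_cst.
- rewrite -[X in _ --> X](mulr0 (x / 2)^-1); apply: cvgMl_tmp.
  exact: cvg_expRN_mul.
Unshelve. all: by end_near. Qed.

Lemma is_derive_split (F : R -> R) x (l : R) :
  is_derive x 1 F l -> derivable F x 1 /\ 'D_1 F x = l.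
Proof. by case. Qed.

Lemma derivable_continuous (F : R -> R) : (forall x, derivable F x 1) -> continuous F.
Proof. by move=> dF x; apply: differentiable_continuous; exact/derivable1_diffP. Qed.

Lemma continuous_FTC2y (f F : R -> R) (l : R) :
  (forall x, 0 <= x -> 0 <= f x) -> continuous f ->
  (forall x, derivable F x 1 /\ 'D_1 F x = f x) -> F x @[x --> +oo] --> l ->
  (\int[leb]_(x in `[0%R, +oo[) (f x)%:E = (l - F 0)%:E)%E.
Proof.
move=> f0 cf dF Fl; rewrite (ge0_continuous_FTC2y _ _ Fl)//=.
- exact: continuous_subspaceT.
- by move=> x _; case: (dF x).
- apply: cvg_at_right_filter; apply: differentiable_continuous.
  by apply/derivable1_diffP; case: (dF 0).
- by move=> x _; rewrite derive1E; case: (dF x).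
Qed.

(** This writes 1 / x^2 as a superposition of exponentials, against which 1 - cos(t x) has an
    elementary integral. *)
Lemma integral_mul_expRN x : 0 < x ->
  (\int[leb]_(s in `[0%R, +oo[) (s * expR (- (x * s)))%:E = ((x ^+ 2)^-1)%:E)%E.
Proof.
move=> x0; have x1 : x != 0 by rewrite gt_eqF.
rewrite (@continuous_FTC2y _
  (fun s => - (x^-1 * (s * expR (- (x * s))) + (x ^+ 2)^-1 * expR (- (x * s)))) 0); last 4 first.
- by move=> s s0; rewrite mulr_ge0// expR_ge0.
- by apply: derivable_continuous => s; apply: ex_derive.
- move=> s; apply: is_derive_split; apply: is_derive_eq.
  by rewrite /GRing.scale /= mulr1; field.
- rewrite -oppr0; apply: cvgN; rewrite -[X in _ --> X]addr0; apply: cvgD.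
    rewrite -[X in _ --> X](mulr0 x^-1); apply: cvgMl_tmp; exact: cvg_mul_expRN.
  rewrite -[X in _ --> X](mulr0 (x ^+ 2)^-1); apply: cvgMl_tmp.
  exact: cvg_expRN_mul.
- by congr EFin; rewrite !mulr0 oppr0 expR0 mul0r; field.
Qed.

Lemma integral_cos_expRN t s : 0 < s ->
  (\int[leb]_(x in `[0%R, +oo[) (s * (1 - cos (t * x)) * expR (- (s * x)))%:E =
   (t ^+ 2 / (s ^+ 2 + t ^+ 2))%:E)%E.
Proof.
move=> s0; have D0 : s ^+ 2 + t ^+ 2 != 0.
  by rewrite gt_eqF// ltr_wpDr ?sqr_ge0// exprn_gt0.
rewrite (@continuous_FTC2y _ (fun x => - expR (- (s * x)) +
   - (s / (s ^+ 2 + t ^+ 2) *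
      ((t * sin (t * x) - s * cos (t * x)) * expR (- (s * x))))) 0); last 4 first.
- by move=> x x0; rewrite !mulr_ge0 ?expR_ge0 ?subr_ge0 ?cos_le1// ltW.
- by apply: derivable_continuous => x; apply: ex_derive.
- move=> x; apply: is_derive_split; apply: is_derive_eq.
  by rewrite /GRing.scale /= !mulr1; field.
- rewrite -[X in _ --> X]addr0 -[X in _ --> X + _]oppr0; apply: cvgD.
    by apply: cvgN; exact: cvg_expRN_mul.
  rewrite -oppr0; apply: cvgN.
  rewrite -[X in _ --> X](mulr0 (s / (s ^+ 2 + t ^+ 2))); apply: cvgMl_tmp.
  have E0 := cvg_expRN_mul s0.
  apply/cvgr0Pnorm_le => e e0.
  have eC : 0 < e / (`|t| + `|s| + 1) by rewrite divr_gt0// ltr_wpDl// addr_ge0.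
  have /cvgr0Pnorm_le/(_ _ eC) := E0; apply: filterS => x.
  rewrite ler_pdivlMr ?ltr_wpDl ?addr_ge0// => /(le_trans _); apply.
  rewrite normrM mulrC ler_wpM2l//.
  apply: le_trans (ler_normB _ _) _; rewrite !normrM.
  apply: (@le_trans _ _ (`|t| * 1 + `|s| * 1)); last lra.
  by rewrite lerD// ler_wpM2l// ler_norml ?sin_geN1 ?sin_le1 ?cos_geN1 ?cos_le1.
- by congr EFin; rewrite !mulr0 oppr0 expR0 sin0 cos0; field.
Qed.

Lemma integral_atan_scale t : 0 < t ->
  (\int[leb]_(s in `[0%R, +oo[) (t ^+ 2 / (s ^+ 2 + t ^+ 2))%:E =
   (pi / 2 * t)%:E)%E.
Proof.
move=> t0; have t1 : t != 0 by rewrite gt_eqF.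
have D0 s : s ^+ 2 + t ^+ 2 != 0.
  by rewrite gt_eqF// ltr_wpDl ?sqr_ge0// exprn_gt0.
rewrite (@continuous_FTC2y _ (fun s => t * atan (t^-1 * s)) (t * (pi / 2))); last 4 first.
- by move=> s _; rewrite divr_ge0 ?addr_ge0 ?sqr_ge0.
- move=> s; apply: cvgM; first exact: cvg_cst.
  apply: cvgV => //; apply: cvgD; last exact: cvg_cst.
  exact: exprn_continuous.
- move=> s; apply: is_derive_split; apply: is_derive_eq.
  have D1 : 1 + (t^-1 * s) ^+ 2 != 0 by rewrite gt_eqF// ltr_wpDr ?sqr_ge0.
  rewrite /GRing.scale /= !mulr1; field.
  by rewrite D0 t1.
- apply: cvgMl_tmp.
  apply: (@cvg_comp _ _ _ _ _ _ (pinfty_nbhs R)); last exact: cvgy_atan.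
  by apply: gt0_cvgMry => //; rewrite invr_gt0.
- by congr EFin; rewrite mulr0 atan0; ring.
Qed.

End sinc_squared.

Section sinc_integrals.
Context {R : realType}.
Local Notation leb := (@lebesgue_measure R).
Implicit Types a b c d s t x y : R.

Let pos : set R := `]0, +oo[.

Let indic_pos (x : R) : (\1_pos x : R) = (0 < x)%R%:R.
Proof. by rewrite indicE; congr ((_ : bool)%:R); apply/idP/idP;
  rewrite inE /pos /= in_itv/= andbT. Qed.

Let integral_pos (f : R -> R) : measurable_fun setT f ->
  (\int[leb]_x (\1_pos x * f x)%:E = \int[leb]_(x in `[0%R, +oo[) (f x)%:E)%E.
Proof.
move=> mf; rewrite -integral_itv_obnd_cbnd; last first.
  by apply/measurable_EFinP; exact: measurable_funTS.
rewrite [RHS]integral_mkcond; apply: eq_integral => x _.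
by rewrite epatch_indic /= mulrC EFinM.
Qed.

Let measurable_expRM s : measurable_fun setT (fun x => expR (- (s * x))).
Proof.
apply: continuous_measurable_fun; apply: derivable_continuous => x.
exact: ex_derive.
Qed.

Let integral_cosquot_kernel t x : 0 < x ->
  (\int[leb]_(s in `[0%R, +oo[) (s * (1 - cos (t * x)) * expR (- (s * x)))%:E =
   (cosquot t x)%:E)%E.
Proof.
move=> x0.
transitivity (\int[leb]_(s in `[0%R, +oo[)
    ((1 - cos (t * x))%:E * (s * expR (- (x * s)))%:E))%E.
  apply: eq_integral => s _; rewrite -EFinM; congr EFin.
  by rewrite (mulrC x s); ring.
rewrite ge0_integralZl_EFin.
- by rewrite integral_mul_expRN// -EFinM.
- exact: measurable_itv.
- move=> s /=; rewrite in_itv/= andbT => s0.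
  by rewrite lee_fin mulr_ge0 ?expR_ge0.
- apply/measurable_EFinP; apply: measurable_funTS.
  by apply: measurable_funM; [exact: measurable_id|exact: measurable_expRM].
- by rewrite subr_ge0 cos_le1.
Qed.

Let measurable_quot t : 0 < t ->
  measurable_fun setT (fun s => t ^+ 2 / (s ^+ 2 + t ^+ 2)).
Proof.
move=> t0; apply: continuous_measurable_fun => s; apply: cvgM.
  exact: cvg_cst.
apply: cvgV; first by rewrite gt_eqF// ltr_wpDl ?sqr_ge0// exprn_gt0.
by apply: cvgD; [exact: exprn_continuous|exact: cvg_cst].
Qed.

Let measurable_kernel s t :
  measurable_fun setT (fun x => s * (1 - cos (t * x)) * expR (- (s * x))).
Proof.
apply: measurable_funM; last exact: measurable_expRM.
by apply: measurable_funM => //; apply: measurable_funB => //; exact: measurable_cos_mul.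
Qed.

(** Tonelli for the nonnegative kernel s (1 - cos(t x)) e^(-s x) on the quadrant: integrating first
    in s gives [cosquot t x], integrating first in x gives t^2 / (s^2 + t^2), whose primitive is an
    arctangent. *)
Lemma integral_cosquot_pos t :
  (\int[leb]_(x in `[0%R, +oo[) (cosquot t x)%:E = (pi / 2 * `|t|)%:E)%E.
Proof.
wlog t0 : t / 0 < t => [H|].
  have [|t0|->] := ltrgt0P t; first by move=> t0; rewrite H ?gtr0_norm.
  - have E x : cosquot t x = cosquot (- t) x by rewrite /cosquot mulNr cosN.
    under eq_integral do rewrite E.
    by rewrite H ?oppr_gt0// gtr0_norm ?oppr_gt0.
  - rewrite mulr0 integral0_eq// => x _.
    by rewrite /cosquot mul0r cos0 subrr mul0r.
rewrite gtr0_norm// -integral_pos; last exact: measurable_cosquot.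
(* The indicators extend the kernel by 0 to the whole plane, where Tonelli's theorem is stated. *)
pose h (p : R * R) := (\1_pos p.1 * \1_pos p.2 *
  (p.2 * (1 - cos (t * p.1)) * expR (- (p.2 * p.1))) : R).
have mi : measurable_fun setT (\1_pos : R -> R).
  by apply: measurable_indic; exact: measurable_itv.
have mh : measurable_fun setT (EFin \o h).
  have m1 : measurable_fun setT (fst : R * R -> R) by exact: measurable_fst.
  have m2 : measurable_fun setT (snd : R * R -> R) by exact: measurable_snd.
  apply/measurable_EFinP; apply: measurable_funM.
    apply: measurable_funM.
      exact: (measurableT_comp mi m1).
    exact: (measurableT_comp mi m2).
  apply: measurable_funM.
    apply: measurable_funM => //; apply: measurable_funB => //.
    exact: measurableT_comp (measurable_cos_mul t) m1.
  apply: measurableT_comp; first exact: measurable_expR.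
  by apply: measurableT_comp => //; exact: measurable_funM.
have h0 p : (0 <= (EFin \o h) p)%E.
  rewrite /= lee_fin /h !indic_pos.
  have [p1|p1] := ltP 0 p.1; last by rewrite mul0r mul0r.
  have [p2|p2] := ltP 0 p.2; last by rewrite mulr0 mul0r.
  by rewrite !mulr_ge0 ?expR_ge0 ?subr_ge0 ?cos_le1// ltW.
have /= E := @fubini_tonelli _ _ (measurableTypeR R) (measurableTypeR R) R
  leb leb (EFin \o h) mh h0.
transitivity (\int[leb]_x \int[leb]_y (h (x, y))%:E)%E.
  apply: eq_integral => x _; rewrite /h /=.
  have [x0|x0] := ltP 0 x; last first.
    have i0 : \1_pos x = 0 :> R by rewrite indic_pos ltNge x0.
    rewrite i0 mul0r; apply/esym; apply: integral0_eq => y _.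
    by rewrite !mul0r.
  have i1 : \1_pos x = 1 :> R by rewrite indic_pos x0.
  rewrite i1 mul1r; under eq_integral do rewrite mul1r.
  rewrite integral_pos; last first.
    apply: measurable_funM; first exact: measurable_funM.
    by under eq_fun do rewrite mulrC; exact: measurable_expRM.
  exact/esym/integral_cosquot_kernel.
rewrite E -(integral_atan_scale t0).
rewrite -[RHS](@integral_pos (fun s => t ^+ 2 / (s ^+ 2 + t ^+ 2))); last first.
  exact: measurable_quot.
apply: eq_integral => s _; rewrite /h /=.
have [s0|s0] := ltP 0 s; last first.
  have i0 : \1_pos s = 0 :> R by rewrite indic_pos ltNge s0.
  rewrite i0 mul0r; apply: integral0_eq => y _.
  by rewrite mulr0 mul0r.
have i1 : \1_pos s = 1 :> R by rewrite indic_pos s0.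
rewrite i1 mul1r; under eq_integral do rewrite mulr1.
by rewrite integral_pos; [rewrite integral_cos_expRN|exact: measurable_kernel].
Qed.

Lemma integral_cosquot t : (\int[leb]_x (cosquot t x)%:E = (pi * `|t|)%:E)%E.
Proof.
have mc := measurable_cosquot t.
rewrite -(setUv `[0%R, +oo[%classic) ge0_integral_setU//=; last 4 first.
- exact: measurableC.
- by apply/measurable_EFinP; rewrite setUv.
- by move=> x _; rewrite lee_fin cosquot_ge0.
- exact/disj_setPCl.
rewrite setCitvr integral_itv_bndo_bndc; last first.
  by apply/measurable_EFinP; exact: measurable_funTS.
have -> : (\int[leb]_(x in `]-oo, 0%R]) (cosquot t x)%:E =
    \int[leb]_(x in `[0%R, +oo[) (cosquot t x)%:E)%E.
  rewrite (@ge0_integration_by_substitution0 R (fun x => (cosquot t x)%:E)).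
  - apply: eq_integral => x _; congr EFin.
    by rewrite /cosquot mulrN cosN sqrrN.
  - exact/measurable_EFinP.
  - by move=> r; rewrite lee_fin cosquot_ge0.
by rewrite integral_cosquot_pos -EFinD; congr EFin; field.
Qed.

Lemma integrable_cosquot t : leb.-integrable setT (EFin \o cosquot t).
Proof.
apply/integrableP; split.
  by apply/measurable_EFinP; exact: measurable_cosquot.
under eq_integral do rewrite /= ger0_norm ?cosquot_ge0//.
by rewrite integral_cosquot ltry.
Qed.

Lemma Rintegral_odd (f : R -> R) : leb.-integrable setT (EFin \o f) ->
  (forall x, f (- x) = - f x) -> Rintegral leb setT f = 0.
Proof.
move=> fi fodd; suff : Rintegral leb setT f = - Rintegral leb setT f.
  by move/eqP; rewrite -addr_eq0 -mulr2n mulrn_eq0 /= => /eqP.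
have mN : measurable_fun setT (-%R : measurableTypeR R -> measurableTypeR R).
  by apply: continuous_measurable_fun => x; apply: cvgN; exact: cvg_id.
rewrite -[RHS]mulN1r -RintegralZl//.
transitivity (Rintegral leb setT (fun x => f (- x))); last first.
  by apply: eq_Rintegral => x _; rewrite fodd mulN1r.
have mf : measurable_fun setT (EFin \o f) by case/integrableP : fi.
rewrite /Rintegral; congr fine.
rewrite (eq_measure_integral
  (pushforward leb (-%R : measurableTypeR R -> measurableTypeR R))) //; last first.
  by move=> A mA _; exact/esym/lebesgue_measureN.
rewrite (@integral_pushforward _ _ _ _ _ _ mN leb setT (EFin \o f))//=.
rewrite preimage_setT.
rewrite (_ : (EFin \o f) \o -%R = (fun x => (-1)%:E * (EFin \o f) x)%E).
  exact: integrableZl.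
by apply/funext => x /=; rewrite fodd -EFinM mulN1r.
Qed.

(** Half-open intervals are stable under intersection, the empty one included, since [ocset a b] is
    empty when b <= a. *)
Definition ocset a b : set R := `]a, b]%classic.

Lemma measurable_ocset a b : measurable (ocset a b).
Proof. exact: measurable_itv. Qed.

Lemma lebesgue_ocset a b : a <= b -> leb (ocset a b) = (b - a)%:E.
Proof.
move=> ab; rewrite /ocset lebesgue_measure_itv /= lte_fin -EFinD.
by case: ltP => // ba; rewrite (@le_anti _ _ a b) ?subrr// ab.
Qed.

Lemma lebesgue_ocset_lty a b : (leb (ocset a b) < +oo)%E.
Proof. by rewrite /ocset lebesgue_measure_itv /=; case: ifP => // _; rewrite ltry. Qed.

Let itv_FTC (f F : R -> R) a b : a < b -> continuous f ->
  (forall x, derivable F x 1 /\ 'D_1 F x = f x) ->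
  Rintegral leb setT (fun x => \1_(ocset a b) x * f x) = F b - F a.
Proof.
move=> ab cf dF; have cF : continuous F.
  by apply: derivable_continuous => x; case: (dF x).
rewrite /Rintegral; transitivity (fine (\int[leb]_(x in `[a, b]) (f x)%:E)%E).
  congr fine; rewrite -integral_itv_obnd_cbnd; last first.
    apply/measurable_EFinP; apply: measurable_funTS.
    exact: continuous_measurable_fun.
  rewrite [RHS]integral_mkcond; apply: eq_integral => x _.
  by rewrite epatch_indic /= mulrC EFinM.
rewrite (@continuous_FTC2 _ f F)//.
- exact: continuous_subspaceT.
- split; first by move=> x _; case: (dF x).
  + by apply: cvg_at_right_filter; exact: cF.
  + by apply: cvg_at_left_filter; exact: cF.
- by move=> x _; rewrite derive1E; case: (dF x).
Qed.

Definition itvFT a b x : R[i] :=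
  cint leb (fun y => cis (- (y * x)) * ((\1_(ocset a b) y)%:C : R[i])).

Lemma memL1_itv a b : memL1 leb (fun y => (\1_(ocset a b) y)%:C : R[i]).
Proof.
split; first by apply: cmeas_real; apply: measurable_indic; exact: measurable_ocset.
under eq_integral do rewrite cabs_real ger0_norm//.
rewrite integral_indic ?setIT//; last exact: measurable_ocset.
exact: lebesgue_ocset_lty.
Qed.

Lemma itvFTE a b x : a < b -> x != 0 ->
  itvFT a b x = (sin (b * x) - sin (a * x)) / x +i*
                ((cos (b * x) - cos (a * x)) / x).
Proof.
move=> ab x0; apply: complex_ext => /=.
  rewrite [LHS](_ : _ = Rintegral leb setT (fun y => \1_(ocset a b) y * cos (x * y))); last first.
    by apply: eq_Rintegral => y _ /=; rewrite mulr0 subr0 cosN mulrC (mulrC y).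
  rewrite (@itv_FTC _ (fun y => x^-1 * sin (x * y)))//.
  - by rewrite !(mulrC x); field.
  - by apply: derivable_continuous => y; apply: ex_derive.
  - move=> y; apply: is_derive_split; apply: is_derive_eq.
    by rewrite /GRing.scale /= !mulr1; field.
rewrite [LHS](_ : _ = Rintegral leb setT (fun y => \1_(ocset a b) y * - sin (x * y))); last first.
  by apply: eq_Rintegral => y _ /=; rewrite mulr0 add0r sinN mulrC (mulrC y).
rewrite (@itv_FTC _ (fun y => x^-1 * cos (x * y)))//.
- by rewrite !(mulrC x); field.
- by apply: derivable_continuous => y; apply: ex_derive.
- move=> y; apply: is_derive_split; apply: is_derive_eq.
  by rewrite /GRing.scale /= !mulr1; field.
Qed.

(** The product of one transform with the conjugate of the other has four phases, with real part
    (cos((b-d)x) + cos((a-c)x) - cos((b-c)x) - cos((a-d)x)) / x^2. The signs add up to 0, so each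
    cosine may be replaced by its difference from 1, which makes every term integrable. *)
Let cosquot4 a b c d x := cosquot (b - c) x + cosquot (a - d) x
  - cosquot (b - d) x - cosquot (a - c) x.

Lemma itvFT_conj_Re a b c d x : a < b -> c < d -> x != 0 ->
  complex.Re (itvFT a b x * (itvFT c d x)^*%C) = cosquot4 a b c d x.
Proof.
move=> ab cd x0; rewrite !itvFTE// Re_mul /= /cosquot4 /cosquot.
by rewrite !mulrBl !cosB; field.
Qed.

End sinc_integrals.

(** * Measurability of integrals depending on a parameter *)

Section parametric.
Context d1 d2 (T1 : measurableType d1) (T2 : measurableType d2) (R : realType).
Variable m2 : {sigma_finite_measure set T2 -> \bar R}.

(** The positive and the negative part are integrated separately, each integral being measurable in
    the parameter by Tonelli. *)
Lemma measurable_Rintegral_param (f : T1 * T2 -> R) : measurable_fun setT f ->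
  measurable_fun setT (fun x => Rintegral m2 setT (fun y => f (x, y))).
Proof.
move=> mf; have mEf : measurable_fun setT (EFin \o f) by exact/measurable_EFinP.
apply: measurableT_comp; first exact: fine_measurable.
under eq_fun do rewrite integralE.
apply: emeasurable_funB.
- have mp : measurable_fun setT ((EFin \o f)^\+)%E by exact: measurable_funepos.
  have p0 z : (0 <= (EFin \o f)^\+ z)%E by exact: funepos_ge0.
  have H := @measurable_fun_fubini_tonelli_F _ _ _ _ _ m2 _ mp p0.
  rewrite [X in measurable_fun _ X](_ : _ = fubini_F m2 ((EFin \o f)^\+)%E)//.
  by apply/funext => x; apply: eq_integral => y _; rewrite !funeposE.
- have mp : measurable_fun setT ((EFin \o f)^\-)%E by exact: measurable_funeneg.
  have p0 z : (0 <= (EFin \o f)^\- z)%E by exact: funeneg_ge0.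
  have H := @measurable_fun_fubini_tonelli_F _ _ _ _ _ m2 _ mp p0.
  rewrite [X in measurable_fun _ X](_ : _ = fubini_F m2 ((EFin \o f)^\-)%E)//.
  by apply/funext => x; apply: eq_integral => y _; rewrite !funenegE.
Qed.

Lemma cmeas_cint (f : T1 * T2 -> R[i]) : cmeas f ->
  cmeas (fun x => cint m2 (fun y => f (x, y))).
Proof.
move=> [f1 f2]; split.
- exact: measurable_Rintegral_param f1.
- exact: measurable_Rintegral_param f2.
Qed.

End parametric.

Lemma Re_cint d (T : measurableType d) (R : realType)
    (mu : {measure set T -> \bar R}) (f : T -> R[i]) :
  complex.Re (cint mu f) = Rintegral mu setT (fun x => complex.Re (f x)).
Proof. by []. Qed.

Lemma Im_cint d (T : measurableType d) (R : realType)
    (mu : {measure set T -> \bar R}) (f : T -> R[i]) :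
  complex.Im (cint mu f) = Rintegral mu setT (fun x => complex.Im (f x)).
Proof. by []. Qed.

(** * Parseval's identity for two intervals *)

Section interval_plancherel.
Context {R : realType}.
Local Notation leb := (@lebesgue_measure R).
Implicit Types a b c d s t x y : R.

Lemma integral_neq0 (f g : R -> \bar R) : measurable_fun setT f ->
  measurable_fun setT g -> (forall x, x != 0 -> f x = g x) ->
  (\int[leb]_x f x = \int[leb]_x g x)%E.
Proof.
move=> mf mg fg; apply: ae_eq_integral => //.
exists [set 0]; split => //.
  exact: lebesgue_measure_set1.
move=> x /= H; apply: contrapT => /eqP x0; apply: H => _; exact: fg.
Qed.

Lemma memL1_cisM dT (T : measurableType dT) (mu : {measure set T -> \bar R})
  (u : T -> R) (f : T -> R[i]) : measurable_fun setT u -> memL1 mu f ->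
  memL1 mu (fun z => cis (u z) * f z).
Proof.
move=> mu' f1; apply: (@memL1M _ _ _ _ _ _ 1) => //; first exact: cmeas_cis.
by move=> z; rewrite cabs_cis.
Qed.

Lemma measurable_mulr_cst (x : R) : measurable_fun setT (fun y : R => - (y * x)).
Proof.
by apply: continuous_measurable_fun => y; apply: cvgN; exact: mulrr_continuous.
Qed.

Lemma cmeas_itvFT a b : cmeas (itvFT a b).
Proof.
pose h (p : measurableTypeR R * measurableTypeR R) : R[i] :=
  cis (- (p.2 * p.1)) * (\1_(ocset a b) p.2)%:C.
apply: (@cmeas_cint _ _ (measurableTypeR R) (measurableTypeR R) R leb h).
apply: cmeasM.
  apply: cmeas_cis; apply: measurableT_comp => //.
  by apply: measurable_funM; [exact: measurable_snd|exact: measurable_fst].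
apply: cmeas_real; apply: (measurableT_comp (f := \1_(ocset a b) : measurableTypeR R -> R)).
  by apply: measurable_indic; exact: measurable_ocset.
exact: measurable_snd.
Qed.

Lemma itvFTN a b x : itvFT a b (- x) = (itvFT a b x)^*%C.
Proof.
rewrite /itvFT -cint_conj; last first.
  by apply: memL1_cisM; [exact: measurable_mulr_cst|exact: memL1_itv].
apply: eq_cint => y; rewrite rmorphM /= mulrN.
by rewrite -[X in _ = X * _]/((cis (- (y * x)))^*%C) conj_cis oppr0.
Qed.

(** The diagonal case comes separately because it shows that [itvFT] is square integrable, whence
    the integrability of the mixed products. *)
Lemma N2_itvFT a b : a < b ->
  (N2 leb (itvFT a b) = (2 * pi * (b - a))%:E)%E.
Proof.
move=> ab; rewrite /N2.
rewrite (@integral_neq0 _ (fun x => (2 * cosquot (b - a) x)%:E)).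
- under eq_integral do rewrite EFinM.
  rewrite ge0_integralZl_EFin//.
  + rewrite integral_cosquot -EFinM gtr0_norm ?subr_gt0//.
    by congr EFin; ring.
  + by move=> x _; rewrite lee_fin cosquot_ge0.
  + by apply/measurable_EFinP; exact: measurable_cosquot.
- by apply/measurable_EFinP; apply: cmeas_cabs2; exact: cmeas_itvFT.
- by apply/measurable_EFinP; apply: measurable_funM => //; exact: measurable_cosquot.
- move=> x x0; congr EFin.
  have := itvFT_conj_Re ab ab x0; rewrite mul_conj_cabs /= => ->.
  rewrite /cosquot !subrr !mul0r cos0 subrr mul0r !subr0 -(opprB a b).
  rewrite mulNr cosN; ring.
Qed.

Lemma memL2_itvFT a b : a < b -> memL2 leb (itvFT a b).
Proof.
by move=> ab; split; [exact: cmeas_itvFT|rewrite N2_itvFT// ltry].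
Qed.

Lemma memL1_itvFT a b c d : a < b -> c < d ->
  memL1 leb (fun x => itvFT a b x * (itvFT c d x)^*%C).
Proof.
by move=> ab cd; apply: memL1_L2M; [|apply: memL2_conj]; exact: memL2_itvFT.
Qed.

Lemma ocsetI a b c d :
  ocset a b `&` ocset c d = ocset (Num.max a c) (Num.min b d).
Proof.
apply/seteqP; split => x; rewrite /ocset /= !in_itv/= gt_max le_min.
  by move=> [/andP[-> ->] /andP[-> ->]].
by move=> /andP[/andP[-> ->] /andP[-> ->]].
Qed.

Lemma ocset0 a b : b <= a -> ocset a b = set0.
Proof.
move=> ba; apply/seteqP; split => // x; rewrite /ocset /= in_itv/=.
by move=> /andP[ax xb]; have := lt_le_trans ax (le_trans xb ba); rewrite ltxx.
Qed.

(** The integrand at -x is the conjugate of that at x, so the imaginary part integrates to 0. The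
    real part gives pi (|b-c| + |a-d| - |b-d| - |a-c|), which is 2 pi times the length of the
    intersection, as one sees by ordering the endpoints. *)
Lemma itv_plancherel a b c d : a < b -> c < d ->
  cint leb (fun x => itvFT a b x * (itvFT c d x)^*%C) =
  (2 * pi * fine (leb (ocset a b `&` ocset c d)))%:C.
Proof.
move=> ab cd; have I1 := memL1_itvFT ab cd.
apply: complex_ext; rewrite ?Re_cint ?Im_cint; last first.
  apply: Rintegral_odd; first exact: memL1_Im I1.
  move=> x; rewrite !itvFTN conjcK !Im_mul.
  by move: (itvFT a b x) (itvFT c d x) => [p q] [p' q'] /=; ring.
transitivity (pi * (`|b - c| + `|a - d| - `|b - d| - `|a - c|)).
  transitivity (Rintegral leb setT (fun x => cosquot (b - c) x +
      cosquot (a - d) x - cosquot (b - d) x - cosquot (a - c) x)).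
    rewrite /Rintegral; congr fine; apply: integral_neq0.
    - by apply/measurable_EFinP; case: (I1.1).
    - apply/measurable_EFinP.
      by do ?apply: measurable_funB; do ?apply: measurable_funD; exact: measurable_cosquot.
    - by move=> x x0; congr EFin; exact: itvFT_conj_Re.
  have ic t := integrable_cosquot t.
  have cE t : Rintegral leb setT (cosquot t) = pi * `|t|.
    by rewrite /Rintegral integral_cosquot.
  have iD := integrableD measurableT (ic (b - c)) (ic (a - d)).
  have iB := integrableB measurableT iD (ic (b - d)).
  rewrite (RintegralB _ iB (ic _))// (RintegralB _ iD (ic _))//.
  by rewrite (RintegralD _ (ic _) (ic _))// !cE; ring.
rewrite ocsetI -!mulrA mulrCA; congr (_ * _).
rewrite /Num.max /Num.min; clear I1.
have [ac|ac] := ltP a c; have [bd|bd] := ltP b d.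
all: have N x y : x <= y -> `|x - y| = y - x
  by move=> xy; rewrite ler0_norm ?opprB// subr_le0.
all: have M x y : y <= x -> `|x - y| = x - y
  by move=> xy; rewrite ger0_norm// subr_ge0.
- have [pq|pq] := leP c b.
    by rewrite lebesgue_ocset ?(M b c) ?(N a d) ?(N b d) ?(N a c) //=; lra.
  by rewrite ocset0 ?measure0 ?(N b c) ?(N a d) ?(N b d) ?(N a c) //=; lra.
- by rewrite lebesgue_ocset ?(M b c) ?(N a d) ?(M b d) ?(N a c) //=; lra.
- by rewrite lebesgue_ocset ?(M b c) ?(N a d) ?(N b d) ?(M a c) //=; lra.
- have [pq|pq] := leP a d.
    by rewrite lebesgue_ocset ?(M b c) ?(N a d) ?(M b d) ?(M a c) //=; lra.
  by rewrite ocset0 ?measure0 ?(M b c) ?(M a d) ?(M b d) ?(M a c) //=; lra.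
Qed.

End interval_plancherel.

(** * Plancherel on L^1 /\ L^2 *)

Section fourier_basics.
Context {R : realType} (n : nat).
Local Notation E := 'rV[R]_n.
Local Notation mu := (@lebesgue_rV R n).
Local Notation leb := (@lebesgue_measure R).
Implicit Types (f g : E -> R[i]) (x xi : E) (a b c d : 'I_n -> R).

Lemma measurable_dotr dT (T : measurableType dT) (u v : T -> E) :
  measurable_fun setT u -> measurable_fun setT v ->
  measurable_fun setT (fun t => dotr (u t) (v t)).
Proof.
move=> mu' mv; rewrite /dotr; apply: measurable_sum => i.
apply: measurable_funM.
  exact: measurableT_comp (measurable_coord i) mu'.
exact: measurableT_comp (measurable_coord i) mv.
Qed.

Lemma measurable_dotrr xi : measurable_fun setT (fun x => - dotr x xi).
Proof.
apply: measurableT_comp => //; apply: measurable_dotr.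
  exact: measurable_id.
exact: measurable_cst.
Qed.

Lemma fourierE f xi : fourier f xi = cint mu (fun x => cis (- dotr x xi) * f x).
Proof. by []. Qed.

Lemma fourier_memL1 f xi : memL1 mu f ->
  memL1 mu (fun x => cis (- dotr x xi) * f x).
Proof. by move=> f1; apply: memL1_cisM => //; exact: measurable_dotrr. Qed.

Lemma fourierD f g xi : memL1 mu f -> memL1 mu g ->
  fourier (fun x => f x + g x) xi = fourier f xi + fourier g xi.
Proof.
move=> f1 g1; rewrite !fourierE -cintD; try exact: fourier_memL1.
by apply: eq_cint => x; rewrite mulrDr.
Qed.

Lemma fourierZ (z : R[i]) f xi : memL1 mu f ->
  fourier (fun x => z * f x) xi = z * fourier f xi.
Proof.
move=> f1; rewrite !fourierE -cintZ; last exact: fourier_memL1.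
by apply: eq_cint => x; rewrite mulrCA.
Qed.

Lemma fourierB f g xi : memL1 mu f -> memL1 mu g ->
  fourier (fun x => f x - g x) xi = fourier f xi - fourier g xi.
Proof.
move=> f1 g1; rewrite !fourierE -cintB; try exact: fourier_memL1.
by apply: eq_cint => x; rewrite mulrBr.
Qed.

Lemma fourier_sum (I : Type) (s : seq I) (F : I -> E -> R[i]) xi :
  (forall i, memL1 mu (F i)) ->
  fourier (fun x => \sum_(i <- s) F i x) xi = \sum_(i <- s) fourier (F i) xi.
Proof.
move=> F1; rewrite fourierE -cint_sum; last by move=> i; exact: fourier_memL1.
by apply: eq_cint => x; rewrite mulr_sumr.
Qed.

Lemma cabs_fourier f xi : memL1 mu f ->
  ((cabs (fourier f xi))%:E <= 2%:E * \int[mu]_x (cabs (f x))%:E)%E.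
Proof.
move=> f1; apply: le_trans (cabs_cint (fourier_memL1 xi f1)) _.
by under eq_integral do rewrite cabsM cabs_cis mul1r.
Qed.

Lemma cmeas_fourier f : cmeas f -> cmeas (fourier f).
Proof.
move=> mf; pose h (p : E * E) := cis (- dotr p.2 p.1) * f p.2.
apply: (@cmeas_cint _ _ _ _ R mu h); apply: cmeasM.
  apply: cmeas_cis; apply: measurableT_comp => //; apply: measurable_dotr.
    exact: measurable_snd.
  exact: measurable_fst.
have [m1 m2] := mf.
by split; [exact: measurableT_comp m1 measurable_snd|
           exact: measurableT_comp m2 measurable_snd].
Qed.

Definition box a b : set E := [set x | forall i, ocset (a i) (b i) (x ord0 i)].

(** The indicator of the box, kept in product form so that its transform splits into those of the
    sides. *)
Definition boxf a b x : R[i] := \prod_(i < n) (\1_(ocset (a i) (b i)) (x ord0 i))%:C.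

Lemma boxfE a b x : boxf a b x = (\1_(box a b) x)%:C.
Proof.
rewrite indicE; have [xb|xb] := boolP (x \in box a b).
  rewrite /boxf big1 // => i _; move: xb; rewrite inE => /(_ i) xi.
  by rewrite indicE mem_set.
move: xb; rewrite notin_setE /box /= => /existsNP[i xi].
by rewrite /boxf (bigD1 i)//= indicE memNset// mul0r.
Qed.

Lemma measurable_box a b : measurable (box a b).
Proof.
rewrite (_ : box a b = \bigcap_(i in [set: 'I_n])
    ((fun x : E => x ord0 i) @^-1` ocset (a i) (b i))).
  apply: fin_bigcap_measurable => // i _.
  rewrite -[X in measurable X]setTI; apply: measurable_coord => //.
  exact: measurable_ocset.
by apply/seteqP; split => x Ax i => [_|]; exact: Ax.
Qed.

Lemma boxI a b c d : box a b `&` box c d =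
  box (fun i => Num.max (a i) (c i)) (fun i => Num.min (b i) (d i)).
Proof.
apply/seteqP; split => x.
  by move=> [xab xcd] i; rewrite -ocsetI; split; [exact: xab|exact: xcd].
by move=> H; split => i; have := H i; rewrite -ocsetI => -[].
Qed.

Lemma lebesgue_box a b :
  mu (box a b) = (\prod_(i < n) leb (ocset (a i) (b i)))%E.
Proof.
by apply: (@lebesgue_rV_box R n (fun i => ocset (a i) (b i))) => i; exact: measurable_ocset.
Qed.

Lemma lebesgue_box_fin a b : mu (box a b) \is a fin_num.
Proof.
rewrite lebesgue_box; apply: (big_ind (fun z : \bar R => z \is a fin_num)) => //.
  by move=> x y; exact: fin_numM.
by move=> i _; rewrite ge0_fin_numE// lebesgue_ocset_lty.
Qed.

Lemma fine_lebesgue_box a b :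
  fine (mu (box a b)) = \prod_(i < n) fine (leb (ocset (a i) (b i))).
Proof.
rewrite lebesgue_box; elim: (index_enum _) => [|i s IH]; first by rewrite !big_nil.
rewrite !big_cons fineM ?IH//.
  by rewrite ge0_fin_numE// lebesgue_ocset_lty.
apply: (big_ind (fun z : \bar R => z \is a fin_num)) => //.
  by move=> x y; exact: fin_numM.
by move=> j _; rewrite ge0_fin_numE// lebesgue_ocset_lty.
Qed.

Lemma memL1_indic (A : set E) : measurable A -> (mu A < +oo)%E ->
  memL1 mu (fun x => (\1_A x)%:C : R[i]).
Proof.
move=> mA Aoo; split; first by apply: cmeas_real; exact: measurable_indic.
under eq_integral do rewrite cabs_real ger0_norm//.
by rewrite integral_indic// setIT.
Qed.

Lemma N2_indic (A : set E) : measurable A ->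
  N2 mu (fun x => (\1_A x)%:C : R[i]) = mu A.
Proof.
move=> mA; rewrite /N2.
have H x : (cabs (\1_A x)%:C) ^+ 2 = \1_A x :> R.
  by rewrite cabs_real ger0_norm// indicE; case: (_ \in _); rewrite ?expr1n ?expr0n.
under eq_integral do rewrite H.
by rewrite integral_indic// setIT.
Qed.

Lemma memL2_indic (A : set E) : measurable A -> (mu A < +oo)%E ->
  memL2 mu (fun x => (\1_A x)%:C : R[i]).
Proof. by move=> mA Aoo; split; [case: (memL1_indic mA Aoo)|rewrite N2_indic]. Qed.

Lemma lebesgue_box_lty a b : (mu (box a b) < +oo)%E.
Proof. by rewrite -ge0_fin_numE// lebesgue_box_fin. Qed.

Lemma boxf_fun a b : boxf a b = (fun x => (\1_(box a b) x)%:C).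
Proof. by apply/funext => x; rewrite boxfE. Qed.

Lemma memL1_boxf a b : memL1 mu (boxf a b).
Proof.
by rewrite boxf_fun; apply: memL1_indic; [exact: measurable_box|exact: lebesgue_box_lty].
Qed.

Lemma memL2_boxf a b : memL2 mu (boxf a b).
Proof.
by rewrite boxf_fun; apply: memL2_indic; [exact: measurable_box|exact: lebesgue_box_lty].
Qed.

Lemma cis_sum (I : Type) (s : seq I) (u : I -> R) :
  cis (\sum_(i <- s) u i) = \prod_(i <- s) cis (u i).
Proof.
elim: s => [|i s IH]; first by rewrite !big_nil cis0.
by rewrite !big_cons cisD IH.
Qed.

Lemma fourier_boxf a b xi :
  fourier (boxf a b) xi = \prod_(i < n) itvFT (a i) (b i) (xi ord0 i).
Proof.
pose h i (y : R) : R[i] := cis (- (y * xi ord0 i)) * (\1_(ocset (a i) (b i)) y)%:C.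
have h1 i : memL1 leb (h i).
  by apply: memL1_cisM; [exact: measurable_mulr_cst|exact: memL1_itv].
have [_ <-] := cint_rV_prod h1.
rewrite fourierE; apply: eq_cint => x.
by rewrite /dotr -sumrN cis_sum -big_split.
Qed.

Lemma box_plancherel a b c d : (forall i, a i < b i) -> (forall i, c i < d i) ->
  memL1 mu (fun xi => fourier (boxf a b) xi * (fourier (boxf c d) xi)^*%C) /\
  cint mu (fun xi => fourier (boxf a b) xi * (fourier (boxf c d) xi)^*%C) =
  ((2 * pi) ^+ n)%:C * cint mu (fun x => boxf a b x * (boxf c d x)^*%C).
Proof.
move=> ab cd.
pose h i (y : R) := itvFT (a i) (b i) y * (itvFT (c i) (d i) y)^*%C.
have h1 i : memL1 leb (h i) by exact: memL1_itvFT.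
have [I1 c1] := cint_rV_prod h1.
have E1 : (fun xi => fourier (boxf a b) xi * (fourier (boxf c d) xi)^*%C) =
   (fun x : E => \prod_(i < n) h i (x ord0 i)).
  by apply/funext => xi; rewrite !fourier_boxf rmorph_prod -big_split.
rewrite E1; split => //; rewrite c1.
under eq_bigr do rewrite itv_plancherel//.
have -> : cint mu (fun x => boxf a b x * (boxf c d x)^*%C) =
    (fine (mu (box a b `&` box c d)))%:C.
  transitivity (cint mu (fun x => (\1_(box a b `&` box c d) x)%:C : R[i])).
    apply: eq_cint => x.
    by rewrite !boxfE conjc_real -rmorphM /= indicI.
  apply: complex_ext; rewrite ?Re_cint ?Im_cint /=.
    rewrite /Rintegral integral_indic ?setIT//.
    by apply: measurableI; exact: measurable_box.
  by rewrite /Rintegral integral0.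
rewrite boxI fine_lebesgue_box -rmorphM -rmorph_prod; congr (_%:C).
rewrite big_split /= prodr_const card_ord; congr (_ * _).
by apply: eq_bigr => i _; rewrite ocsetI.
Qed.

(* Boxes generate the Borel sets: a coordinate strip is a countable union of
   boxes whose other sides are ]-k, k]. *)
Lemma measurable_box_generated :
  @measurable _ E = <<s [set box p.1 p.2 | p in [set: ('I_n -> R) * ('I_n -> R)]] >>.
Proof.
apply/seteqP; split; last first.
  apply: smallest_sub; first exact: sigma_algebra_measurable.
  by move=> _ [p _ <-]; exact: measurable_box.
apply: smallest_sub; first exact: smallest_sigma_algebra.
move=> A; rewrite -bigcup_seq => -[i _] /=.
rewrite [X in X A -> _](_ : _ = preimage_set_system setT (fun x : E => x ord0 i)
    (@ocitv R).-sigma.-measurable)// -g_sigma_preimageE.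
move: A; apply: smallest_sub; first exact: smallest_sigma_algebra.
move=> _ [_ [[u v] _ <-] <-]; rewrite setTI /=.
pose a (k : nat) (j : 'I_n) : R := if j == i then u else - k%:R.
pose b (k : nat) (j : 'I_n) : R := if j == i then v else k%:R.
rewrite (_ : _ @^-1` _ = \bigcup_k box (a k) (b k)).
  apply: sigma_algebra_bigcup => k; apply: sub_sigma_algebra.
  by exists (a k, b k).
apply/seteqP; split => x /=; last first.
  by move=> [k _ /(_ i)]; rewrite /a /b eqxx.
rewrite in_itv/= => xuv.
pose M := \sum_(j < n) `|x ord0 j|.
have xM j : `|x ord0 j| <= M.
  by rewrite /M (bigD1 j)//= lerDl sumr_ge0.
have M0 : 0 <= M by rewrite sumr_ge0.
exists (Num.bound M) => // j; rewrite /a /b /ocset /= in_itv/=.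
case: eqP => [->//|_].
have := xM j; rewrite ler_norml => /andP[x1 x2].
have Mk := archi_boundP M0.
by rewrite (lt_le_trans _ x1) ?ltrN2//= (le_trans x2)// ltW.
Qed.

End fourier_basics.

(** * Limits under the integral sign *)

Lemma ler_dist_cabs (R : realType) (z w : R[i]) : `|cabs z - cabs w| <= cabs (z - w).
Proof.
have h1 := ler_cabsD (z - w) w; have h2 := ler_cabsD (w - z) z.
move: h1 h2; rewrite !subrK (cabsB w) ler_norml => h1 h2.
by apply/andP; split; lra.
Qed.

Section integral_limits.
Context d (T : measurableType d) (R : realType).
Variable mu : {measure set T -> \bar R}.
Implicit Types (f g h : T -> R[i]).

Lemma integral_dominated0 (v : nat -> T -> R) (g : T -> R) :
  (forall k, measurable_fun setT (v k)) -> mu.-integrable setT (EFin \o g) ->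
  (forall k x, 0 <= v k x <= g x) ->
  (forall x, v k x @[k --> \oo] --> (0 : R)) ->
  (\int[mu]_x (v k x)%:E @[k --> \oo] --> 0)%E.
Proof.
move=> mv ig vg v0.
have mE k : measurable_fun setT (EFin \o v k) by exact/measurable_EFinP.
have m0 : measurable_fun setT (EFin \o (fun _ : T => 0 : R)).
  by apply/measurable_EFinP; exact: measurable_cst.
have [] := @dominated_convergence _ _ _ mu setT measurableT
  (fun k => EFin \o v k) (EFin \o (fun=> 0)) (EFin \o g) mE m0 _ ig _.
- apply: aeW => x _ /=.
  by apply: cvg_EFin; [exact: nearW|exact: v0].
- apply: aeW => x k _ /=; have /andP[v1 v2] := vg k x.
  by rewrite lee_fin ger0_norm.
- by move=> _ _ /=; rewrite integral0.
Qed.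

Lemma N2_dominated0 (h : nat -> T -> R[i]) f : (forall k, cmeas (h k)) ->
  memL2 mu f -> (forall k x, cabs (h k x) <= cabs (f x)) ->
  (forall x, cabs (h k x) @[k --> \oo] --> (0 : R)) ->
  N2 mu (h k) @[k --> \oo] --> 0%E.
Proof.
move=> mh [mf f2] hf h0.
apply: (@integral_dominated0 (fun k x => cabs (h k x) ^+ 2) (fun x => cabs (f x) ^+ 2)).
- by move=> k; exact: cmeas_cabs2.
- apply/integrableP; split; first by apply/measurable_EFinP; exact: cmeas_cabs2.
  by under eq_integral do rewrite /= ger0_norm ?sqr_ge0//.
- by move=> k x; rewrite sqr_ge0 lerXn2r ?nnegrE ?cabs_ge0.
- move=> x; rewrite (_ : 0 = 0 ^+ 2 :> R); last by rewrite expr0n.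
  apply: (@cvg_comp _ _ _ _ (fun y : R => y ^+ 2)); first exact: h0.
  exact: exprn_continuous.
Qed.

Lemma limn_einf_le_cst (u : nat -> \bar R) (C : \bar R) :
  (forall k, u k <= C)%E -> (limn_einf u <= C)%E.
Proof.
move=> uC; rewrite limn_einf_lim; apply: lime_le; first exact: is_cvg_einfs.
near=> k; apply: le_trans (uC k).
by apply: ereal_inf_lbound; exists k => //=.
Unshelve. all: by end_near. Qed.

Lemma N2_fatou (h : nat -> T -> R[i]) f (C : \bar R) : (forall k, cmeas (h k)) ->
  (forall x, cabs (h k x - f x) @[k --> \oo] --> (0 : R)) ->
  (forall k, N2 mu (h k) <= C)%E -> (N2 mu f <= C)%E.
Proof.
move=> mh h0 hC.
pose v k x := ((cabs (h k x)) ^+ 2)%:E.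
have cv x : v k x @[k --> \oo] --> ((cabs (f x)) ^+ 2)%:E.
  apply: cvg_EFin; first exact: nearW.
  have cx : cabs (h k x) @[k --> \oo] --> cabs (f x).
    apply/cvgrPdist_le => e e0; have /cvgr0Pnorm_le/(_ _ e0) := h0 x.
    apply: filterS => k; apply: le_trans; rewrite [leRHS]ger0_norm ?cabs_ge0//.
    by rewrite distrC ler_dist_cabs.
  apply: (@cvg_comp _ _ _ _ (fun y : R => y ^+ 2)); first exact: cx.
  exact: exprn_continuous.
have E : N2 mu f = (\int[mu]_x limn_einf (v^~ x))%E.
  apply: eq_integral => x _; rewrite is_cvg_limn_einfE; last first.
    by apply/cvg_ex; exists ((cabs (f x)) ^+ 2)%:E; exact: cv.
  by apply/esym/cvg_lim => //; exact: cv.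
rewrite E; apply: le_trans (fatou _ _ _ _) _ => //.
- by move=> k; apply/measurable_EFinP; exact: cmeas_cabs2.
- by move=> k x _; rewrite lee_fin sqr_ge0.
- exact: limn_einf_le_cst.
Qed.

(** It controls two things at once: the L^1 part makes the transforms converge uniformly, the L^2
    part makes the energies converge. It is neither homogeneous nor subadditive, but [D12D] and
    [D12Z] suffice for density arguments. *)
Definition D12 f : \bar R := (\int[mu]_x (cabs (f x))%:E + N2 mu f)%E.

Lemma L1norm_ge0 f : (0 <= \int[mu]_x (cabs (f x))%:E)%E.
Proof. by apply: integral_ge0 => x _; rewrite lee_fin cabs_ge0. Qed.

Lemma D12_ge0 f : (0 <= D12 f)%E.
Proof. by rewrite adde_ge0 ?L1norm_ge0 ?N2_ge0. Qed.

Lemma L1norm_le_D12 f : (\int[mu]_x (cabs (f x))%:E <= D12 f)%E.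
Proof. by rewrite leeDl ?N2_ge0. Qed.

Lemma N2_le_D12 f : (N2 mu f <= D12 f)%E.
Proof. by rewrite leeDr ?L1norm_ge0. Qed.

Lemma L1normD f g : cmeas f -> cmeas g ->
  (\int[mu]_x (cabs (f x + g x))%:E <=
   \int[mu]_x (cabs (f x))%:E + \int[mu]_x (cabs (g x))%:E)%E.
Proof.
move=> mf mg; have m h : cmeas h -> measurable_fun setT (fun x => (cabs (h x))%:E).
  by move=> mh; apply/measurable_EFinP; exact: cmeas_cabs.
rewrite -ge0_integralD//; last 4 first.
- by move=> x _; rewrite lee_fin cabs_ge0.
- exact: m.
- by move=> x _; rewrite lee_fin cabs_ge0.
- exact: m.
apply: ge0_le_integral => //.
- by move=> x _; rewrite lee_fin cabs_ge0.
- by apply: m; exact: cmeasD.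
- by apply: emeasurable_funD; exact: m.
- by move=> x _; rewrite -EFinD lee_fin ler_cabsD.
Qed.

Lemma D12D f g : cmeas f -> cmeas g ->
  (D12 (fun x => (f x + g x)%R) <= 2%:E * D12 f + 2%:E * D12 g)%E.
Proof.
move=> mf mg; rewrite /D12.
have H := N2D mu (@ltr01 R) mf mg.
rewrite invr1 (_ : 1 + 1 = 2 :> R) in H; last by lra.
have two0 : (0 <= 2%:E :> \bar R)%E by rewrite lee_fin.
rewrite (ge0_muleDr _ (L1norm_ge0 f) (N2_ge0 mu f)).
rewrite (ge0_muleDr _ (L1norm_ge0 g) (N2_ge0 mu g)) [leRHS]addeACA.
apply: leeD; last exact: H.
apply: le_trans (L1normD mf mg) _.
apply: leeD; rewrite -[leLHS]mul1e lee_wpmul2r ?L1norm_ge0// lee_fin; lra.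
Qed.

Lemma D12Z (z : R[i]) f : cmeas f ->
  (D12 (fun x => (z * f x)%R) <= ((cabs z + cabs z ^+ 2)%R)%:E * D12 f)%E.
Proof.
move=> mf; rewrite /D12 N2Z//.
have z0 : (0 <= (cabs z + cabs z ^+ 2)%:E)%E.
  by rewrite lee_fin addr_ge0 ?cabs_ge0 ?sqr_ge0.
rewrite (ge0_muleDr _ (L1norm_ge0 f) (N2_ge0 mu f)); apply: leeD.
  under eq_integral do rewrite cabsM EFinM.
  rewrite ge0_integralZl_EFin ?cabs_ge0//.
  - by rewrite lee_wpmul2r ?L1norm_ge0// lee_fin lerDl sqr_ge0.
  - by move=> x _; rewrite lee_fin cabs_ge0.
  - by apply/measurable_EFinP; exact: cmeas_cabs.
by rewrite lee_wpmul2r ?N2_ge0// lee_fin lerDr cabs_ge0.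
Qed.

Lemma D12B f g : D12 (fun x => f x - g x) = D12 (fun x => g x - f x).
Proof.
rewrite /D12 N2B; congr (_ + _)%E.
by apply: eq_integral => x _; rewrite cabsB.
Qed.

Definition memL12 f := memL1 mu f /\ memL2 mu f.

Lemma memL12D f g : memL12 f -> memL12 g -> memL12 (fun x => f x + g x).
Proof. by move=> [f1 f2] [g1 g2]; split; [exact: memL1D|exact: memL2D]. Qed.

Lemma memL12B f g : memL12 f -> memL12 g -> memL12 (fun x => f x - g x).
Proof. by move=> [f1 f2] [g1 g2]; split; [exact: memL1B|exact: memL2B]. Qed.

Lemma memL12Z (z : R[i]) f : memL12 f -> memL12 (fun x => z * f x).
Proof. by move=> [f1 f2]; split; [exact: memL1Z|exact: memL2Z]. Qed.

Lemma memL12_conj f : memL12 f -> memL12 (fun x => (f x)^*%C).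
Proof. by move=> [f1 f2]; split; [exact: memL1_conj|exact: memL2_conj]. Qed.

Lemma D12_dominated0 (h : nat -> T -> R[i]) f : (forall k, cmeas (h k)) ->
  memL12 f -> (forall k x, cabs (h k x) <= cabs (f x)) ->
  (forall x, cabs (h k x) @[k --> \oo] --> (0 : R)) ->
  D12 (h k) @[k --> \oo] --> 0%E.
Proof.
move=> mh [f1 f2] hf h0; rewrite -[X in _ --> X](adde0 0%E) /D12.
have H2 := N2_dominated0 mh f2 hf h0.
have H1 : (\int[mu]_x (cabs (h k x))%:E @[k --> \oo] --> 0)%E.
  apply: (@integral_dominated0 (fun k x => cabs (h k x)) (fun x => cabs (f x))) => //.
  - by move=> k; exact: cmeas_cabs.
  - exact: memL1_cabs.
  - by move=> k x; rewrite cabs_ge0 hf.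
by apply: cvgeD H1 H2.
Qed.

Lemma N2_cint f : memL2 mu f ->
  N2 mu f = (complex.Re (cint mu (fun x => f x * (f x)^*%C)))%:E.
Proof.
move=> [mf f2]; rewrite Re_cint /Rintegral.
under [in RHS]eq_integral do rewrite mul_conj_cabs /=.
by rewrite fineK// ge0_fin_numE// N2_ge0.
Qed.

Lemma N2D_cint f g : memL2 mu f -> memL2 mu g ->
  N2 mu (fun x => f x + g x) = (N2 mu f + N2 mu g +
    (2 * complex.Re (cint mu (fun x => (f x * (g x)^*%C)%R)))%:E)%E.
Proof.
move=> f2 g2; have fc := memL2_conj f2; have gc := memL2_conj g2.
have ff := memL1_L2M f2 fc; have gg := memL1_L2M g2 gc.
have fg := memL1_L2M f2 gc; have gf := memL1_L2M g2 fc.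
rewrite !N2_cint//; last exact: memL2D.
rewrite (@eq_cint _ _ _ mu _ (fun x => (f x * (f x)^*%C + g x * (g x)^*%C) +
  (f x * (g x)^*%C + g x * (f x)^*%C))); last first.
  by move=> x; rewrite rmorphD /=; ring.
rewrite cintD; [|exact: memL1D|exact: memL1D].
rewrite [cint mu (fun x => f x * (g x)^*%C + _)]cintD//.
rewrite [cint mu (fun x => f x * (f x)^*%C + _)]cintD//.
rewrite !Re_add -!EFinD; congr EFin.
rewrite [cint mu (fun x => g x * (f x)^*%C)](_ : _ = (cint mu (fun x => f x * (g x)^*%C))^*%C).
  by case: (cint mu (fun x => f x * (g x)^*%C)) => p q /=; ring.
rewrite -cint_conj//; apply: eq_cint => x.
by rewrite rmorphM /= conjcK mulrC.
Qed.

End integral_limits.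

(** * Step functions on boxes *)

Section plancherel.
Context {R : realType} (n : nat).
Local Notation E := 'rV[R]_n.
Local Notation mu := (@lebesgue_rV R n).
Implicit Types (f g : E -> R[i]) (x xi : E).

Let c0 : R := (2 * pi) ^+ n.

Definition step_of (s : seq (R[i] * (('I_n -> R) * ('I_n -> R)))) x : R[i] :=
  \sum_(p <- s) p.1 * boxf p.2.1 p.2.2 x.

Lemma memL12_boxf a b : memL12 mu (@boxf R n a b).
Proof. by split; [exact: memL1_boxf|exact: memL2_boxf]. Qed.

Lemma memL12_step s : memL12 mu (step_of s).
Proof.
elim: s => [|p s IH].
  rewrite (_ : step_of [::] = (fun x => 0 * boxf (fun=> 0) (fun=> 0) x)).
    by apply: memL12Z; exact: memL12_boxf.
  by apply/funext => x; rewrite /step_of big_nil mul0r.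
rewrite (_ : step_of (p :: s) = (fun x => p.1 * boxf p.2.1 p.2.2 x + step_of s x)).
  by apply: memL12D => //; apply: memL12Z; exact: memL12_boxf.
by apply/funext => x; rewrite /step_of big_cons.
Qed.

Lemma boxf_degenerate (a b : 'I_n -> R) i : b i <= a i -> boxf a b = (fun=> 0).
Proof.
move=> ba; apply/funext => x; rewrite /boxf (bigD1 i)//= ocset0//.
by rewrite indic0 mul0r.
Qed.

Lemma fourier0 xi : fourier (fun=> 0 : R[i]) xi = 0 :> R[i].
Proof.
by rewrite fourierE -[RHS](cint0 mu); apply: eq_cint => x; rewrite mulr0.
Qed.

(** [step_of] takes arbitrary pairs of corners. A box with an empty side has indicator 0, and both
    integrands then vanish. *)
Lemma boxf_plancherel (a b c d : 'I_n -> R) :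
  memL1 mu (fun xi => fourier (boxf a b) xi * (fourier (boxf c d) xi)^*%C) /\
  cint mu (fun xi => fourier (boxf a b) xi * (fourier (boxf c d) xi)^*%C) =
  c0%:C * cint mu (fun x => boxf a b x * (boxf c d x)^*%C).
Proof.
have Z (u v : E -> R[i]) : (forall x, u x = 0) -> (forall x, v x = 0) ->
    memL1 mu u /\ cint mu u = c0%:C * cint mu v.
  move=> u0 v0; have -> : u = (fun=> 0) by apply/funext.
  have -> : v = (fun=> 0) by apply/funext.
  by split; [exact: memL1_0|rewrite cint0 mulr0].
have [ab|] := pselect (forall i, a i < b i); last first.
  move=> /existsNP[i /negP]; rewrite -leNgt => ba.
  by rewrite (boxf_degenerate ba); apply: Z => x; rewrite ?fourier0 mul0r.
have [cd|] := pselect (forall i, c i < d i); last first.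
  move=> /existsNP[i /negP]; rewrite -leNgt => dc.
  by rewrite (boxf_degenerate dc); apply: Z => x; rewrite ?fourier0 conjc0 mulr0.
exact: box_plancherel.
Qed.

Lemma memL2_fourier_boxf a b : memL2 mu (fourier (@boxf R n a b)).
Proof.
have [[_ I1] _] := boxf_plancherel a b a b.
split; first by apply: cmeas_fourier; case: (memL1_boxf a b).
apply: le_lt_trans I1; rewrite /N2 le_eqVlt; apply/orP; left; apply/eqP.
by apply: eq_integral => x _; rewrite cabsM cabs_conj expr2.
Qed.

Lemma fourier_step s xi :
  fourier (step_of s) xi = \sum_(p <- s) p.1 * fourier (boxf p.2.1 p.2.2) xi.
Proof.
rewrite fourier_sum; last by move=> p; apply: memL1Z; exact: memL1_boxf.
by apply: eq_bigr => p _; rewrite fourierZ//; exact: memL1_boxf.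
Qed.

Lemma memL2_fourier_step s : memL2 mu (fourier (step_of s)).
Proof.
rewrite (_ : fourier _ = fun xi => \sum_(p <- s) p.1 * fourier (boxf p.2.1 p.2.2) xi).
  elim: s => [|p s IH].
    rewrite (_ : (fun _ => _) = (fun xi => 0 * fourier (boxf (fun=> 0) (fun=> 0)) xi)).
      by apply: memL2Z; exact: memL2_fourier_boxf.
    by apply/funext => x; rewrite big_nil mul0r.
  under eq_fun do rewrite big_cons.
  by apply: memL2D => //; apply: memL2Z; exact: memL2_fourier_boxf.
by apply/funext => xi; exact: fourier_step.
Qed.

(** Both sides are Hermitian forms in the coefficients of the step function, and their entries agree
    up to [c0] by [boxf_plancherel]. *)
Lemma step_plancherel s :
  N2 mu (fourier (step_of s)) = (c0%:E * N2 mu (step_of s))%E.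
Proof.
rewrite !N2_cint; [|by case: (memL12_step s)|exact: memL2_fourier_step].
rewrite -EFinM; congr EFin.
pose I := (R[i] * (('I_n -> R) * ('I_n -> R)))%type.
have S (u : seq I) (F : I -> E -> R[i]) :
    (forall p q, memL1 mu (fun x => F p x * (F q x)^*%C)) ->
    cint mu (fun x => (\sum_(p <- u) p.1 * F p x) * (\sum_(p <- u) p.1 * F p x)^*%C) =
    \sum_(p <- u) \sum_(q <- u) p.1 * q.1^*%C * cint mu (fun x => F p x * (F q x)^*%C)
    :> R[i].
  move=> F1.
  have F2 (p q : I) :
      memL1 mu (fun x => p.1 * q.1^*%C * (F p x * (F q x)^*%C)) by exact: memL1Z.
  rewrite (@eq_cint _ _ _ mu _ (fun x => \sum_(p <- u) \sum_(q <- u)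
      p.1 * q.1^*%C * (F p x * (F q x)^*%C))); last first.
    move=> x; rewrite rmorph_sum /= big_distrlr /=.
    by apply: eq_bigr => p _; apply: eq_bigr => q _; rewrite rmorphM /=; ring.
  rewrite cint_sum; last by move=> p; exact: memL1_sum.
  by apply: eq_bigr => p _; rewrite cint_sum//; apply: eq_bigr => q _; rewrite cintZ.
rewrite (@eq_cint _ _ _ mu (fun x => fourier (step_of s) x * _) (fun x =>
  (\sum_(p <- s) p.1 * fourier (boxf p.2.1 p.2.2) x) *
  (\sum_(p <- s) p.1 * fourier (boxf p.2.1 p.2.2) x)^*%C)); last first.
  by move=> x; rewrite fourier_step.
rewrite (S s (fun p : I => fourier (boxf p.2.1 p.2.2))); last first.
  by move=> p q; case: (boxf_plancherel p.2.1 p.2.2 q.2.1 q.2.2).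
rewrite (S s (fun p : I => boxf p.2.1 p.2.2)); last first.
  move=> p q; apply: memL1_L2M; first exact: memL2_boxf.
  by apply: memL2_conj; exact: memL2_boxf.
transitivity (complex.Re (c0%:C * (\sum_(p <- s) \sum_(q <- s)
   p.1 * q.1^*%C * cint mu (fun x => boxf p.2.1 p.2.2 x * (boxf q.2.1 q.2.2 x)^*%C)))).
  congr complex.Re; rewrite mulr_sumr; apply: eq_bigr => p _.
  rewrite mulr_sumr; apply: eq_bigr => q _.
  by have [_ ->] := boxf_plancherel p.2.1 p.2.2 q.2.1 q.2.2; ring.
by rewrite Re_mul /= mul0r subr0.
Qed.

Definition approximable f := forall e : R, 0 < e ->
  exists s, (D12 mu (fun x => (f x - step_of s x)%R) < e%:E)%E.

Lemma approx_step s : approximable (step_of s).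
Proof.
move=> e e0; exists s; rewrite (_ : (fun _ => _) = (fun=> 0)).
  rewrite /D12 /N2 !integral0_eq// => [|x _|x _]; rewrite ?adde0 ?lte_fin//.
    by rewrite cabs0 expr0n.
  by rewrite cabs0.
by apply/funext => x; rewrite subrr.
Qed.

Lemma approx_boxf a b : approximable (boxf a b).
Proof.
rewrite (_ : boxf a b = step_of [:: (1, (a, b))]); first exact: approx_step.
by apply/funext => x; rewrite /step_of big_seq1 mul1r.
Qed.

Lemma cmeas_step s : cmeas (step_of s).
Proof. by have [[]] := memL12_step s. Qed.

Lemma approxD f g : cmeas f -> cmeas g -> approximable f -> approximable g ->
  approximable (fun x => f x + g x).
Proof.
(* Quarters, because [D12D] doubles both terms. *)
move=> mf mg af ag e e0; have e4 : 0 < e / 4 by rewrite divr_gt0.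
have [s sf] := af _ e4; have [t tg] := ag _ e4.
exists (s ++ t).
rewrite (_ : (fun _ => _) = (fun x => (f x - step_of s x) + (g x - step_of t x))).
  apply: le_lt_trans (D12D mu (cmeasB mf (cmeas_step s)) (cmeasB mg (cmeas_step t))) _.
  rewrite (_ : e%:E = 2%:E * (e / 4)%:E + 2%:E * (e / 4)%:E)%E; last first.
    by rewrite -!EFinM -EFinD; congr EFin; field.
  by apply: lteD; rewrite lte_pmul2l// lte_fin.
by apply/funext => x; rewrite /step_of big_cat /=; ring.
Qed.

Lemma approxZ (z : R[i]) f : cmeas f -> approximable f -> approximable (fun x => z * f x).
Proof.
(* The added 1 keeps the divisor positive when z = 0. *)
move=> mf af e e0; pose C := cabs z + cabs z ^+ 2 + 1.
have C0 : 0 < C by rewrite ltr_wpDl// addr_ge0 ?cabs_ge0 ?sqr_ge0.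
have eC : 0 < e / C by rewrite divr_gt0.
have [s sf] := af _ eC.
exists [seq (z * p.1, p.2) | p <- s].
rewrite (_ : (fun _ => _) = (fun x => z * (f x - step_of s x))).
  apply: le_lt_trans (D12Z mu z (cmeasB mf (cmeas_step s))) _.
  rewrite (_ : e%:E = C%:E * (e / C)%:E)%E; last first.
    by rewrite -EFinM; congr EFin; field; rewrite gt_eqF.
  apply: (@le_lt_trans _ _ (C%:E * D12 mu (fun x => (f x - step_of s x)%R))%E).
    by rewrite lee_wpmul2r ?D12_ge0// lee_fin /C lerDl.
  by rewrite lte_pmul2l.
apply/funext => x; rewrite mulrBr /step_of big_map mulr_sumr.
by congr (_ - _); apply: eq_bigr => p _; rewrite mulrA.
Qed.

Lemma approxB f g : cmeas f -> cmeas g -> approximable f -> approximable g ->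
  approximable (fun x => f x - g x).
Proof.
move=> mf mg af ag.
rewrite (_ : (fun _ => _) = (fun x => f x + (-1) * g x)).
  apply: approxD => //; last exact: approxZ.
  by apply: cmeasM => //; exact: cmeas_cst.
by apply/funext => x; rewrite mulN1r.
Qed.

Lemma approx_lim f : cmeas f -> (forall e : R, 0 < e -> exists g,
    [/\ cmeas g, approximable g & (D12 mu (fun x => (f x - g x)%R) < e%:E)%E]) -> approximable f.
Proof.
move=> mf H e e0; have e4 : 0 < e / 4 by rewrite divr_gt0.
have [g [mg ag fg]] := H _ e4; have [s gs] := ag _ e4.
exists s; rewrite (_ : (fun _ => _) = (fun x => (f x - g x) + (g x - step_of s x))).
  apply: le_lt_trans (D12D mu (cmeasB mf mg) (cmeasB mg (cmeas_step s))) _.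
  rewrite (_ : e%:E = 2%:E * (e / 4)%:E + 2%:E * (e / 4)%:E)%E; last first.
    by rewrite -!EFinM -EFinD; congr EFin; field.
  by apply: lteD; rewrite lte_pmul2l// lte_fin.
by apply/funext => x; ring.
Qed.

Lemma approx_cvg f (g : nat -> E -> R[i]) : cmeas f -> (forall k, cmeas (g k)) ->
  (forall k, approximable (g k)) ->
  D12 mu (fun x => g k x - f x) @[k --> \oo] --> 0%E -> approximable f.
Proof.
move=> mf mg ag gf; apply: approx_lim => // e e0.
have : \forall k \near \oo, (D12 mu (fun x => (g k x - f x)%R) < e%:E)%E.
  by apply: (gf (fun y => (y < e%:E)%E)); apply: open_ereal_lt'; rewrite lte_fin.
move=> /filter_ex[k gk]; exists (g k); split => //.
by rewrite D12B.
Qed.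

End plancherel.

Lemma cabs_realB (R : realType) (s t : R) : cabs (s%:C - t%:C) = `|s - t|.
Proof. by rewrite -cabs_real rmorphB. Qed.

(** * Density of the step functions in L^1 /\ L^2 *)

Section density.
Context {R : realType} (n : nat).
Local Notation E := 'rV[R]_n.
Local Notation mu := (@lebesgue_rV R n).
Implicit Types (f g : E -> R[i]) (x xi : E) (A B : set E).

Definition cube (k : nat) : set E := box (fun=> - k%:R) (fun=> k%:R).

Lemma measurable_cube k : measurable (cube k).
Proof. exact: measurable_box. Qed.

Lemma cube_bound x : exists k, forall m, (k <= m)%N -> cube m x.
Proof.
pose M := \sum_(j < n) `|x ord0 j|.
have xM j : `|x ord0 j| <= M by rewrite /M (bigD1 j)//= lerDl sumr_ge0.
have M0 : 0 <= M by rewrite sumr_ge0.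
exists (Num.bound M) => m km j; rewrite /ocset /= in_itv/=.
have := xM j; rewrite ler_norml => /andP[x1 x2].
have Mk := archi_boundP M0.
have {}Mk : M < m%:R by rewrite (lt_le_trans Mk)// ler_nat.
by rewrite (lt_le_trans _ x1) ?ltrN2//= (le_trans x2)// ltW.
Qed.

Lemma memL12_indic_cube A k : measurable A ->
  memL12 mu (fun x => (\1_(A `&` cube k) x)%:C : R[i]).
Proof.
move=> mA; have mAc : measurable (A `&` cube k).
  by apply: measurableI => //; exact: measurable_cube.
have Aoo : (mu (A `&` cube k) < +oo)%E.
  apply: le_lt_trans (@lebesgue_box_lty R n (fun=> - k%:R) (fun=> k%:R)).
  by apply: le_measure; rewrite ?inE//; exact: measurable_cube.
by split; [exact: memL1_indic|exact: memL2_indic].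
Qed.

Lemma cmeas_indicC A : measurable A -> cmeas (fun x => (\1_A x)%:C : R[i]).
Proof. by move=> mA; apply: cmeas_real; exact: measurable_indic. Qed.

(** Dynkin induction from the boxes. Intersecting with a fixed cube keeps all measures finite, so
    that a complement becomes a difference from the indicator of the cube and a countable disjoint
    union a dominated limit. *)
Lemma approximable_indic_cube A k : measurable A ->
  approximable (fun x => (\1_(A `&` cube k) x)%:C).
Proof.
have H := @dynkin_induction _ E
  [set box p.1 p.2 | p in [set: ('I_n -> R) * ('I_n -> R)]]
  (fun A => approximable (fun x => (\1_(A `&` cube k) x)%:C))
  (measurable_box_generated n).
move=> mA; apply: H; last by rewrite -measurable_box_generated.
- move=> _ _ [p _ <-] [q _ <-].
  exists (fun i => Num.max (p.1 i) (q.1 i), fun i => Num.min (p.2 i) (q.2 i)) => //=.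
  by rewrite boxI.
- rewrite setTI /cube (_ : (fun _ => _) = boxf (fun=> - k%:R) (fun=> k%:R)).
    exact: approx_boxf.
  by rewrite boxf_fun.
- move=> _ [p _ <-]; rewrite /cube boxI -boxf_fun; exact: approx_boxf.
- move=> B mB aB.
  rewrite (_ : (fun _ => _) = (fun x => boxf (fun=> - k%:R) (fun=> k%:R) x -
      (\1_(B `&` cube k) x)%:C)).
    apply: approxB => //; last exact: approx_boxf.
      by case: (memL1_boxf (fun _ : 'I_n => - k%:R) (fun=> k%:R) : memL1 mu _).
    by apply: cmeas_indicC; apply: measurableI => //; exact: measurable_cube.
  apply/funext => x; rewrite boxfE -/(cube k) !indicE !in_setI in_setC.
  by case: (x \in B); case: (x \in cube k); rewrite /= ?subr0 ?subrr.
move=> F mF tF aF; pose U m := \big[setU/set0]_(i < m) F i.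
have mU m : measurable (U m) by apply: bigsetU_measurable => i _.
have mI m : measurable (U m `&` cube k).
  by apply: measurableI => //; exact: measurable_cube.
have mV : measurable (\bigcup_k F k) by exact: bigcup_measurable.
have mVI : measurable ((\bigcup_k F k) `&` cube k).
  by apply: measurableI => //; exact: measurable_cube.
have sub m : U m `<=` \bigcup_k F k.
  by rewrite /U -bigcup_mkord => x [i _ Fix]; exists i.
apply: (@approx_cvg _ _ _ (fun m x => (\1_(U m `&` cube k) x)%:C)).
- exact: cmeas_indicC.
- by move=> m; exact: cmeas_indicC.
- elim=> [|m IH].
    rewrite (_ : (fun _ => _) = step_of [::]); first exact: approx_step.
    by apply/funext => x; rewrite /U big_ord0 set0I indic0 /step_of big_nil.
  rewrite (_ : (fun _ => _) = (fun x => (\1_(U m `&` cube k) x)%:C +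
      (\1_(F m `&` cube k) x)%:C)).
    apply: approxD => //; apply: cmeas_indicC => //.
    by apply: measurableI => //; exact: measurable_cube.
  apply/funext => x; rewrite /U big_ord_recr/= -/(U m) -rmorphD; congr (_%:C).
  rewrite !indicE !in_setI in_setU.
  have [xc|] := boolP (x \in cube k); last by rewrite !andbF addr0.
  rewrite !andbT; have [xU|xU] := boolP (x \in U m); last by rewrite add0r.
  rewrite [x \in F m](_ : _ = false) ?addr0//; apply/negbTE; rewrite notin_setE => xF.
  move: xU; rewrite inE /U -bigcup_mkord => -[i /= im xFi].
  have /trivIsetP/(_ m i Logic.I Logic.I) := tF.
  rewrite neq_ltn im orbT => /(_ isT) FF.
  by have : (F m `&` F i) x by []; rewrite FF.
apply: (@D12_dominated0 _ _ _ mu _ (fun x => (\1_((\bigcup_k F k) `&` cube k) x)%:C)).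
- by move=> m; apply: cmeasB; exact: cmeas_indicC.
- exact: memL12_indic_cube.
- move=> m x; rewrite cabs_realB !cabs_real !indicE !in_setI.
  have [xc|] := boolP (x \in cube k); last by rewrite !andbF subrr normr0.
  rewrite !andbT; have [xU|xU] := boolP (x \in U m); last by rewrite sub0r normrN.
  rewrite [x \in \bigcup_k F k](_ : _ = true) ?subrr ?normr0 ?normr1//.
  by apply/mem_set/(sub m); rewrite inE in xU.
- move=> x; apply: cvg_near_cst.
  have [[i _ Fix]|nx] := pselect ((\bigcup_k F k) x).
    near=> m; rewrite cabs_realB !indicE !in_setI.
    rewrite [x \in \bigcup_k F k]mem_set; last by exists i.
    rewrite [x \in U m]mem_set ?subrr ?normr0// /U -bigcup_mkord; exists i => //=.
    by near: m; exact: nbhs_infty_gt.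
  near=> m; rewrite cabs_realB !indicE !in_setI.
  rewrite [x \in \bigcup_k F k]memNset// [x \in U m]memNset ?subrr ?normr0//.
  by move=> /(sub m).
Unshelve. all: by end_near. Qed.

Import HBNNSimple.

(** The increasing simple functions below g are also cut to growing cubes, since only indicators of
    sets inside a cube are known to be approximable; g dominates the whole sequence. *)
Lemma approximable_ge0 (g : E -> R) : measurable_fun setT g ->
  (forall x, 0 <= g x) -> memL12 mu (fun x => (g x)%:C : R[i]) ->
  approximable (fun x => (g x)%:C).
Proof.
move=> mg g0 g12.
have mEg : measurable_fun setT (EFin \o g) by exact/measurable_EFinP.
have Eg0 x : setT x -> (0 <= (EFin \o g) x)%E by rewrite /= lee_fin.
pose u := nnsfun_approx measurableT mEg.
have ucv x : u k x @[k --> \oo] --> g x.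
  by have /fine_cvgP[_] := @cvg_nnsfun_approx _ _ _ _ measurableT _ mEg Eg0 x Logic.I.
have und x a b : (a <= b)%N -> u a x <= u b x.
  by move=> ab; have /lefP := @nd_nnsfun_approx _ _ _ _ measurableT _ mEg a b ab; apply.
have ule k x : u k x <= g x.
  rewrite -(cvg_lim (@Rhausdorff R) (ucv x)).
  apply: (@nondecreasing_cvgn_le _ (u^~ x)); [by move=> a b; exact: und|].
  by apply/cvg_ex; exists (g x); exact: ucv.
have u0 k x : 0 <= u k x by [].
have mh k : measurable_fun setT (fun x => u k x * \1_(cube k) x).
  by apply: measurable_funM => //; apply: measurable_indic; exact: measurable_cube.
apply: (@approx_cvg _ _ _ (fun k x => (u k x * \1_(cube k) x)%:C)).
- exact: cmeas_real.
- by move=> k; exact: cmeas_real.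
- move=> k.
  pose s := finmap.enum_fset (fset_set (range (u k))).
  rewrite (_ : (fun _ => _) = (fun x => \sum_(y <- s)
      y%:C * (\1_((u k @^-1` [set y]) `&` cube k) x)%:C)); last first.
    apply/funext => x; rewrite fimfunE fsbig_finite//= mulr_suml rmorph_sum /=.
    apply: eq_bigr => y _; rewrite -rmorphM /=; congr (_%:C).
    by rewrite indicI /= mulrA.
  have ms y : measurable ((u k @^-1` [set y]) `&` cube k).
    by apply: measurableI; [exact: measurable_sfunP|exact: measurable_cube].
  elim: s => [|y t IH].
    rewrite (_ : (fun _ => _) = step_of [::]); first exact: approx_step.
    by apply/funext => x; rewrite /step_of !big_nil.
  under eq_fun do rewrite big_cons.
  apply: approxD => //.
  + by apply: cmeasM; [exact: cmeas_cst|exact: cmeas_indicC].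
  + apply: cmeas_sum => z; apply: cmeasM; [exact: cmeas_cst|exact: cmeas_indicC].
  + apply: approxZ; first exact: cmeas_indicC.
    by apply: approximable_indic_cube; exact: measurable_sfunP.
apply: (@D12_dominated0 _ _ _ mu _ (fun x => (g x)%:C)) => //.
- by move=> k; apply: cmeasB; exact: cmeas_real.
- move=> k x; rewrite cabs_realB !cabs_real (ger0_norm (g0 x)) distrC.
  rewrite ger0_norm ?subr_ge0; last first.
    by rewrite indicE; case: (_ \in _); rewrite ?mulr1 ?mulr0.
  by rewrite lerBlDr lerDl mulr_ge0.
- move=> x.
  rewrite (_ : (fun _ => _) = (fun k => `|u k x * \1_(cube k) x - g x|)); last first.
    by apply/funext => k; rewrite cabs_realB.
  rewrite -[X in _ --> X](normr0 R) -(subrr (g x)); apply: cvg_norm.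
  apply: cvgB; last exact: cvg_cst.
  have [k0 Hk] := cube_bound x.
  apply: cvg_trans (ucv x); apply: near_eq_cvg.
  near=> k; rewrite indicE mem_set ?mulr1//; apply: Hk.
  by near: k; exact: nbhs_infty_ge.
Unshelve. all: by end_near. Qed.

Lemma memL12_real_le f (g : E -> R) : memL12 mu f -> measurable_fun setT g ->
  (forall x, `|g x| <= cabs (f x)) -> memL12 mu (fun x => (g x)%:C).
Proof.
move=> [f1 f2] mg gf; split.
  apply: (memL1_le (cmeas_real mg) (memL1_cabs f1)) => x.
  by rewrite cabs_real.
split; first exact: cmeas_real.
apply: le_lt_trans f2.2; apply: le_N2; [exact: cmeas_real|exact: f1.1|].
by move=> x; rewrite cabs_real.
Qed.

Lemma approximable_real f (g : E -> R) : memL12 mu f -> measurable_fun setT g ->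
  (forall x, `|g x| <= cabs (f x)) -> approximable (fun x => (g x)%:C).
Proof.
move=> f12 mg gf.
have mp : measurable_fun setT (fun x => Num.max (g x) 0) by exact: measurable_maxr.
have mn : measurable_fun setT (fun x => Num.max (- g x) 0).
  by apply: measurable_maxr => //; exact: measurableT_comp.
rewrite (_ : (fun _ => _) = (fun x => (Num.max (g x) 0)%:C - (Num.max (- g x) 0)%:C)).
  apply: approxB; try exact: cmeas_real.
  - apply: approximable_ge0 => //; first by move=> x; rewrite le_max lexx orbT.
    apply: memL12_real_le f12 _ _ => // x; rewrite (le_trans _ (gf x))//.
    by case: (leP (g x) 0) => h; rewrite ?normr0.
  - apply: approximable_ge0 => //; first by move=> x; rewrite le_max lexx orbT.
    apply: memL12_real_le f12 _ _ => // x; rewrite (le_trans _ (gf x))//.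
    by case: (leP (- g x) 0) => h; rewrite ?normr0 ?normrN.
apply/funext => x; rewrite -rmorphB /=; congr (_%:C).
by case: (leP (g x) 0) => h1; case: (leP (- g x) 0) => h2; lra.
Qed.

Lemma approximable_memL12 f : memL12 mu f -> approximable f.
Proof.
move=> f12; have [[m1 m2] _] := f12.1.
rewrite (_ : f = (fun x => (complex.Re (f x))%:C + 'i * (complex.Im (f x))%:C)).
  apply: approxD; try exact: cmeas_real.
  - by apply: cmeasM; [exact: cmeas_cst|exact: cmeas_real].
  - by apply: approximable_real f12 _ _ => // x; exact: normr_Re.
  - apply: approxZ; first exact: cmeas_real.
    by apply: approximable_real f12 _ _ => // x; exact: normr_Im.
by apply/funext => x; exact: complexE.
Qed.

End density.

(** * Plancherel and Parseval by density *)

Section plancherel_theorem.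
Context {R : realType} (n : nat).
Local Notation E := 'rV[R]_n.
Local Notation mu := (@lebesgue_rV R n).
Implicit Types (f g : E -> R[i]) (x xi : E).

Definition cst_pi : R := (2 * pi) ^+ n.

Lemma cst_pi_gt0 : 0 < cst_pi.
Proof. by rewrite exprn_gt0// mulr_gt0// pi_gt0. Qed.

Let N2fin f : memL2 mu f -> N2 mu f \is a fin_num.
Proof. by move=> [_ f2]; rewrite ge0_fin_numE// N2_ge0. Qed.

(** Closeness in L^1 makes the transforms of the step functions converge pointwise, and Fatou turns
    their Plancherel identity into an inequality in the limit. In particular the transform of f lies
    in L^2, which the proof of equality presupposes. *)
Lemma fourier_contraction f : memL12 mu f ->
  (N2 mu (fourier f) <= cst_pi%:E * N2 mu f)%E.
Proof.
move=> f12; have f1 := f12.1; have f2 := f12.2; have mf := f1.1.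
have c0 := cst_pi_gt0.
rewrite -(fineK (N2fin f2)); set A := fine (N2 mu f).
have A0 : 0 <= A by rewrite fine_ge0// N2_ge0.
apply/lee_addgt0Pr => e e0.
(* [eta] solves cst_pi * eta * (A + 1) = e: the allowed excess is spent both on the factor 1 + eta
   and on the additive error. *)
have [eta eta0 etaE] : exists2 eta : R, 0 < eta &
    cst_pi * A + e = cst_pi * ((1 + eta) * A + eta).
  exists (e / (cst_pi * (A + 1))); first by rewrite divr_gt0// mulr_gt0// ltr_wpDl.
  by field; rewrite !gt_eqF// ltr_wpDl.
(* These tolerances tend to 0, and (1 + 1/eta) d k <= eta, so the error term in [N2D] costs at most
   eta. *)
pose d (k : nat) := eta / ((1 + eta^-1) * k.+1%:R).
have ei0 : 0 < 1 + eta^-1 by rewrite addr_gt0// invr_gt0.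
have d0 k : 0 < d k by rewrite divr_gt0// mulr_gt0// ltr0n.
have /choice[s sP] : forall k : nat, exists s,
    (D12 mu (fun x => (f x - step_of s x)%R) < (d k)%:E)%E.
  by move=> k; exact: approximable_memL12 f12 _ (d0 k).
have s12 k := @memL12_step R n (s k).
have fs12 k := memL12B f12 (s12 k).
apply: (@N2_fatou _ _ _ mu (fun k => fourier (step_of (s k)))).
- by move=> k; apply: cmeas_fourier; exact: cmeas_step.
- move=> xi; apply: (@squeeze_cvgr _ _ _ _ (fun=> 0) (fun k => 2 * d k)).
  + near=> k; rewrite cabs_ge0 andTb cabsB -fourierB; [|exact: f1|exact: (s12 k).1].
    rewrite -lee_fin; apply: le_trans (cabs_fourier _ (fs12 k).1) _.
    rewrite EFinM lee_wpmul2l// ?lee_fin//.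
    apply: le_trans (ltW (sP k)); exact: L1norm_le_D12.
  + exact: cvg_cst.
  + rewrite (_ : (fun k => 2 * d k) =
        (fun k => (2 * (eta / (1 + eta^-1))) * k.+1%:R^-1)).
      rewrite -[X in _ --> X](mulr0 (2 * (eta / (1 + eta^-1)))).
      by apply: cvgMl_tmp; exact: cvg_harmonic.
    apply/funext => k; rewrite /d; field.
    by apply/and3P; split; rewrite gt_eqF// ?addr_gt0// ltr_pwDl.
- move=> k; rewrite step_plancherel.
  have k1 : N2 mu (step_of (s k)) = N2 mu (fun x => f x + - (f x - step_of (s k) x)).
    by congr N2; apply/funext => x; ring.
  rewrite -EFinM -EFinD etaE.
  rewrite EFinM; apply: lee_wpmul2l; first by rewrite lee_fin ltW.
  rewrite k1.
  apply: le_trans (N2D mu eta0 mf (cmeasN (cmeasB mf (cmeas_step (s k))))) _.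
  rewrite [leRHS]EFinD [X in (_ <= X + _)%E]EFinM -(fineK (N2fin f2)); apply: leeD => //.
  rewrite (_ : N2 mu _ = N2 mu (fun x => f x - step_of (s k) x)); last first.
    by rewrite N2B; congr N2; apply/funext => x; ring.
  apply: (@le_trans _ _ ((1 + eta^-1)%:E * (d k)%:E)%E).
    apply: lee_wpmul2l; first by rewrite lee_fin ltW.
    by rewrite ltW// (le_lt_trans (N2_le_D12 _ _) (sP k)).
  have -> : ((1 + eta^-1)%:E * (d k)%:E)%E = (eta / k.+1%:R)%:E.
    rewrite -EFinM; congr EFin; rewrite /d; field.
    by apply/and3P; split; rewrite gt_eqF// ?addr_gt0// ltr_pwDl.
  rewrite lee_fin.
  rewrite ler_pdivrMr ?ltr0n//; apply: ler_peMr; first exact: ltW.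
  by rewrite ler1n.
Unshelve. all: by end_near. Qed.

Lemma memL2_fourier f : memL12 mu f -> memL2 mu (fourier f).
Proof.
move=> f12; split; first by apply: cmeas_fourier; exact: f12.1.1.
apply: le_lt_trans (fourier_contraction f12) _.
rewrite lte_mul_pinfty ?lee_fin ?ltW ?cst_pi_gt0//.
exact: f12.2.2.
Qed.

(** For the reverse inequality, f is replaced by a nearby step function, where equality holds; the
    transform of the small difference is bounded by [fourier_contraction]. *)
Theorem plancherel f : memL12 mu f ->
  N2 mu (fourier f) = (cst_pi%:E * N2 mu f)%E.
Proof.
move=> f12; apply/eqP; rewrite eq_le fourier_contraction//=.
have f2 := f12.2; have mf := f12.1.1; have F2 := memL2_fourier f12.
have c0 := cst_pi_gt0.
rewrite -(fineK (N2fin f2)) -(fineK (N2fin F2)).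
set A := fine (N2 mu f); set B := fine (N2 mu (fourier f)).
have A0 : 0 <= A by rewrite fine_ge0// N2_ge0.
have B0 : 0 <= B by rewrite fine_ge0// N2_ge0.
rewrite -EFinM lee_fin; apply/ler_addgt0Pr => e e0.
(* The final error is (2 eta + eta^2)(B + cst_pi), at most 3 eta (B + cst_pi) because eta <= 1,
   hence at most e. *)
pose eta := Num.min 1 (e / (3 * B + 3 * cst_pi)).
have BC : 0 < 3 * B + 3 * cst_pi by lra.
have eta0 : 0 < eta by rewrite lt_min ltr01 divr_gt0.
have eta1 : eta <= 1 by rewrite ge_min lexx.
have etae : eta * (3 * B + 3 * cst_pi) <= e.
  by rewrite -ler_pdivlMr// ge_min lexx orbT.
have ei0 : 0 < 1 + eta^-1 by rewrite addr_gt0// invr_gt0.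
have d0 : 0 < eta / (1 + eta^-1) by rewrite divr_gt0.
have [s sP] := approximable_memL12 f12 d0.
have s12 := @memL12_step R n s; have ms := cmeas_step s.
have fs12 := memL12B f12 s12.
have mfs := fs12.1.1.
have N1 : (N2 mu (fun x => (f x - step_of s x)%R) <= (eta / (1 + eta^-1))%:E)%E.
  by rewrite ltW// (le_lt_trans (N2_le_D12 _ _) sP).
have K1 : (N2 mu f <= (1 + eta)%:E * N2 mu (step_of s) + eta%:E)%E.
  rewrite [X in (N2 mu X <= _)%E](_ : f = (fun x => step_of s x + (f x - step_of s x))); last first.
    by apply/funext => x; ring.
  apply: le_trans (N2D mu eta0 ms mfs) _; apply: leeD => //.
  apply: (@le_trans _ _ ((1 + eta^-1)%:E * (eta / (1 + eta^-1))%:E)%E).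
    by rewrite lee_wpmul2l// lee_fin ltW.
  by rewrite -EFinM lee_fin mulrCA divff ?mulr1// gt_eqF.
have K2 : (cst_pi%:E * N2 mu (step_of s) <=
    (1 + eta)%:E * N2 mu (fourier f) + (cst_pi * eta)%:E)%E.
  rewrite -step_plancherel.
  rewrite [X in (N2 mu X <= _)%E](_ : fourier (step_of s) =
      (fun xi => fourier f xi + - fourier (fun x => f x - step_of s x) xi)); last first.
    apply/funext => xi; rewrite fourierB ?opprB//; [|exact: f12.1|exact: s12.1].
    by rewrite addrC subrK.
  have mF h : cmeas h -> cmeas (fourier h : E -> R[i]) by exact: cmeas_fourier.
  apply: le_trans (N2D mu eta0 (mF _ mf) (cmeasN (mF _ mfs))) _; apply: leeD => //.
  rewrite (_ : N2 mu _ = N2 mu (fourier (fun x => f x - step_of s x))); last first.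
    by rewrite /N2; under eq_integral do rewrite cabsN.
  apply: (@le_trans _ _ ((1 + eta^-1)%:E * (cst_pi%:E * (eta / (1 + eta^-1))%:E))%E).
    apply: lee_wpmul2l; first by rewrite lee_fin ltW.
    apply: le_trans (fourier_contraction fs12) _.
    by rewrite lee_wpmul2l// lee_fin ltW.
  rewrite -!EFinM lee_fin [leLHS](_ : _ = cst_pi * eta)//.
  by field; rewrite !gt_eqF// addr_gt0.
have S2 := s12.2; move: K1 K2.
rewrite -(fineK (N2fin f2)) -(fineK (N2fin F2)) -(fineK (N2fin S2)) -/A -/B.
set S := fine (N2 mu (step_of s)).
rewrite -!EFinM -!EFinD !lee_fin => K1 K2.
apply: (@le_trans _ _ ((1 + eta) * ((1 + eta) * B + cst_pi * eta) + cst_pi * eta)).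
  apply: (@le_trans _ _ (cst_pi * ((1 + eta) * S + eta))).
    by rewrite ler_wpM2l// ltW.
  rewrite [leLHS](_ : _ = (1 + eta) * (cst_pi * S) + cst_pi * eta); last by ring.
  by rewrite lerD2r ler_wpM2l// addr_ge0// ltW.
have e2 : eta * eta <= eta by rewrite ler_piMr// ltW.
have t1 : eta * eta * B <= eta * B by rewrite ler_wpM2r.
have t2 : eta * eta * cst_pi <= eta * cst_pi by rewrite ler_wpM2r// ltW.
have -> : (1 + eta) * ((1 + eta) * B + cst_pi * eta) + cst_pi * eta =
  B + (2 * (eta * B) + eta * eta * B) + (2 * (eta * cst_pi) + eta * eta * cst_pi) by ring.
have -> : B + e = B + e by [].
have : eta * (3 * B + 3 * cst_pi) = 3 * (eta * B) + 3 * (eta * cst_pi) by ring.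
move=> H; rewrite H in etae; lra.
Qed.

(** Polarization: Plancherel for the sum of f and g gives the real parts, and the same with 'i g in
    place of g gives the imaginary parts. *)
Lemma parseval f g : memL12 mu f -> memL12 mu g ->
  cint mu (fun xi => fourier f xi * (fourier g xi)^*%C) =
  cst_pi%:C * cint mu (fun x => f x * (g x)^*%C).
Proof.
move=> f12.
have ReP h : memL12 mu h ->
    complex.Re (cint mu (fun xi => fourier f xi * (fourier h xi)^*%C)) =
    cst_pi * complex.Re (cint mu (fun x => f x * (h x)^*%C)).
  move=> h12; have fh12 := memL12D f12 h12.
  have := plancherel fh12.
  have -> : fourier (fun x => f x + h x) = (fun xi => fourier f xi + fourier h xi).
    by apply/funext => xi; rewrite fourierD//; [exact: f12.1|exact: h12.1].
  rewrite (N2D_cint (memL2_fourier f12) (memL2_fourier h12)) (N2D_cint f12.2 h12.2).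
  rewrite !plancherel//.
  rewrite -(fineK (N2fin f12.2)) -(fineK (N2fin h12.2)) -!(EFinM, EFinD).
  move: (complex.Re (cint mu (fun xi => fourier f xi * _)))
    (complex.Re (cint mu (fun x => f x * _))) (fine _) (fine _) => p q a b [H].
  have : 2 * p = 2 * (cst_pi * q) by move: H; rewrite !mulrDr => /addrI ->; ring.
  by apply: mulfI.
move=> g12; apply: complex_ext.
  by rewrite ReP// Re_mul /= mul0r subr0.
have g12' := memL12Z 'i g12.
have := ReP _ g12'.
have X (u v : E -> R[i]) : memL2 mu u -> memL2 mu v ->
   complex.Re (cint mu (fun x => u x * ('i * v x)^*%C)) =
   complex.Im (cint mu (fun x => u x * (v x)^*%C)).
  move=> u2 v2; have uv1 := memL1_L2M u2 (memL2_conj v2).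
  rewrite (@eq_cint _ _ _ mu _ (fun x => ('i)^*%C * (u x * (v x)^*%C))); last first.
    by move=> x; rewrite rmorphM /=; ring.
  by rewrite cintZ// Re_mul /=; ring.
have -> : fourier (fun x => 'i * g x) = (fun xi => 'i * fourier g xi).
  by apply/funext => xi; rewrite fourierZ//; exact: g12.1.
rewrite (X _ _ (memL2_fourier f12) (memL2_fourier g12)) (X _ _ f12.2 g12.2).
by move=> ->; rewrite Im_mul /= mul0r addr0.
Qed.

End plancherel_theorem.

(** * The Fourier transform on L^2 *)

Section riesz_fischer.
Context d (T : measurableType d) (R : realType).
Variable mu : {measure set T -> \bar R}.
Implicit Types (f g h : T -> R[i]).

(* Telescoping with |a + b|^2 <= 2 |a|^2 + 2 |b|^2 replaces Minkowski's
   inequality. *)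
Lemma telescope_sqr (F : nat -> R[i]) (k i : nat) :
  2 ^+ k * cabs (F (k + i)%N - F k) ^+ 2 <=
  2 * \sum_(k <= j < k + i) 2 ^+ j * cabs (F j.+1 - F j) ^+ 2.
Proof.
elim: i k => [|i IH] k.
  by rewrite addn0 subrr cabs0 expr0n mulr0 big_geq// mulr0.
rewrite -addSnnS [leRHS](_ : _ = 2 * (2 ^+ k * cabs (F k.+1 - F k) ^+ 2) +
    2 * \sum_(k.+1 <= j < k.+1 + i) 2 ^+ j * cabs (F j.+1 - F j) ^+ 2); last first.
  by rewrite big_ltn ?addSn ?ltnS ?leq_addr// mulrDr.
have k0 : 0 <= 2 ^+ k :> R by rewrite exprn_ge0.
have := @cabs_sqrD R 1 (F k.+1 - F k) (F (k.+1 + i)%N - F k.+1) ltr01.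
rewrite (_ : F k.+1 - F k + (F (k.+1 + i)%N - F k.+1) = F (k.+1 + i)%N - F k); last by ring.
move=> H; have {}H := ler_wpM2l k0 H; apply: le_trans H _.
rewrite invr1 mulrDr; have := IH k.+1; rewrite exprS.
set X := \sum_(_ <= _ < _) _; set Y := cabs _ ^+ 2; set Z := cabs _ ^+ 2.
move=> {}IH; lra.
Qed.

(** The series G of the 2^k |F (k+1) - F k|^2 has integral at most the sum of the 2^-k, so it is
    finite almost everywhere, and where it is finite the sequence is Cauchy by [telescope_sqr]. The
    decay 4^-k in the hypothesis is what beats the weight 2^k. *)
Lemma riesz_fischer (F : nat -> T -> R[i]) : (forall k, memL2 mu (F k)) ->
  (forall k, N2 mu (fun x => (F k.+1 x - F k x)%R) <= ((4 ^+ k)^-1)%:E)%E ->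
  exists2 f, memL2 mu f & N2 mu (fun x => F k x - f x) @[k --> \oo] --> 0%E.
Proof.
move=> F2 Fd.
pose a k x := 2 ^+ k * cabs (F k.+1 x - F k x) ^+ 2.
have a0 k x : 0 <= a k x by rewrite mulr_ge0 ?sqr_ge0// exprn_ge0.
have ma k : measurable_fun setT (fun x => (a k x)%:E).
  apply/measurable_EFinP; apply: measurable_funM => //.
  by apply: cmeas_cabs2; apply: cmeasB; [case: (F2 k.+1)|case: (F2 k)].
pose G x := (\sum_(0 <= k <oo) (a k x)%:E)%E.
have G0 x : (0 <= G x)%E by apply: nneseries_ge0 => k _ _; rewrite lee_fin.
have mG : measurable_fun setT G.
  by apply: ge0_emeasurable_sum => // k x _ _; rewrite lee_fin.
have GI : (\int[mu]_x G x <= 2%:E)%E.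
  rewrite integral_nneseries//; last by move=> k x _; rewrite lee_fin.
  apply: (@le_trans _ _ (\sum_(0 <= k <oo) ((1 / 2 ^+ k : R)%:E))%E).
    apply: lee_nneseries => k _.
      by move=> _; apply: integral_ge0 => x _; rewrite lee_fin.
    rewrite (_ : (fun x => (a k x)%:E) =
       fun x => ((2 ^+ k)%:E * (cabs (F k.+1 x - F k x) ^+ 2)%:E)%E)//.
    rewrite ge0_integralZl_EFin ?exprn_ge0//; last 2 first.
    - by move=> x _; rewrite lee_fin sqr_ge0.
    - apply/measurable_EFinP; apply: cmeas_cabs2.
      by apply: cmeasB; [case: (F2 k.+1)|case: (F2 k)].
    apply: (@le_trans _ _ ((2 ^+ k)%:E * ((4 ^+ k)^-1)%:E)%E).
      by apply: lee_wpmul2l; [rewrite lee_fin exprn_ge0|exact: Fd].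
    rewrite -EFinM lee_fin (_ : 4 = 2 * 2 :> R); last by lra.
    by rewrite exprMn invfM mulrA divff ?expf_neq0// mul1r.
  have H := @epsilon_trick0 R 2 xpredT (ler0n R 2).
  apply: le_trans H.
  apply: lee_nneseries => k _; first by move=> _; rewrite lee_fin divr_ge0// exprn_ge0.
  by rewrite lee_fin natrX exprS invfM mulrA divff// mul1r.
pose A := [set x | (G x < +oo)%E].
have mA : measurable A.
  by rewrite /A -[X in measurable X]setTI; exact: emeasurable_fun_infty_o.
have bnd k i x : ((2 ^+ k * cabs (F (k + i)%N x - F k x) ^+ 2)%:E <= 2%:E * G x)%E.
  apply: (@le_trans _ _ (2 * \sum_(k <= j < k + i) a j x)%:E).
    by rewrite lee_fin; exact: (telescope_sqr (fun k => F k x)).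
  rewrite EFinM; apply: lee_wpmul2l; first by rewrite lee_fin.
  apply: (@le_trans _ _ (\sum_(0 <= j < k + i) (a j x)%:E)%E).
    rewrite -sumEFin [leRHS](big_cat_nat (n := k)) ?leq_addr//=.
    by rewrite leeDr// sume_ge0// => j _; rewrite lee_fin.
  by apply: nneseries_lim_ge => j _ _; rewrite lee_fin.
have bndA k i x : A x ->
    cabs (F (k + i)%N x - F k x) ^+ 2 <= 2 * fine (G x) / 2 ^+ k.
  move=> Ax; rewrite ler_pdivlMr ?exprn_gt0// mulrC.
  have Gf : G x = (fine (G x))%:E by rewrite fineK// ge0_fin_numE.
  by have := bnd k i x; rewrite [in X in X -> _]Gf -EFinM lee_fin.
(* Multiplying by the indicator of [A] makes the limit exist at every point, with value 0 outside
   [A]. *)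
pose h k x := ((\1_A x : R)%:C : R[i]) * F k x.
have mh k : cmeas (h k) by apply: cmeas_indic => //; case: (F2 k).
have hE k x : A x -> h k x = F k x by move=> Ax; rewrite /h indicE mem_set// mul1r.
have hNE k x : ~ A x -> h k x = 0 by move=> Ax; rewrite /h indicE memNset// mul0r.
have hC (q : R[i] -> R) x : (forall z w, `|q z - q w| <= cabs (z - w)) ->
    cvgn (fun k => q (h k x)).
  move=> qL; have [Ax|nAx] := pselect (A x); last first.
    by under eq_fun do rewrite hNE//; exact: is_cvg_cst.
  apply/cauchy_cvgP/cauchy_exP => e e0.
  have : (2 * fine (G x)) * (2^-1) ^+ k @[k --> \oo] --> (0 : R).
    rewrite -[X in _ --> X](mulr0 (2 * fine (G x))); apply: cvgMl_tmp.
    by apply: cvg_expr; rewrite ger0_norm ?invr_ge0// invf_lt1 ?ltr1n.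
  have e2 : 0 < e ^+ 2 by rewrite exprn_gt0.
  move=> /cvgr0Pnorm_lt/(_ _ e2)/filter_ex[N HN].
  exists (q (h N x)); exists N => // k /= Nk.
  rewrite /ball /= (le_lt_trans (qL _ _))// !hE//.
  rewrite -(@ltr_pXn2r _ 2) ?nnegrE ?cabs_ge0 ?(ltW e0)// cabsB.
  rewrite -(subnKC Nk) (le_lt_trans (bndA N (k - N)%N x Ax))//.
  by rewrite (le_lt_trans _ HN)// exprVn ler_norm.
pose f x := limn (fun k => complex.Re (h k x)) +i* limn (fun k => complex.Im (h k x)).
have cRe x : cvgn (fun k => complex.Re (h k x)).
  by apply: hC => z w; rewrite -Re_opp -Re_add normr_Re.
have cIm x : cvgn (fun k => complex.Im (h k x)).
  by apply: hC => z w; rewrite -Im_opp -Im_add normr_Im.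
have mf : cmeas f.
  split.
  - apply: (measurable_fun_cvg (fun k => (mh k).1)) => x _; exact: cRe.
  - apply: (measurable_fun_cvg (fun k => (mh k).2)) => x _; exact: cIm.
have hf x : cabs (h k x - f x) @[k --> \oo] --> (0 : R).
  apply: (@squeeze_cvgr _ _ _ _ (fun=> 0) (fun k =>
     `|complex.Re (h k x) - complex.Re (f x)| + `|complex.Im (h k x) - complex.Im (f x)|)).
  + near=> k; rewrite cabs_ge0 andTb (le_trans (cabs_le_ReIm _))//.
    by rewrite Re_add Re_opp Im_add Im_opp.
  + exact: cvg_cst.
  + rewrite -[X in _ --> X]addr0; apply: cvgD.
    * rewrite -[X in _ --> X](normr0 R) -(subrr (complex.Re (f x))).
      by apply: cvg_norm; apply: cvgB; [exact: cRe|exact: cvg_cst].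
    * rewrite -[X in _ --> X](normr0 R) -(subrr (complex.Im (f x))).
      by apply: cvg_norm; apply: cvgB; [exact: cIm|exact: cvg_cst].
(* Outside [A] the right side is +oo, so the bound holds everywhere and can be integrated as it
   stands. *)
have fF k x : ((cabs (F k x - f x) ^+ 2)%:E <= (2 / 2 ^+ k)%:E * G x)%E.
  have [Ax|nAx] := pselect (A x); last first.
    have -> : G x = +oo%E by apply/eqP; rewrite -leye_eq leNgt; exact/negP.
    by rewrite gt0_muley ?leey// lte_fin divr_gt0// exprn_gt0.
  have Gf : G x = (fine (G x))%:E by rewrite fineK// ge0_fin_numE.
  rewrite Gf -EFinM lee_fin mulrAC.
  have cv : cabs (F (k + i)%N x - F k x) ^+ 2 @[i --> \oo] --> cabs (F k x - f x) ^+ 2.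
    apply: (@cvg_comp _ _ _ _ (fun y : R => y ^+ 2)); last exact: exprn_continuous.
    apply/cvgrPdist_le => e e0.
    have /cvgr0Pnorm_le/(_ _ e0) := hf x.
    move=> [N _ HN]; exists N => // i /= Ni.
    have := HN (k + i)%N; rewrite /= hE// => /(_ _) /=.
    rewrite ger0_norm ?cabs_ge0// => H.
    rewrite cabsB; apply: le_trans (ler_dist_cabs _ _) _.
    rewrite (_ : f x - F k x - _ = f x - F (k + i)%N x); last by ring.
    by rewrite cabsB H// (leq_trans Ni)// leq_addl.
  rewrite -(cvg_lim (@Rhausdorff R) cv); apply: limr_le.
    by apply/cvg_ex; eexists; exact: cv.
  by near=> i; exact: bndA.
have fN k : (N2 mu (fun x => (F k x - f x)%R) <= (4 / 2 ^+ k)%:E)%E.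
  apply: (@le_trans _ _ (\int[mu]_x ((2 / 2 ^+ k)%:E * G x))%E).
    apply: ge0_le_integral => //.
    - by move=> x _; rewrite lee_fin sqr_ge0.
    - apply/measurable_EFinP; apply: cmeas_cabs2; apply: cmeasB => //.
      by case: (F2 k).
    - exact: measurable_funeM.
  rewrite ge0_integralZl_EFin// ?divr_ge0 ?exprn_ge0//.
  rewrite (_ : 4 / 2 ^+ k = 2 / 2 ^+ k * 2 :> R); last by ring.
  by rewrite [leRHS]EFinM; apply: lee_wpmul2l => //; rewrite lee_fin divr_ge0 ?exprn_ge0.
exists f.
  split => //.
  rewrite (_ : f = (fun x => F 0%N x - (F 0%N x - f x))); last first.
    by apply/funext => x; ring.
  have FB : memL2 mu (fun x => F 0%N x - f x).
    split; first by apply: cmeasB => //; case: (F2 0%N).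
    by apply: le_lt_trans (fN 0%N) _; rewrite ltry.
  by have [] := memL2B (F2 0%N) FB.
apply: (@squeeze_cvge _ _ _ _ (fun=> 0%E) _ (fun k => (4 / 2 ^+ k)%:E)).
- by near=> k; rewrite N2_ge0 fN.
- exact: cvg_cst.
- apply: cvg_EFin; first exact: nearW.
  rewrite -[X in _ --> X](mulr0 (4 : R)); apply: cvgMl_tmp.
  rewrite (_ : (fun _ => _) = (fun k => (2^-1) ^+ k)); last first.
    by apply/funext => k; rewrite exprVn.
  by apply: cvg_expr; rewrite ger0_norm ?invr_ge0// invf_lt1 ?ltr1n.
Unshelve. all: by end_near. Qed.

End riesz_fischer.

Section fourier_L2.
Context {R : realType} (n : nat).
Local Notation E := 'rV[R]_n.
Local Notation mu := (@lebesgue_rV R n).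
Implicit Types (f g u v w psi chi : E -> R[i]) (x xi : E).

(** The multiplication formula: Fubini for cis(- x . xi) f(x) g(xi), which is symmetric in the
    phase. *)
Lemma fourier_mul f g : memL1 mu f -> memL1 mu g ->
  cint mu (fun xi => fourier f xi * g xi) = cint mu (fun x => f x * fourier g x).
Proof.
move=> f1 g1.
pose h (p : E * E) := cis (- dotr p.1 p.2) * (f p.1 * g p.2).
have mc : measurable_fun setT (fun p : E * E => - dotr p.1 p.2).
  apply: measurableT_comp => //; apply: measurable_dotr.
    exact: measurable_fst.
  exact: measurable_snd.
have h1 : memL1 (mu \x mu)%E h by apply: memL1_cisM => //; exact: memL1_prod.
have hx x : memL1 mu (fun xi => h (x, xi)).
  apply: (memL1_cisM (u := fun xi => - dotr x xi) (f := fun xi => f x * g xi)).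
    exact: (measurableT_comp mc (measurable_pair1 x)).
  exact: memL1Z.
have hxi xi : memL1 mu (fun x => h (x, xi)).
  apply: (memL1_cisM (u := fun x => - dotr x xi) (f := fun x => f x * g xi)).
    exact: measurable_dotrr.
  by under eq_fun do rewrite mulrC; exact: memL1Z.
have := cint12 h1 hx; rewrite (cint21 h1 hxi) => H.
rewrite [LHS](_ : _ = cint mu (fun y => cint mu (fun x => h (x, y)))); last first.
  apply: eq_cint => xi; rewrite fourierE mulrC -cintZ; last exact: fourier_memL1.
  by apply: eq_cint => x; rewrite /h /=; ring.
rewrite H; apply: eq_cint => x; rewrite fourierE -cintZ; last exact: fourier_memL1.
apply: eq_cint => xi; rewrite /h /= (_ : dotr x xi = dotr xi x); last first.
  by apply: eq_bigr => i _; rewrite mulrC.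
by ring.
Qed.

(** Up to its constant, the inverse transform is the transform conjugated on both sides. Plancherel
    and the multiplication formula carry over to it in this way. *)
Lemma fourier_invE f x : memL1 mu f ->
  fourier_inv f x = (((2 * pi) ^- n)%:C : R[i]) * (fourier (fun y => (f y)^*%C) x)^*%C.
Proof.
move=> f1; rewrite /fourier_inv; congr (_ * _).
rewrite fourierE -cint_conj; last by apply: fourier_memL1; exact: memL1_conj.
apply: eq_cint => xi; rewrite rmorphM /= conjcK.
rewrite -[X in _ = X * _]/((cis (- dotr xi x))^*%C) conj_cis opprK.
by congr (cis _ * _); apply: eq_bigr => i _; rewrite mulrC.
Qed.

Lemma memL2_fourier_inv f : memL12 mu f -> memL2 mu (fourier_inv f).
Proof.
move=> f12; rewrite (_ : fourier_inv f = fun x => (((2 * pi) ^- n)%:C : R[i]) *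
    (fourier (fun y => (f y)^*%C) x)^*%C).
  by apply: memL2Z; apply: memL2_conj; apply: memL2_fourier; exact: memL12_conj.
by apply/funext => x; exact: fourier_invE f12.1.
Qed.

Lemma N2_fourier_inv f : memL12 mu f ->
  N2 mu (fourier_inv f) = (((2 * pi) ^- n)%:E * N2 mu f)%E.
Proof.
move=> f12; have c12 := memL12_conj f12.
rewrite (_ : fourier_inv f = fun x => (((2 * pi) ^- n)%:C : R[i]) *
    (fourier (fun y => (f y)^*%C) x)^*%C); last first.
  by apply/funext => x; exact: fourier_invE f12.1.
rewrite N2Z; last by apply: cmeas_conj; apply: cmeas_fourier; exact: c12.1.1.
have J (h : E -> R[i]) : N2 mu (fun x => (h x)^*%C) = N2 mu h.
  by rewrite /N2; under eq_integral do rewrite cabs_conj.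
rewrite J plancherel// J muleA -EFinM; congr (_%:E * _)%E.
rewrite cabs_real ger0_norm ?invr_ge0 ?exprn_ge0 ?mulr_ge0 ?pi_ge0//.
by rewrite /cst_pi; field; rewrite expf_neq0// mulf_neq0// gt_eqF ?pi_gt0.
Qed.

Lemma fourier_inv_mul f g : memL1 mu f -> memL1 mu g ->
  cint mu (fun xi => fourier_inv f xi * g xi) =
  cint mu (fun x => f x * fourier_inv g x).
Proof.
move=> f1 g1; have fc := memL1_conj f1; have gc := memL1_conj g1.
pose c : R[i] := ((2 * pi) ^- n)%:C.
have mF h : memL1 mu h -> memL1 mu (fun x => (h x)^*%C) by exact: memL1_conj.
have I h k : memL1 mu h -> memL1 mu k ->
   cint mu (fun xi => c * (fourier (fun y => (h y)^*%C) xi)^*%C * k xi) =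
   c * (cint mu (fun xi => fourier (fun y => (h y)^*%C) xi * (k xi)^*%C))^*%C.
  move=> h1 k1.
  have hk : memL1 mu (fun xi => fourier (fun y => (h y)^*%C) xi * (k xi)^*%C).
    have hc := mF _ h1.
    have Hfin : (2%:E * \int[mu]_x (cabs ((h x)^*%C))%:E < +oo)%E.
      by rewrite lte_mul_pinfty//; case: hc.
    apply: (@memL1M _ _ _ _ _ _ (fine (2%:E * \int[mu]_x (cabs ((h x)^*%C))%:E)%E)).
    - by apply: cmeas_fourier; exact: hc.1.
    - exact: mF.
    - move=> xi; rewrite -lee_fin fineK; first exact: cabs_fourier.
      by rewrite ge0_fin_numE// mule_ge0// integral_ge0// => x _; rewrite lee_fin cabs_ge0.
  rewrite -cint_conj// -cintZ; last exact: mF.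
  by apply: eq_cint => xi; rewrite rmorphM /= conjcK mulrA.
rewrite (@eq_cint _ _ _ mu _
  (fun xi => c * (fourier (fun y => (f y)^*%C) xi)^*%C * g xi)); last first.
  by move=> xi; rewrite fourier_invE.
rewrite (@eq_cint _ _ _ mu (fun x => f x * _)
  (fun xi => c * (fourier (fun y => (g y)^*%C) xi)^*%C * f xi)); last first.
  by move=> xi; rewrite fourier_invE// mulrC.
rewrite !I// (fourier_mul fc gc); congr (_ * (_)^*%C).
by apply: eq_cint => x; rewrite mulrC.
Qed.

Lemma truncate_cvg u : memL2 mu u ->
  N2 mu (fun x => u x - (\1_(cube k) x)%:C * u x) @[k --> \oo] --> 0%E.
Proof.
move=> u2; have mu' := u2.1.
have mk k : cmeas (fun x => (\1_(cube k) x)%:C * u x).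
  by apply: cmeas_indic => //; exact: measurable_cube.
apply: (@N2_dominated0 _ _ _ mu _ u) => //.
- by move=> k; exact: cmeasB.
- move=> k x; rewrite indicE; case: (_ \in _); first by rewrite mul1r subrr cabs0 cabs_ge0.
  by rewrite mul0r subr0.
- move=> x; apply: cvg_near_cst; have [k0 Hk] := cube_bound x.
  near=> k; rewrite indicE mem_set ?mul1r ?subrr ?cabs0//; apply: Hk.
  by near: k; exact: nbhs_infty_ge.
Unshelve. all: by end_near. Qed.

Lemma memL12_truncate u k : memL2 mu u ->
  memL12 mu (fun x => (\1_(cube k) x)%:C * u x).
Proof.
move=> u2; have [mu' _] := u2.
have b12 : memL12 mu (fun x => (\1_(cube k) x)%:C : R[i]).
  by have := @memL12_indic_cube R n _ k measurableT; rewrite setTI.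
split; first exact: memL1_L2M b12.2 u2.
apply: (@memL2M _ _ _ _ _ _ 1) => //; first exact: b12.1.1.
by move=> x; rewrite cabs_real indicE; case: (_ \in _); rewrite ?normr1 ?normr0.
Qed.

Lemma memL12_dense u (e : R) : memL2 mu u -> 0 < e ->
  exists w, memL12 mu w /\ (N2 mu (fun x => (u x - w x)%R) < e%:E)%E.
Proof.
move=> u2 e0.
have : \forall k \near \oo,
    (N2 mu (fun x => (u x - (\1_(cube k) x)%:C * u x)%R) < e%:E)%E.
  have H := truncate_cvg u2.
  by apply: (H (fun y => (y < e%:E)%E)); apply: open_ereal_lt'; rewrite lte_fin.
move=> /filter_ex[k Hk]; exists (fun x => (\1_(cube k) x)%:C * u x); split => //.
exact: memL12_truncate.
Qed.

Lemma cabs_sub_cvg_eq (a b : nat -> R[i]) (z w : R[i]) : (forall k, a k = b k) ->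
  cabs (a k - z) @[k --> \oo] --> (0 : R) ->
  cabs (b k - w) @[k --> \oo] --> (0 : R) -> z = w.
Proof.
move=> ab az bw; apply/eqP; rewrite -subr_eq0; apply/eqP/cabs_eq0.
apply/eqP; rewrite eq_le cabs_ge0 andbT.
have H : cabs (a k - z) + cabs (b k - w) @[k --> \oo] --> (0 + 0 : R) by exact: cvgD.
rewrite addr0 in H; rewrite -(cvg_lim (@Rhausdorff R) H); apply: limr_ge.
  by apply/cvg_ex; eexists; exact: H.
near=> k; rewrite [cabs (a k - z)]cabsB (ab k).
by apply: le_trans (ler_cabsD _ _); rewrite addrA subrK.
Unshelve. all: by end_near. Qed.

(* The Fourier transform of u in L^2 is the L^2 limit of the transforms of
   truncations of u; the two identities pass to the limit from
   [fourier_mul] and [parseval]. *)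
Lemma fourier_L2_exists u : memL2 mu u -> exists v, [/\ memL2 mu v,
  (forall chi, memL12 mu chi ->
    cint mu (fun xi => v xi * chi xi) = cint mu (fun x => u x * fourier chi x)) &
  (forall psi, memL12 mu psi ->
    cint mu (fun xi => v xi * fourier_inv psi xi) = cint mu (fun x => u x * psi x))].
Proof.
move=> u2; have c0 := @cst_pi_gt0 R n; set c := cst_pi n in c0.
(* Consecutive approximations differ by at most 4 e k in [N2], and Plancherel multiplies this by c:
   the result is exactly the 4^-k of [riesz_fischer]. *)
pose e k : R := (4 ^+ k)^-1 / (4 * c).
have e0 k : 0 < e k by rewrite divr_gt0 ?invr_gt0 ?exprn_gt0// mulr_gt0.
have /choice[w wP] : forall k, exists w,
   memL12 mu w /\ (N2 mu (fun x => (u x - w x)%R) < (e k)%:E)%E.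
  by move=> k; exact: memL12_dense.
have w12 k : memL12 mu (w k) by case: (wP k).
have F2 k : memL2 mu (fourier (w k)) by exact: memL2_fourier.
have wd k : (N2 mu (fun x => (w k.+1 x - w k x)%R) <= (4 * e k)%:E)%E.
  have m j : cmeas (fun x => u x - w j x).
    by apply: cmeasB; [case: u2|exact: (w12 j).1.1].
  rewrite (_ : (fun x => w k.+1 x - w k x) =
      (fun x => (u x - w k x) + - (u x - w k.+1 x))); last first.
    by apply/funext => x; ring.
  apply: le_trans (N2D mu ltr01 (m k) (cmeasN (m k.+1))) _.
  rewrite invr1 (_ : 4 * e k = (1 + 1) * e k + (1 + 1) * e k); last by ring.
  rewrite [leRHS](_ : _ = ((1 + 1)%:E * (e k)%:E + (1 + 1)%:E * (e k)%:E)%E)//.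
  apply: leeD; apply: lee_wpmul2l.
  - by rewrite lee_fin addr_ge0.
  - by case: (wP k) => _ /ltW.
  - by rewrite lee_fin addr_ge0.
  - rewrite (_ : N2 mu _ = N2 mu (fun x => u x - w k.+1 x)); last first.
      by rewrite /N2; under eq_integral do rewrite cabsN.
    case: (wP k.+1) => _ /ltW /le_trans; apply; rewrite lee_fin /e.
    rewrite ler_pM2r ?invr_gt0 ?mulr_gt0// lef_pV2 ?posrE ?exprn_gt0//.
    by rewrite exprS ler_peMl ?exprn_ge0// ler1n.
have [|v v2 Fv] := riesz_fischer F2.
  move=> k; rewrite (_ : (fun x => _) = fourier (fun x => w k.+1 x - w k x)); last first.
    by apply/funext => xi; rewrite fourierB//; [exact: (w12 k.+1).1|exact: (w12 k).1].
  rewrite plancherel; last exact: memL12B.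
  apply: (@le_trans _ _ (c%:E * (4 * e k)%:E)%E).
    by apply: lee_wpmul2l; [rewrite lee_fin ltW|exact: wd].
  rewrite -EFinM lee_fin /e (_ : c * _ = (4 ^+ k)^-1)//.
  by field; rewrite expf_neq0//= gt_eqF.
have wu : N2 mu (fun x => w k x - u x) @[k --> \oo] --> 0%E.
  apply: (@squeeze_cvge _ _ _ _ (fun=> 0%E) _ (fun k => (e k)%:E)).
  - near=> k; rewrite N2_ge0/= N2B.
    by case: (wP k) => _ /ltW.
  - exact: cvg_cst.
  - apply: cvg_EFin; first exact: nearW.
    rewrite -[X in _ --> X](mul0r (4 * c)^-1); apply: cvgMr_tmp.
    rewrite (_ : (fun _ => _) = (fun k => (4^-1) ^+ k)); last first.
      by apply/funext => k; rewrite exprVn.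
    by apply: cvg_expr; rewrite ger0_norm ?invr_ge0// invf_lt1 ?ltr1n.
have W2 k : memL2 mu (w k) by exact: (w12 k).2.
exists v; split => //.
- move=> chi chi12.
  apply: (@cabs_sub_cvg_eq (fun k => cint mu (fun xi => fourier (w k) xi * chi xi))
     (fun k => cint mu (fun x => w k x * fourier chi x))).
  + by move=> k; apply: fourier_mul; [exact: (w12 k).1|exact: chi12.1].
  + exact: cint_L2_cvg F2 v2 chi12.2 Fv.
  + exact: cint_L2_cvg W2 u2 (memL2_fourier chi12) wu.
- move=> psi psi12.
  apply: (@cabs_sub_cvg_eq (fun k => cint mu (fun xi => fourier (w k) xi * fourier_inv psi xi))
     (fun k => cint mu (fun x => w k x * psi x))).
  (* Parseval against the conjugate of psi, whose transform is, after conjugation, [fourier_inv psi]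
     times c. *)
  + move=> k; have pc := memL12_conj psi12.
    have := parseval (w12 k) pc => P.
    rewrite (@eq_cint _ _ _ mu _
  (fun xi => (c^-1)%:C *
       (fourier (w k) xi * (fourier (fun y => (psi y)^*%C) xi)^*%C))); last first.
      by move=> xi; rewrite fourier_invE; [rewrite mulrCA|exact: psi12.1].
    rewrite cintZ; last first.
      apply: memL1_L2M; first exact: F2.
      by apply: memL2_conj; exact: memL2_fourier.
    rewrite P mulrA -rmorphM /= mulVf ?gt_eqF// mul1r.
    by apply: eq_cint => x; rewrite conjcK.
  + exact: cint_L2_cvg F2 v2 (memL2_fourier_inv psi12) Fv.
  + exact: cint_L2_cvg W2 u2 psi12.2 wu.
Unshelve. all: by end_near. Qed.

End fourier_L2.

(** * Schwartz functions as test functions *)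

Section schwartz_functions.
Context {R : realType} (n : nat).
Local Notation E := 'rV[R]_n.
Local Notation mu := (@lebesgue_rV R n).
Local Notation leb := (@lebesgue_measure R).
Implicit Types (x xi : E).

(** The topology comes from the sup norm, so each point of U lies in a box with rational centre and
    side 2 / (k + 1) contained in U; there are countably many such boxes. *)
Lemma measurable_open_rV (U : set E) : open U -> measurable U.
Proof.
move=> oU.
pose B (p : 'rV[rat]_n * nat) : set E :=
  box (fun i => ratr (p.1 ord0 i) - p.2.+1%:R^-1) (fun i => ratr (p.1 ord0 i) + p.2.+1%:R^-1).
pose F p := if pselect (B p `<=` U) then B p else set0.
have -> : U = \bigcup_p F p.
  apply/seteqP; split => x; last first.
    by move=> [p _]; rewrite /F; case: pselect => // BU /BU.
  move=> Ux; have /nbhs_ballP[e /= e0 xe] := open_nbhs_nbhs (conj oU Ux).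
  have e3 : 0 < e / 3 by rewrite divr_gt0.
  pose k := Num.bound (e / 3)^-1.
  have ke : (k.+1%:R : R)^-1 < e / 3.
    rewrite -[ltRHS]invrK ltf_pV2 ?posrE ?invr_gt0 ?ltr0n//.
    have := archi_boundP (ltW (_ : 0 < (e / 3)^-1)); rewrite invr_gt0 => /(_ e3) h.
    by rewrite (lt_le_trans h)// ler_nat.
  have k0 : 0 < (k.+1%:R : R)^-1 by rewrite invr_gt0 ltr0n.
  have /choice[q qP] : forall i : 'I_n, exists q : rat,
      x ord0 i - k.+1%:R^-1 < ratr q < x ord0 i + k.+1%:R^-1.
    move=> i; have xx : x ord0 i - k.+1%:R^-1 < x ord0 i + k.+1%:R^-1.
      by rewrite ltrD2l (lt_trans _ k0)// oppr_lt0.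
    by have [q] := rat_in_itvoo xx; rewrite in_itv/= => qP; exists q.
  have BU : B (\row_i q i, k) `<=` U.
    move=> y By; apply: xe; split => // i j; rewrite (ord1 i).
    have := By j; rewrite /ocset /= in_itv/= mxE => /andP[y1 y2].
    have /andP[q1 q2] := qP j.
    rewrite /ball /= ltr_norml.
    move: k0 ke q1 q2 y1 y2; move: (k.+1%:R^-1) => del k0 ke q1 q2 y1 y2.
    by apply/andP; split; lra.
  exists (\row_i q i, k) => //; rewrite /F; case: pselect => // H i.
  rewrite /ocset /= in_itv/= mxE; have /andP[q1 q2] := qP i.
  move: k0 ke q1 q2; move: (k.+1%:R^-1) => del k0 ke q1 q2.
  by apply/andP; split; lra.
apply: countable_bigcupT_measurable => [|p]; first exact: countableP.
rewrite /F; case: pselect => H /=; [exact: measurable_box|exact: measurable0].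
Qed.

Lemma continuous_measurable_rV (f : E -> R) : continuous f -> measurable_fun setT f.
Proof.
move=> cf; apply: (measurability _ (RGenOpens.measurableE R)) => /=.
move=> _ [_ [a [b ->]] <-]; rewrite setTI; apply: measurable_open_rV.
by apply: open_comp => //; exact: interval_open.
Qed.

(** An integrable majorant in product form: its integral is a product of arctangent integrals, and
    it dominates (1 + |x|)^(-2n), hence every Schwartz function up to a Schwartz norm of order
    2n. *)
Definition weight x : R := \prod_(i < n) (1 + x ord0 i ^+ 2)^-1.

Lemma integral_oneDsqrV : (\int[leb]_t ((1 + t ^+ 2)^-1 : R)%:E = pi%:E)%E.
Proof.
have cf : continuous (fun t : R => (1 + t ^+ 2)^-1) by exact: continuous_oneDsqrV.
rewrite (@ge0_symfun_integralT R (fun t => (1 + t ^+ 2)^-1))//.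
- rewrite (_ : [set t | 0 <= t] = `[0%R, +oo[%classic); last exact/esym/set_itvcy.
  have -> := @integral0y_oneDsqr R.
  by rewrite -EFinM; congr EFin; field.
- by move=> t; rewrite invr_ge0 addr_ge0// sqr_ge0.
- by move=> t /=; rewrite sqrrN.
Qed.

Lemma weight_ge0 x : 0 <= weight x.
Proof. by apply: prodr_ge0 => i _; rewrite invr_ge0 addr_ge0// sqr_ge0. Qed.

Lemma weight_le1 x : weight x <= 1.
Proof.
apply: prodr_ile1 => i _; rewrite invr_ge0 addr_ge0 ?sqr_ge0//=.
by rewrite invf_le1 ?lerDl ?sqr_ge0// ltr_wpDr ?sqr_ge0.
Qed.

Lemma memL12_weight : memL12 mu (fun x => (weight x)%:C : R[i]).
Proof.
pose h (i : 'I_n) (t : R) : R[i] := ((1 + t ^+ 2)^-1)%:C.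
have h1 i : memL1 leb (h i).
  split.
    apply: cmeas_real; apply: continuous_measurable_fun; exact: continuous_oneDsqrV.
  under eq_integral do rewrite cabs_real ger0_norm ?invr_ge0 ?addr_ge0 ?sqr_ge0//.
  by rewrite integral_oneDsqrV ltry.
have [w1 _] := cint_rV_prod h1.
have {}w1 : memL1 mu (fun x => (weight x)%:C : R[i]).
  rewrite (_ : (fun _ => _) = (fun x : E => \prod_(i < n) h i (x ord0 i)))//.
  by apply/funext => x; rewrite /weight rmorph_prod.
split => //; split; first exact: w1.1.
apply: le_lt_trans w1.2; apply: ge0_le_integral => //.
- by move=> x _; rewrite lee_fin sqr_ge0.
- by apply/measurable_EFinP; apply: cmeas_cabs2; exact: w1.1.
- by apply/measurable_EFinP; apply: cmeas_cabs; exact: w1.1.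
- move=> x _; rewrite lee_fin cabs_real ger0_norm ?weight_ge0// expr2.
  by rewrite ler_piMr ?weight_ge0 ?weight_le1.
Qed.

Lemma dotr_ge0 x : 0 <= dotr x x.
Proof. by apply: sumr_ge0 => i _; rewrite -expr2 sqr_ge0. Qed.

Lemma enorm_ge0 x : 0 <= enorm x. Proof. exact: sqrtr_ge0. Qed.

Lemma enorm_sqr x : enorm x ^+ 2 = dotr x x.
Proof. by rewrite sqr_sqrtr// dotr_ge0. Qed.

Lemma coord_le_enorm x i : `|x ord0 i| <= enorm x.
Proof.
rewrite -(@ler_pXn2r _ 2) ?nnegrE ?enorm_ge0// enorm_sqr real_normK ?num_real//.
rewrite /dotr (bigD1 i)//= -expr2 lerDl; apply: sumr_ge0 => j _.
by rewrite -expr2 sqr_ge0.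
Qed.

Lemma enorm_weight x : ((1 + enorm x) ^+ (2 * n))^-1 <= weight x.
Proof.
have e1 : 0 < 1 + enorm x by rewrite ltr_wpDr ?enorm_ge0.
rewrite /weight exprM -exprVn -[X in _ ^+ X](card_ord n) -prodr_const.
apply: ler_prod => i _; apply/andP; split.
  by rewrite invr_ge0 exprn_ge0// ltW.
rewrite lef_pV2 ?posrE ?exprn_gt0//; last by rewrite ltr_wpDr ?sqr_ge0.
have := coord_le_enorm x i; have := enorm_ge0 x.
rewrite -(real_normK (num_real (x ord0 i))).
move: (enorm x) `|x ord0 i| (normr_ge0 (x ord0 i)) => a b b0 a0 ba.
rewrite sqrrD expr1n; nra.
Qed.

Lemma cabs_schwartz (psi : E -> R[i]) (N : nat) x : schwartz psi ->
  cabs (psi x) <= fine (schwartz_norm N psi) / (1 + enorm x) ^+ N.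
Proof.
move=> [_ /(_ N) Noo].
have e1 : 0 < (1 + enorm x) ^+ N by rewrite exprn_gt0// ltr_wpDr ?enorm_ge0.
have H : (((1 + enorm x) ^+ N * cabs (psi x))%:E <= schwartz_norm N psi)%E.
  apply: ereal_sup_ubound; exists [::], x; split => //.
  by rewrite /cpartial /= /ReF /ImF; case: (psi x).
have N0 : (0 <= schwartz_norm N psi)%E.
  by apply: le_trans H; rewrite lee_fin mulr_ge0 ?cabs_ge0// ltW.
rewrite ler_pdivlMr// mulrC -lee_fin fineK// ge0_fin_numE//.
Qed.

Lemma schwartz_norm_ge0 (psi : E -> R[i]) (N : nat) : (0 <= schwartz_norm N psi)%E.
Proof.
apply: (@le_trans _ _ (((1 + enorm (0 : E)) ^+ N * cabs (cpartial [::] psi 0))%:E)).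
  by rewrite lee_fin mulr_ge0 ?cabs_ge0// exprn_ge0// addr_ge0// enorm_ge0.
by apply: ereal_sup_ubound; exists [::], 0.
Qed.

Lemma cabs_schwartz_weight (psi : E -> R[i]) x : schwartz psi ->
  cabs (psi x) <= fine (schwartz_norm (2 * n) psi) * weight x.
Proof.
move=> spsi; apply: le_trans (cabs_schwartz (2 * n) x spsi) _.
by apply: ler_wpM2l; [rewrite fine_ge0// schwartz_norm_ge0|exact: enorm_weight].
Qed.

Lemma cmeas_smooth (psi : E -> R[i]) : smooth psi -> cmeas psi.
Proof.
move=> sm; split; apply: continuous_measurable_rV => x;
  apply: differentiable_continuous; by have [] := sm [::] x.
Qed.

Lemma memL12_schwartz (psi : E -> R[i]) : schwartz psi -> memL12 mu psi.
Proof.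
move=> spsi; have mpsi := cmeas_smooth spsi.1.
pose S := fine (schwartz_norm (2 * n) psi).
have w12 := memL12Z (S%:C) memL12_weight.
have S0 : 0 <= S by rewrite fine_ge0// schwartz_norm_ge0.
have le x : cabs (psi x) <= cabs (S%:C * (weight x)%:C).
  rewrite cabsM !cabs_real (ger0_norm S0) (ger0_norm (weight_ge0 x)).
  exact: cabs_schwartz_weight.
split; first exact: memL1_le mpsi (memL1_cabs w12.1) le.
split => //; apply: le_lt_trans w12.2.2.
by apply: le_N2 => //; exact: w12.1.1.
Qed.

End schwartz_functions.

(** * Gaussian wave packets *)

Section gaussian_wave_packets.
Context {R : realType} (n : nat).
Local Notation E := 'rV[R]_n.
Local Notation mu := (@lebesgue_rV R n).
Implicit Types (x xi : E) (f g h : E -> R).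

(* An algebra of functions of polynomial growth which is stable under partial
   derivatives. *)
Inductive tame : (E -> R) -> Prop :=
| tame_cst (c : R) : tame (fun=> c)
| tame_coord i : tame (fun x => x ord0 i)
| tame_add f g : tame f -> tame g -> tame (fun x => f x + g x)
| tame_mul f g : tame f -> tame g -> tame (fun x => f x * g x)
| tame_cos f : tame f -> tame (fun x => cos (f x))
| tame_sin f : tame f -> tame (fun x => sin (f x)).

Lemma differentiable_comp1 f (q : R -> R) x : differentiable f x ->
  derivable q (f x) 1 -> differentiable (fun y => q (f y)) x.
Proof.
by move=> df dq; apply: (@differentiable_comp _ _ _ _ f q) => //; exact/derivable1_diffP.
Qed.

Lemma derive_comp1 f (q : R -> R) x v : differentiable f x ->
  derivable q (f x) 1 -> 'D_v (fun y => q (f y)) x = derive1 q (f x) * 'D_v f x.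
Proof.
move=> df dq; have dq' : differentiable q (f x) by exact/derivable1_diffP.
rewrite deriveE; last exact: differentiable_comp1.
rewrite (_ : (fun y => q (f y)) = q \o f)// diff_comp//= diff1E// [RHS]mulrC.
by rewrite deriveE.
Qed.

Lemma derive_coord x i j : 'D_(delta_mx ord0 i) (fun y : E => y ord0 j) x = (i == j)%:R.
Proof.
rewrite /derive; apply: lim_near_cst => //; near=> t.
have t0 : t != 0 by near: t; exact: nbhs_dnbhs_neq.
rewrite /shift /= !mxE eqxx /= addrK /GRing.scale /= mulrA mulVf// mul1r.
by rewrite eq_sym.
Unshelve. all: by end_near. Qed.

Lemma tame_differentiable f x : tame f -> differentiable f x.
Proof.
elim=> [c|i|u v _ du _ dv|u v _ du _ dv|u _ du|u _ du].
- exact: differentiable_cst.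
- exact: differentiable_coord.
- exact: differentiableD du dv.
- exact: differentiableM du dv.
- by apply: differentiable_comp1 => //; exact: ex_derive.
- by apply: differentiable_comp1 => //; exact: ex_derive.
Qed.

Lemma tame_derive f i : tame f ->
  exists2 g, tame g & forall x, 'D_(delta_mx ord0 i) f x = g x.
Proof.
have D u x : tame u -> derivable u x (delta_mx ord0 i).
  by move=> tu; apply: diff_derivable; exact: tame_differentiable.
elim=> [c|j|u v tu [u' tu' uE] tv [v' tv' vE]|u v tu [u' tu' uE] tv [v' tv' vE]
       |u tu [u' tu' uE]|u tu [u' tu' uE]].
- exists (fun=> 0); first exact: tame_cst.
  by move=> x; rewrite derive_cst.
- exists (fun=> (i == j)%:R); first exact: tame_cst.
  by move=> x; rewrite derive_coord.
- exists (fun x => u' x + v' x); first exact: tame_add.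
  by move=> x; rewrite -uE -vE -deriveD//; exact: D.
- exists (fun x => u x * v' x + v x * u' x).
    by apply: tame_add; exact: tame_mul.
  by move=> x; rewrite -uE -vE -[RHS]deriveM//; exact: D.
- exists (fun x => -1 * (sin (u x) * u' x)).
    apply: tame_mul; [exact: tame_cst|apply: tame_mul => //; exact: tame_sin].
  move=> x; rewrite -uE derive_comp1; [|exact: tame_differentiable|exact: ex_derive].
  by rewrite derive1E derive_val; ring.
- exists (fun x => cos (u x) * u' x).
    by apply: tame_mul => //; exact: tame_cos.
  move=> x; rewrite -uE derive_comp1; [|exact: tame_differentiable|exact: ex_derive].
  by rewrite derive1E derive_val.
Qed.

Lemma tame_growth f : tame f ->
  exists C N, 0 <= C /\ forall x, `|f x| <= C * (1 + enorm x) ^+ N.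
Proof.
have e1 x : 1 <= 1 + enorm x by rewrite lerDl enorm_ge0.
have e0 x : 0 <= 1 + enorm x by rewrite addr_ge0// enorm_ge0.
elim=> [c|j|u v _ [C [N [C0 uC]]] _ [D [M [D0 vD]]]
       |u v _ [C [N [C0 uC]]] _ [D [M [D0 vD]]]|u _ _|u _ _].
- by exists `|c|, 0%N; split => // x; rewrite expr0 mulr1.
- exists 1, 1%N; split => // x; rewrite mul1r expr1.
  by rewrite (le_trans (coord_le_enorm x j))// lerDr.
- exists (C + D), (N + M)%N; split; first exact: addr_ge0.
  move=> x; apply: le_trans (ler_normD _ _) _; rewrite mulrDl; apply: lerD.
    apply: le_trans (uC x) _; apply: ler_wpM2l => //.
    by apply: ler_weXn2l => //; exact: leq_addr.
  apply: le_trans (vD x) _; apply: ler_wpM2l => //.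
  by apply: ler_weXn2l => //; exact: leq_addl.
- exists (C * D), (N + M)%N; split; first exact: mulr_ge0.
  by move=> x; rewrite normrM exprD mulrACA ler_pM.
- by exists 1, 0%N; split => // x; rewrite expr0 mulr1 ler_norml cos_geN1 cos_le1.
- by exists 1, 0%N; split => // x; rewrite expr0 mulr1 ler_norml sin_geN1 sin_le1.
Qed.

Lemma tame_sum (I : Type) (s : seq I) (F : I -> E -> R) : (forall i, tame (F i)) ->
  tame (fun x => \sum_(i <- s) F i x).
Proof.
move=> tF; elim: s => [|i s IH].
  by under eq_fun do rewrite big_nil; exact: tame_cst.
by under eq_fun do rewrite big_cons; exact: tame_add.
Qed.

Definition gauss x : R := expR (- dotr x x).

Lemma tame_dotrr : tame (fun x => - dotr x x).
Proof.
rewrite (_ : (fun _ => _) = (fun x => -1 * \sum_(i < n) x ord0 i * x ord0 i)).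
  apply: tame_mul; first exact: tame_cst.
  by apply: tame_sum => i; apply: tame_mul; exact: tame_coord.
by apply/funext => x; rewrite mulN1r.
Qed.

Lemma tame_dotr xi : tame (fun x => - dotr x xi).
Proof.
rewrite (_ : (fun _ => _) = (fun x => -1 * \sum_(i < n) x ord0 i * xi ord0 i)).
  apply: tame_mul; first exact: tame_cst.
  by apply: tame_sum => i; apply: tame_mul; [exact: tame_coord|exact: tame_cst].
by apply/funext => x; rewrite mulN1r.
Qed.

Lemma gauss_differentiable x : differentiable gauss x.
Proof.
apply: (@differentiable_comp1 (fun x => - dotr x x) expR).
  by apply: tame_differentiable; exact: tame_dotrr.
exact: ex_derive.
Qed.

Lemma gauss_tame_differentiable f x : tame f ->
  differentiable (fun y => gauss y * f y) x.
Proof.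
move=> tf.
exact: differentiableM (gauss_differentiable x) (tame_differentiable x tf).
Qed.

Lemma gauss_tame_derive f i : tame f ->
  exists2 g, tame g & 'D_(delta_mx ord0 i) (fun y => gauss y * f y) =
                      (fun x => gauss x * g x).
Proof.
move=> tf; have [f' tf' fE] := tame_derive i tf.
have [q tq qE] := tame_derive i tame_dotrr.
exists (fun x => f' x + f x * q x); first by apply: tame_add => //; exact: tame_mul.
apply/funext => x.
have dg : derivable gauss x (delta_mx ord0 i).
  by apply: diff_derivable; exact: gauss_differentiable.
have df : derivable f x (delta_mx ord0 i).
  by apply: diff_derivable; exact: tame_differentiable.
transitivity ('D_(delta_mx ord0 i) (gauss * f) x); first by [].
rewrite deriveM// fE /gauss.
rewrite (@derive_comp1 (fun x => - dotr x x) expR); last 2 first.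
- by apply: tame_differentiable; exact: tame_dotrr.
- exact: ex_derive.
by rewrite qE derive1E derive_val /GRing.scale /=; ring.
Qed.

(** [partial] is a right fold, so the last index of the list is differentiated first; inductions on
    multi-indices therefore peel off the right end. *)
Lemma partial_rcons alpha i h :
  partial (rcons alpha i) h = partial alpha ('D_(delta_mx ord0 i) h).
Proof. by rewrite /partial foldr_rcons. Qed.

Lemma partial_gauss_tame alpha f : tame f ->
  exists2 g, tame g & partial alpha (fun y => gauss y * f y) = (fun x => gauss x * g x).
Proof.
elim/last_ind: alpha f => [|alpha i IH] f tf; first by exists f.
have [g tg E] := gauss_tame_derive i tf.
by rewrite partial_rcons E; exact: IH.
Qed.

(** With M = K + N and b = |x|, one has (1 + b)^M <= e^(M b) and M b <= M^2 + b^2; this is the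
    origin of the constant e^(M^2). *)
Lemma gauss_tame_bound f (K : nat) : tame f ->
  exists2 C, 0 <= C & forall x, (1 + enorm x) ^+ K * `|gauss x * f x| <= C.
Proof.
move=> /tame_growth[C [N [C0 fC]]].
pose M := (K + N)%N; exists (C * expR (M%:R ^+ 2)).
  by rewrite mulr_ge0// expR_ge0.
move=> x; have e0 := enorm_ge0 x.
have e1 : 0 <= 1 + enorm x by rewrite addr_ge0.
rewrite normrM ger0_norm ?expR_ge0// mulrCA.
apply: (@le_trans _ _ (gauss x * ((1 + enorm x) ^+ K * (C * (1 + enorm x) ^+ N)))).
  rewrite ler_wpM2l ?expR_ge0// ler_wpM2l// exprn_ge0//.
rewrite (mulrCA _ C) -exprD -/M mulrCA ler_wpM2l//.
apply: (@le_trans _ _ (gauss x * expR (enorm x) ^+ M)).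
  rewrite ler_wpM2l ?expR_ge0//.
  by apply: lerXn2r; rewrite ?nnegrE ?expR_ge0 ?expR_ge1Dx.
rewrite -expRM_natl /gauss -expRD ler_expR -enorm_sqr.
move: (M%:R) (enorm x) => a b; rewrite -subr_ge0.
have -> : a ^+ 2 - (- b ^+ 2 + a * b) = (a - b / 2) ^+ 2 + 3 / 4 * b ^+ 2 by field.
by rewrite addr_ge0 ?sqr_ge0// mulr_ge0// sqr_ge0.
Qed.

(** One constant serves all multi-indices of bounded length: there are finitely many choices of the
    last index, and their constants are added up. *)
Lemma partial_gauss_tame_bound f (K N : nat) : tame f ->
  exists2 C, 0 <= C & forall alpha x, (size alpha <= N)%N ->
    (1 + enorm x) ^+ K * `|partial alpha (fun y => gauss y * f y) x| <= C.
Proof.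
elim: N f => [|N IH] f tf.
  have [C C0 CP] := gauss_tame_bound K tf.
  by exists C => // -[|//] x _; exact: CP.
have [C C0 CP] := gauss_tame_bound K tf.
have /choice[D DP] : forall i : 'I_n, exists D, 0 <= D /\
    forall alpha x, (size alpha <= N)%N -> (1 + enorm x) ^+ K *
      `|partial (rcons alpha i) (fun y => gauss y * f y) x| <= D.
  move=> i; have [g tg E] := gauss_tame_derive i tf.
  have [D D0 DP] := IH g tg; exists D; split => // alpha x sz.
  by rewrite partial_rcons E; exact: DP.
exists (C + \sum_(i < n) D i).
  by rewrite addr_ge0// sumr_ge0// => i _; case: (DP i).
move=> alpha x; case: (lastP alpha) => [|beta i] sz.
  apply: le_trans (CP x) _; rewrite lerDl sumr_ge0// => i _; by case: (DP i).
have [Di0 Di] := DP i.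
apply: le_trans (Di beta x _) _; first by rewrite size_rcons in sz.
rewrite (bigD1 i)//= addrCA lerDl addr_ge0// sumr_ge0// => j _.
by case: (DP j).
Qed.

(** Written through its two components so that each is by conversion the Gaussian times a tame
    function. *)
Definition wave_packet xi x : R[i] :=
  (gauss x * cos (- dotr x xi)) +i* (gauss x * sin (- dotr x xi)).

Lemma wave_packetE xi x : wave_packet xi x = (gauss x)%:C * cis (- dotr x xi).
Proof.
by apply: complex_ext; rewrite ?Re_mul ?Im_mul /= ?mul0r ?subr0 ?addr0.
Qed.

Lemma schwartz_wave_packet xi : schwartz (wave_packet xi).
Proof.
have tc := tame_cos (tame_dotr xi); have ts := tame_sin (tame_dotr xi).
split.
  move=> alpha x; split.
    have [g tg] := partial_gauss_tame alpha tc; rewrite /wave_packet /ReF /= => ->.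
    exact: gauss_tame_differentiable.
  have [g tg] := partial_gauss_tame alpha ts; rewrite /wave_packet /ImF /= => ->.
  exact: gauss_tame_differentiable.
move=> N.
have [C C0 CP] := partial_gauss_tame_bound N N tc.
have [D D0 DP] := partial_gauss_tame_bound N N ts.
apply: (@le_lt_trans _ _ (C + D)%:E); last exact: ltry.
apply: ub_ereal_sup => _ [alpha [x [sz ->]]]; rewrite lee_fin.
apply: (@le_trans _ _ ((1 + enorm x) ^+ N * (`|complex.Re (cpartial alpha (wave_packet xi) x)|
    + `|complex.Im (cpartial alpha (wave_packet xi) x)|))).
  by rewrite ler_wpM2l ?cabs_le_ReIm// exprn_ge0// addr_ge0// enorm_ge0.
by rewrite mulrDr; apply: lerD; [exact: CP|exact: DP].
Qed.

Lemma gauss_le1 x : gauss x <= 1.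
Proof. by rewrite /gauss -expR0 ler_expR oppr_le0 dotr_ge0. Qed.

Lemma memL12_gauss : memL12 mu (fun x => (gauss x)%:C : R[i]).
Proof.
have H := memL12_schwartz (schwartz_wave_packet (0 : E)).
rewrite (_ : (fun _ => _) = wave_packet 0)//; apply/funext => x.
rewrite wave_packetE (_ : dotr x 0 = 0) ?oppr0 ?cis0 ?mulr1//.
by rewrite /dotr big1// => i _; rewrite mxE mulr0.
Qed.

(* Testing w against the wave packets computes the Fourier transform of
   w * gauss. *)
Lemma schwartz_separates (w : E -> R[i]) : memL2 mu w ->
  (forall psi, schwartz psi -> cint mu (fun x => w x * psi x) = 0) ->
  N2 mu w = 0%E.
Proof.
move=> w2 w0; have [mw _] := w2; have G12 := memL12_gauss.
pose v x := w x * (gauss x)%:C.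
have v12 : memL12 mu v.
  split; first exact: memL1_L2M w2 G12.2.
  rewrite /v; under eq_fun do rewrite mulrC.
  apply: (@memL2M _ _ _ _ _ _ 1) => //; first exact: G12.1.1.
  by move=> x; rewrite cabs_real ger0_norm ?expR_ge0 ?gauss_le1.
have Fv xi : fourier v xi = 0.
  rewrite fourierE -(w0 _ (schwartz_wave_packet xi)); apply: eq_cint => x.
  by rewrite wave_packetE /v; ring.
have := plancherel v12; rewrite [LHS](_ : _ = 0%E); last first.
  by apply: integral0_eq => xi _; rewrite Fv cabs0 expr0n.
(* By Plancherel [v] vanishes almost everywhere; the Gaussian factor never does, so w vanishes where
   [v] does. *)
move=> /esym/eqP; rewrite mule_eq0 eqe gt_eqF ?cst_pi_gt0//= => /eqP Nv.
have mv := v12.1.1.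
have ae0 : ae_eq mu setT (fun x => ((cabs (v x)) ^+ 2)%:E) (cst 0%E).
  apply/ae_eq_integral_abs => //.
    by apply/measurable_EFinP; exact: cmeas_cabs2.
  by rewrite -[RHS]Nv; apply: eq_integral => x _; rewrite gee0_abs// lee_fin sqr_ge0.
rewrite -(integral0 mu setT); apply: ae_eq_integral => //.
  by apply/measurable_EFinP; exact: cmeas_cabs2.
apply: filterS ae0 => x /= H Tx; have := H Tx.
move=> [] /eqP; rewrite sqrf_eq0 => /eqP/cabs_eq0/eqP; rewrite mulf_eq0 => /orP[/eqP ->|].
  by rewrite cabs0 expr0n.
by move=> /eqP[] /eqP; rewrite gt_eqF ?expR_gt0.
Qed.

End gaussian_wave_packets.

(** * Littlewood-Paley blocks *)

Section littlewood_paley_blocks.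
Context {R : realType} (n : nat).
Local Notation E := 'rV[R]_n.
Local Notation mu := (@lebesgue_rV R n).
Implicit Types (u v w f g psi : E -> R[i]) (x xi : E).

Lemma L2normE f : cmeas f -> L2norm f = poweR (N2 mu f) 2^-1.
Proof.
move=> mf; rewrite /L2norm unlock; congr poweR; apply: eq_integral => x _.
by rewrite poweR_EFin /= powR_mulrn ?normr_ge0// ger0_norm// cabs_ge0.
Qed.

Lemma L2normE_fine f : memL2 mu f -> L2norm f = (Num.sqrt (fine (N2 mu f)))%:E.
Proof.
move=> [mf f2]; rewrite L2normE//.
have fE : N2 mu f = (fine (N2 mu f))%:E by rewrite fineK// ge0_fin_numE// N2_ge0.
by rewrite fE poweR_EFin powR12_sqrt// fine_ge0// N2_ge0.
Qed.

Lemma L2_memL2 f : L2 f <-> memL2 mu f.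
Proof.
split => [[mR mI fo]|f2].
  have mf : cmeas f by [].
  split => //; rewrite ltNge; apply/negP; rewrite leye_eq => /eqP N.
  by move: fo; rewrite L2normE// N poweRyr ?ltxx// invr_neq0.
by have [[mR mI] _] := f2; split => //; rewrite L2normE_fine// ltry.
Qed.

Lemma N2_eq0 w : cmeas w -> N2 mu w = 0%E -> ae_eq mu setT w (cst 0).
Proof.
move=> mw Nw.
have ae0 : ae_eq mu setT (fun x => ((cabs (w x)) ^+ 2)%:E) (cst 0%E).
  apply/ae_eq_integral_abs => //.
    by apply/measurable_EFinP; exact: cmeas_cabs2.
  by rewrite -[RHS]Nw; apply: eq_integral => x _; rewrite gee0_abs// lee_fin sqr_ge0.
apply: filterS ae0 => x /= H Tx; have := H Tx.
by move=> [] /eqP; rewrite sqrf_eq0 => /eqP/cabs_eq0.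
Qed.

Lemma schwartz_uniq v w : memL2 mu v -> memL2 mu w ->
  (forall psi, schwartz psi ->
    cint mu (fun x => v x * psi x) = cint mu (fun x => w x * psi x)) ->
  ae_eq mu setT v w.
Proof.
move=> v2 w2 vw; have d2 : memL2 mu (fun x => v x - w x) by exact: memL2B.
have := @N2_eq0 (fun x => v x - w x) d2.1; rewrite schwartz_separates//.
  move=> /(_ erefl); apply: filterS => x H Tx; apply/eqP; rewrite -subr_eq0.
  by apply/eqP; exact: H.
move=> psi sp; have [_ p2] := memL12_schwartz sp.
rewrite (_ : (fun _ => _) = (fun x => v x * psi x - w x * psi x)).
  by rewrite cintB ?vw ?subrr//; exact: memL1_L2M.
by apply/funext => x; rewrite mulrBl.
Qed.

Lemma ae_eq_N2 v w : cmeas v -> cmeas w -> ae_eq mu setT v w -> N2 mu v = N2 mu w.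
Proof.
move=> mv mw vw; apply: ae_eq_integral => //.
- by apply/measurable_EFinP; exact: cmeas_cabs2.
- by apply/measurable_EFinP; exact: cmeas_cabs2.
- by apply: filterS vw => x /= H Tx; rewrite H.
Qed.

Lemma ae_eq_cint v w chi : cmeas v -> cmeas w -> cmeas chi -> ae_eq mu setT v w ->
  cint mu (fun x => v x * chi x) = cint mu (fun x => w x * chi x).
Proof.
move=> mv mw mc vw.
have [mR mI] := cmeasM mv mc; have [mR' mI'] := cmeasM mw mc.
apply: complex_ext => /=; congr fine; apply: ae_eq_integral => //.
- exact/measurable_EFinP.
- exact/measurable_EFinP.
- by apply: filterS vw => x /= H Tx; rewrite H.
- exact/measurable_EFinP.
- exact/measurable_EFinP.
- by apply: filterS vw => x /= H Tx; rewrite H.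
Qed.

(** The infimum is over a single value, because [schwartz_uniq] makes any two representatives equal
    almost everywhere. *)
Lemma dist_L2norm_represents g (T : dist n) : memL2 mu g -> represents g T ->
  dist_L2norm T = (Num.sqrt (fine (N2 mu g)))%:E.
Proof.
move=> g2 gT; rewrite -L2normE_fine//.
rewrite /dist_L2norm (_ : [set L2norm h | h in _] = [set L2norm g]) ?ereal_inf1//.
apply/seteqP; split => [_ [h [/L2_memL2 h2 hT] <-]|_ ->].
  apply/eqP; rewrite /= !L2normE_fine//; apply/eqP; congr (Num.sqrt (fine _))%:E.
  apply: ae_eq_N2 => //; [exact: h2.1|exact: g2.1|].
  by apply: schwartz_uniq => // psi sp; rewrite [LHS]hT// -gT.
by exists g => //; split => //; exact/L2_memL2.
Qed.

(** [L2_fourier] is a chosen representative; it agrees almost everywhere with the limit built in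
    [fourier_L2_exists] and inherits its identities for tests in L^1 /\ L^2. This generality serves
    for a cutoff times [fourier_inv psi], which is not shown to be Schwartz. *)
Lemma L2_fourierP u : memL2 mu u ->
  [/\ memL2 mu (L2_fourier u),
  (forall chi, memL12 mu chi -> cint mu (fun xi => L2_fourier u xi * chi xi) =
    cint mu (fun x => u x * fourier chi x)) &
  (forall psi, memL12 mu psi ->
    cint mu (fun xi => L2_fourier u xi * fourier_inv psi xi) =
    cint mu (fun x => u x * psi x))].
Proof.
move=> u2; have [v [v2 vF vI]] := fourier_L2_exists u2.
have [] : [set v | L2 v /\ represents v (dist_fourier (dist_of u))] (L2_fourier u).
  apply: xgetPex; exists v; split; first exact/L2_memL2.
  by move=> psi sp; exact: vF (memL12_schwartz sp).
move=> /L2_memL2 w2 wF.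
have wv : ae_eq mu setT (L2_fourier u) v.
  apply: schwartz_uniq => // psi sp.
  by rewrite [LHS](wF _ sp) (vF _ (memL12_schwartz sp)).
split => // chi chi12.
  by rewrite -vF//; apply: ae_eq_cint => //; [exact: w2.1|exact: v2.1|exact: chi12.1.1].
rewrite -vI//; apply: ae_eq_cint => //; [exact: w2.1|exact: v2.1|].
exact: (memL2_fourier_inv chi12).1.
Qed.

(** A Schwartz function is at most its norm of order 2n times [weight], and u times [weight] is
    integrable; the factor 2 is that of [cabs_cint]. *)
Lemma tempered_dist_of u : memL2 mu u -> tempered (dist_of u).
Proof.
move=> u2; split.
  move=> a f g sf sg; have [_ f2] := memL12_schwartz sf; have [_ g2] := memL12_schwartz sg.
  have uf := memL1_L2M u2 f2; have ug := memL1_L2M u2 g2.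
  rewrite -[dist_of u f]/(cint mu _) -[dist_of u g]/(cint mu _) -cintZ// -cintD//.
    by apply: eq_cint => x; rewrite mulrDr mulrCA.
  exact: memL1Z.
have [w1 w2] := @memL12_weight R n; have uw := memL1_L2M u2 w2.
pose I := fine (\int[mu]_x (cabs (u x * (weight x)%:C))%:E).
have I0 : (0 <= \int[mu]_x (cabs (u x * (weight x)%:C))%:E)%E.
  by apply: integral_ge0 => x _; rewrite lee_fin cabs_ge0.
have IE : (\int[mu]_x (cabs (u x * (weight x)%:C))%:E = I%:E)%E.
  by rewrite fineK// ge0_fin_numE//; exact: uw.2.
exists (2 * n)%N, (2 * I) => psi sp; have [_ p2] := memL12_schwartz sp.
have up := memL1_L2M u2 p2.
have S0 := schwartz_norm_ge0 psi (2 * n).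
have SE : schwartz_norm (2 * n) psi = (fine (schwartz_norm (2 * n) psi))%:E.
  by rewrite fineK// ge0_fin_numE//; case: sp => _; exact.
apply: le_trans (cabs_cint up) _; rewrite EFinM -muleA; apply: lee_wpmul2l => //.
rewrite SE -IE muleC -ge0_integralZl//; first last.
- by rewrite lee_fin fine_ge0.
- by move=> x _; rewrite lee_fin cabs_ge0.
- by apply/measurable_EFinP; apply: cmeas_cabs; exact: uw.1.
apply: ge0_le_integral => //.
- by move=> x _; rewrite lee_fin cabs_ge0.
- by apply/measurable_EFinP; apply: cmeas_cabs; exact: up.1.
- apply: measurable_funeM; apply/measurable_EFinP; apply: cmeas_cabs; exact: uw.1.
- move=> x _; rewrite -EFinM lee_fin !cabsM cabs_real ger0_norm ?weight_ge0//.
  rewrite mulrCA ler_wpM2l ?cabs_ge0//; exact: cabs_schwartz_weight.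
Qed.

End littlewood_paley_blocks.

(** * Dyadic cutoffs and the L^2 norm of a block *)

Section cutoff.
Context {R : realType} (n : nat).
Local Notation E := 'rV[R]_n.
Local Notation mu := (@lebesgue_rV R n).
Implicit Types (x xi : E).

Lemma enormZ (t : R) x : enorm (t *: x) = `|t| * enorm x.
Proof.
rewrite /enorm (_ : dotr _ _ = t ^+ 2 * dotr x x).
  by rewrite sqrtrM ?sqr_ge0// sqrtr_sqr.
by rewrite /dotr mulr_sumr; apply: eq_bigr => i _; rewrite !mxE; ring.
Qed.

Lemma enorm_eq0 x : enorm x = 0 -> x = 0.
Proof.
move=> x0; apply/rowP => i; rewrite mxE; apply/eqP; rewrite -normr_le0 -x0.
exact: coord_le_enorm.
Qed.

Lemma enorm_delta (i : 'I_n) : enorm (delta_mx ord0 i : E) = 1.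
Proof.
rewrite /enorm /dotr (bigD1 i)//= big1 => [|j ji]; rewrite !mxE !eqxx/=.
  by rewrite mulr1 addr0 sqrtr1.
by rewrite (negbTE ji) mulr0.
Qed.

Lemma measurable_enorm : measurable_fun setT (@enorm R n).
Proof.
apply: (@measurableT_comp _ _ _ _ _ _ (@Num.sqrt R)); last exact: measurable_dotr.
exact: (continuous_measurable_fun (@sqrt_continuous R)).
Qed.

Lemma measurable_eball (rho : R) : measurable (@eball R n rho).
Proof.
rewrite (_ : eball rho = @enorm R n @^-1` [set t | t <= rho])//.
rewrite -[X in measurable X]setTI; apply: measurable_enorm => //.
by rewrite (_ : [set t | t <= rho] = `]-oo, rho]%classic)//; exact/esym/set_itvNyc.
Qed.

Lemma eball_lty (rho : R) : (mu (eball rho) < +oo)%E.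
Proof.
apply: le_lt_trans (lebesgue_box_lty (fun=> - rho - 1) (fun=> rho)).
apply: le_measure; rewrite ?inE; [exact: measurable_eball|exact: measurable_box|].
move=> x xr i; rewrite /ocset /= in_itv/=.
have := le_trans (coord_le_enorm x i) xr; rewrite ler_norml => /andP[h1 h2].
by apply/andP; split; lra.
Qed.

Variables (phi : E -> R[i]) (hphi : LP_cutoff phi).

Definition cutoff (j : int) xi : R[i] := phi ((2 : R) ^ (- j) *: xi).

Lemma exp2_gt0 (j : int) : 0 < (2 : R) ^ j.
Proof. exact: exprz_gt0. Qed.

Lemma enorm_scale (j : int) xi : enorm ((2 : R) ^ (- j) *: xi) = 2 ^ (- j) * enorm xi.
Proof. by rewrite enormZ gtr0_norm// exp2_gt0. Qed.

Lemma cutoff_support (j : int) xi : cutoff j xi != 0 ->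
  3 / 4 * 2 ^ j <= enorm xi <= 8 / 3 * 2 ^ j.
Proof.
case: hphi => _ _ sup _ c0.
have /sup /= : closure [set xi | phi xi != 0] ((2 : R) ^ (- j) *: xi).
  exact: subset_closure.
rewrite enorm_scale -invr_expz (mulrC (2 ^ j)^-1) => /andP[h1 h2].
by rewrite -ler_pdivlMr ?exp2_gt0// h1 -ler_pdivrMr ?exp2_gt0.
Qed.

Lemma cmeas_cutoff (j : int) : cmeas (cutoff j).
Proof.
case: hphi => sm _ _ _.
have cs : continuous (fun xi : E => (2 : R) ^ (- j) *: xi) by exact: scaler_continuous.
have [mR mI] : continuous (ReF phi) /\ continuous (ImF phi).
  by split => x; apply: differentiable_continuous; have [] := sm [::] x.
split; apply: continuous_measurable_rV => x.
  exact: (continuous_comp (cs x) (mR _)).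
exact: (continuous_comp (cs x) (mI _)).
Qed.

(** Radiality reduces the bound to a segment of a coordinate axis, where the extreme value theorem
    applies; its length 3 exceeds the radius 8/3 of the support. *)
Lemma cutoff_bounded : (0 < n)%N ->
  exists2 B : R, 0 <= B & forall j xi, cabs (cutoff j xi) <= B.
Proof.
move=> n0; case: hphi => sm rad _ _; pose e : E := delta_mx ord0 (Ordinal n0).
have ce : continuous (fun t : R => t *: e).
  by move=> t; apply: continuousZr_tmp; exact: cvg_id.
have [mR mI] : continuous (ReF phi) /\ continuous (ImF phi).
  by split => x; apply: differentiable_continuous; have [] := sm [::] x.
have bnd (h : E -> R) : continuous h -> exists C, forall t, 0 <= t <= 3 -> `|h (t *: e)| <= C.
  move=> ch.
  have cc : {within `[0, 3], continuous (fun t : R => `|h (t *: e)|)}.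
    apply: continuous_subspaceT => t.
    apply: (continuous_comp (continuous_comp (ce t) (ch _))); exact: norm_continuous.
  have [c _ cP] := EVT_max (ler0n R 3) cc.
  by exists (`|h (c *: e)|) => t t3; apply: cP; rewrite in_itv.
have [C1 h1] := bnd _ mR; have [C2 h2] := bnd _ mI.
have C1C2 : 0 <= C1 + C2.
  have z : 0 <= (0 : R) <= 3 by rewrite lexx ler0n.
  by apply: addr_ge0; [apply: le_trans (h1 0 z)|apply: le_trans (h2 0 z)].
exists (C1 + C2) => // j xi.
have [->|c0] := eqVneq (cutoff j xi) 0; first by rewrite cabs0.
have := cutoff_support c0; set y := (2 : R) ^ (- j) *: xi => /andP[_ sup].
have ye : enorm y = enorm (enorm y *: e).
  by rewrite enormZ enorm_delta mulr1 ger0_norm// enorm_ge0.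
rewrite /cutoff -/y (rad _ _ ye); apply: le_trans (cabs_le_ReIm _) _.
have y3 : 0 <= enorm y <= 3.
  rewrite enorm_ge0 /y enorm_scale -invr_expz ler_pdivrMl ?exp2_gt0//=.
  by apply: le_trans sup _; rewrite mulrC ler_wpM2l ?ltW ?exp2_gt0//; lra.
by apply: lerD; [exact: h1|exact: h2].
Qed.

Lemma memL2_cutoff (j : int) : (0 < n)%N -> memL2 mu (cutoff j).
Proof.
move=> n0; have [B B0 cB] := cutoff_bounded n0.
pose A := @eball R n (8 / 3 * 2 ^ j).
have -> : cutoff j = (fun xi => cutoff j xi * (\1_A xi)%:C).
  apply/funext => xi; rewrite indicE; have [xA|xA] := boolP (xi \in A).
    by rewrite mulr1.
  rewrite mulr0; apply/eqP; apply: contraNT xA => /cutoff_support/andP[_ h].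
  by rewrite inE.
apply: memL2M (cB j) => //; first exact: cmeas_cutoff.
by apply: memL2_indic; [exact: measurable_eball|exact: eball_lty].
Qed.

Lemma memL12_cutoff_mul (j : int) v : (0 < n)%N -> memL2 mu v ->
  memL12 mu (fun xi => cutoff j xi * v xi).
Proof.
move=> n0 v2; have [B B0 cB] := cutoff_bounded n0; split.
  by apply: memL1_L2M => //; exact: memL2_cutoff.
by apply: memL2M (cB j) => //; exact: cmeas_cutoff.
Qed.

(** Unfolded, the left side is u paired with the transform of [cutoff j] times [fourier_inv psi];
    the multiplication formula moves that transform onto u. *)
Lemma LP_block_pairing u (j : int) psi : (0 < n)%N -> memL2 mu u -> memL12 mu psi ->
  LP_block phi j (dist_of u) psi =
  cint mu (fun xi => L2_fourier u xi * (cutoff j xi * fourier_inv psi xi)).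
Proof.
move=> n0 u2 p12; have [_ wF _] := L2_fourierP u2.
by rewrite wF//; apply: memL12_cutoff_mul => //; exact: memL2_fourier_inv.
Qed.

Definition block_fun u (j : int) : E -> R[i] :=
  fourier_inv (fun xi => cutoff j xi * L2_fourier u xi).

Lemma memL2_block_fun u j : (0 < n)%N -> memL2 mu u -> memL2 mu (block_fun u j).
Proof.
move=> n0 /L2_fourierP[w2 _ _]; apply: memL2_fourier_inv; exact: memL12_cutoff_mul.
Qed.

Lemma represents_block_fun u j : (0 < n)%N -> memL2 mu u ->
  represents (block_fun u j) (LP_block phi j (dist_of u)).
Proof.
move=> n0 u2 psi sp; have p12 := memL12_schwartz sp.
rewrite LP_block_pairing//; have [w2 _ _] := L2_fourierP u2.
rewrite -[LHS]/(cint mu _) fourier_inv_mul; [|exact: (memL12_cutoff_mul _ _ _).1|exact: p12.1].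
by apply: eq_cint => xi; ring.
Qed.

Lemma dist_L2norm_block u j : (0 < n)%N -> memL2 mu u ->
  dist_L2norm (LP_block phi j (dist_of u)) =
  (Num.sqrt ((2 * pi) ^- n * fine (N2 mu (fun xi => cutoff j xi * L2_fourier u xi))))%:E.
Proof.
move=> n0 u2; have [w2 _ _] := L2_fourierP u2.
rewrite (dist_L2norm_represents (memL2_block_fun j n0 u2) (represents_block_fun j n0 u2)).
congr (Num.sqrt _)%:E; have c12 := memL12_cutoff_mul j n0 w2.
by rewrite N2_fourier_inv// fineM// ge0_fin_numE ?N2_ge0//; exact: c12.2.2.
Qed.

End cutoff.

(** * Energies of balls and of blocks *)

Section dyadic_energy.
Context {R : realType} (n : nat).
Local Notation E := 'rV[R]_n.
Local Notation mu := (@lebesgue_rV R n).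
Implicit Types (u v w f g psi : E -> R[i]) (x xi : E).

Lemma dyadic_floor (t : R) : 0 < t -> exists J : int, 2 ^ J <= t < 2 ^ (J + 1).
Proof.
move=> t0; have l2 : 0 < ln (2 : R) by rewrite ln_gt0// ltr1n.
have tE : t = 2 `^ (ln t / ln 2) by rewrite /powR pnatr_eq0/= divfK ?gt_eqF// lnK.
exists (Num.floor (ln t / ln 2)); rewrite -!powR_intmul// [X in _ <= X < _]tE.
rewrite ler_powR ?ler1n ?floor_le//=.
rewrite /powR pnatr_eq0/= ltr_expR ltr_pM2r//; exact: floorD1_gt.
Qed.

Variables (phi : E -> R[i]) (hphi : LP_cutoff phi).
Local Notation cutoff := (cutoff phi).

Lemma enorm0 : enorm (0 : E) = 0.
Proof. by rewrite /enorm /dotr big1 ?sqrtr0// => i _; rewrite mxE mul0r. Qed.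

(** The cutoffs that can be nonzero on the shell 2^J <= |xi| <= 2^(J+1): the support condition 3/4
    2^j <= |xi| <= 8/3 2^j allows only |j - J| < 2. *)
Definition three (J : int) : seq int := [:: J - 1; J; J + 1].

Lemma three_uniq J : uniq (three J).
Proof. by rewrite /three /= !inE; lia. Qed.

Lemma cutoff_three (J j : int) xi : 2 ^ J <= enorm xi <= 2 ^ (J + 1) ->
  cutoff j xi != 0 -> j \in three J.
Proof.
move=> /andP[h1 h2] /(cutoff_support hphi)/andP[h3 h4].
have two0 : (2 : R) != 0 by rewrite pnatr_eq0.
have jJ : j < J + 2.
  rewrite -(@ltr_eXz2l R 2) ?ltr1n//; have := @exp2_gt0 R J.
  rewrite expfzDr// (_ : (2 : R) ^ 2 = 4); last by rewrite -exprnP -natrX.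
  move: h2; rewrite expfzDr// expr1z; move: h3; set a := 2 ^ j; set b := 2 ^ J.
  by move=> *; lra.
have Jj : J < j + 2.
  rewrite -(@ltr_eXz2l R 2) ?ltr1n//; have := @exp2_gt0 R j.
  rewrite expfzDr// (_ : (2 : R) ^ 2 = 4); last by rewrite -exprnP -natrX.
  by move: h1 h4; set a := 2 ^ j; set b := 2 ^ J => *; lra.
by rewrite !inE; lia.
Qed.

Lemma enorm_gt0 xi : xi != 0 -> 0 < enorm xi.
Proof.
by move=> x0; rewrite lt_neqAle enorm_ge0 andbT eq_sym; apply: contra x0 => /eqP/enorm_eq0 ->.
Qed.

Lemma sum_cutoff (J : int) xi : 2 ^ J <= enorm xi <= 2 ^ (J + 1) ->
  \sum_(j <- three J) cutoff j xi = 1.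
Proof.
move=> xJ; case: hphi => _ _ _ /(_ xi) <-.
  rewrite (@fsbig_seq _ _ _ _ _ (cutoff ^~ xi)) ?three_uniq//.
  apply: fsbig_widen => // j [_ /= jJ]; apply/eqP; apply: contra_notT jJ.
  exact: cutoff_three.
by apply: contraTneq xJ => ->; rewrite enorm0 leNgt exp2_gt0.
Qed.

(** On the shell only the cutoffs of [three J] count, so what a partial sum misses from 1 consists
    of those of them that are not in s. *)
Lemma sum_cutoff_defect (s : seq int) (J : int) xi : uniq s ->
  2 ^ J <= enorm xi <= 2 ^ (J + 1) ->
  \sum_(j <- s) cutoff j xi - 1 = - \sum_(j <- three J | j \notin s) cutoff j xi.
Proof.
move=> us xJ; rewrite -(sum_cutoff xJ) (bigID (mem (three J)))/= addrC.
rewrite big1 ?add0r => [|j jJ].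
  rewrite (bigID (mem s) predT)/=.
  rewrite -big_filter -[X in _ - (X + _)]big_filter.
  rewrite (perm_big [seq j <- three J | j \in s]); first by rewrite opprD addrA subrr add0r.
  apply: uniq_perm; rewrite ?filter_uniq ?three_uniq// => j.
  by rewrite !mem_filter andbC.
by apply/eqP; apply: contraNT jJ; exact: cutoff_three.
Qed.

Hypothesis n0 : (0 < n)%N.

(** The origin lies in no dyadic shell, and the cutoffs do not sum to 1 there; being a null set, it
    can be discarded. *)
Lemma lebesgue_rV_origin : mu [set 0] = 0%E.
Proof.
have -> : [set 0] = [set x : E | forall i, [set 0] (x ord0 i)].
  apply/seteqP; split => [x -> i|x H]; first by rewrite /= mxE.
  by apply/rowP => i; rewrite mxE; exact: H.
rewrite (@lebesgue_rV_box R n (fun=> [set 0]))// (bigD1 (Ordinal n0))//=.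
by rewrite lebesgue_measure_set1 mul0e.
Qed.

Lemma measurable_origin : measurable [set (0 : E)].
Proof.
have -> : [set 0] = @eball R n 0.
  apply/seteqP; split => [x ->|x]; rewrite /eball /=.
    by rewrite /enorm /dotr big1 ?sqrtr0// => i _; rewrite mxE mul0r.
  by move=> h; apply: enorm_eq0; apply/eqP; rewrite eq_le h enorm_ge0.
exact: measurable_eball.
Qed.

Lemma ae_neq0 : {ae mu, forall xi : E, xi != 0}.
Proof.
exists [set 0]; split; [exact: measurable_origin|exact: lebesgue_rV_origin|].
by move=> x /= /negP; rewrite negbK => /eqP.
Qed.

Definition low_energy v (rho : R) : R := fine (N2 mu (fun xi => (\1_(eball rho) xi)%:C * v xi)).

Definition block_energy v (j : int) : R := fine (N2 mu (fun xi => cutoff j xi * v xi)).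

Lemma memL2_low v rho : memL2 mu v -> memL2 mu (fun xi => (\1_(eball rho) xi)%:C * v xi).
Proof.
move=> v2; apply: (@memL2M _ _ _ _ _ _ 1) => // [|x].
  by apply: cmeas_real; apply: measurable_indic; exact: measurable_eball.
by rewrite cabs_real indicE; case: (_ \in _); rewrite ?normr0 ?normr1.
Qed.

Lemma N2_fin w : memL2 mu w -> N2 mu w = (fine (N2 mu w))%:E.
Proof. by move=> [_ h]; rewrite fineK// ge0_fin_numE// N2_ge0. Qed.

Lemma fine_le_N2 f g : memL2 mu f -> memL2 mu g ->
  (forall x, cabs (f x) <= cabs (g x)) -> fine (N2 mu f) <= fine (N2 mu g).
Proof. by move=> f2 g2 fg; rewrite -lee_fin -!N2_fin// le_N2//; [exact: f2.1|exact: g2.1]. Qed.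

Lemma low_integral v rho : memL2 mu v ->
  (\int[mu]_(xi in eball rho) ((cabs (v xi)) ^+ 2)%:E = (low_energy v rho)%:E)%E.
Proof.
move=> v2; rewrite /low_energy -N2_fin; last exact: memL2_low.
rewrite integral_mkcond; apply: eq_integral => x _; rewrite patchE indicE.
by case: (_ \in _); rewrite ?mul1r// mul0r cabs0 expr0n.
Qed.

Lemma low_ge0 v rho : 0 <= low_energy v rho.
Proof. by rewrite fine_ge0// N2_ge0. Qed.

Lemma le_low v (a b : R) : memL2 mu v -> a <= b -> low_energy v a <= low_energy v b.
Proof.
move=> v2 ab; apply: fine_le_N2; [exact: memL2_low|exact: memL2_low|].
move=> x; rewrite !cabsM ler_wpM2r ?cabs_ge0// !indicE !cabs_real.
have [xa|xa] := boolP (x \in eball a); last by rewrite normr0 normr_ge0.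
by rewrite mem_set//; apply: le_trans ab; rewrite inE in xa.
Qed.

Lemma low_bounded v rho : memL2 mu v -> low_energy v rho <= fine (N2 mu v).
Proof.
move=> v2; apply: fine_le_N2 => //; first exact: memL2_low.
move=> x; rewrite cabsM cabs_real indicE ler_piMl ?cabs_ge0//.
by case: (_ \in _); rewrite ?normr0 ?normr1.
Qed.

(** The support of [cutoff j] lies in the ball of radius 8/3 2^j, hence in that of radius 2^(j+2).
    Taking B + 1 makes the constant positive. *)
Lemma block_energy_le_low v : memL2 mu v ->
  exists2 B : R, 0 < B & forall j, block_energy v j <= B * low_energy v (2 ^ (j + 2)).
Proof.
move=> v2; have [B B0 cB] := cutoff_bounded hphi n0.
exists ((B + 1) ^+ 2) => [|j]; first by rewrite exprn_gt0// ltr_wpDl.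
have l2 := memL2_low (2 ^ (j + 2)) v2.
rewrite /low_energy -[leRHS]/(fine ((B + 1) ^+ 2)%:E * _) -fineM//; last first.
  by rewrite ge0_fin_numE ?N2_ge0//; exact: l2.2.
have -> : (((B + 1) ^+ 2)%:E = (cabs ((B + 1)%:C : R[i]) ^+ 2)%:E)%E.
  by rewrite cabs_real ger0_norm// addr_ge0.
rewrite -N2Z; last exact: l2.1.
apply: fine_le_N2; [exact: (memL12_cutoff_mul hphi j n0 v2).2|exact: memL2Z|].
move=> x; rewrite !cabsM mulrA ler_wpM2r ?cabs_ge0//.
rewrite indicE !cabs_real (@ger0_norm _ (B + 1)) ?addr_ge0//.
have [->|c0] := eqVneq (cutoff j x) 0.
  by rewrite cabs0 mulr_ge0// addr_ge0.
rewrite mem_set; first by rewrite normr1 mulr1 (le_trans (cB j x))// lerDl.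
have /andP[_ h] := cutoff_support hphi c0; apply: le_trans h _.
rewrite expfzDr ?pnatr_eq0// (_ : (2 : R) ^ 2 = 4); last by rewrite -exprnP -natrX.
by have := @exp2_gt0 R j; set a := 2 ^ j => *; lra.
Qed.

(** On the new shell three cutoffs sum to 1, so 1 <= (p + q + r)^2 <= 3 (p^2 + q^2 + r^2) for their
    moduli; the integrands can then be compared point by point. *)
Lemma low_shell v (J : int) : memL2 mu v -> low_energy v (2 ^ (J + 1)) <= low_energy v (2 ^ J) +
  3 * (block_energy v (J - 1) + block_energy v J + block_energy v (J + 1)).
Proof.
move=> v2; have c2 j := (memL12_cutoff_mul hphi j n0 v2).2.
have l2 rho := memL2_low rho v2.
have mN2 w : memL2 mu w -> measurable_fun setT (fun x => ((cabs (w x)) ^+ 2)%:E).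
  by move=> [mw _]; apply/measurable_EFinP; exact: cmeas_cabs2.
have [c cE] : exists c : R, c = 3 by eexists.
have c0 : 0 <= c by rewrite cE.
rewrite -cE -lee_fin !EFinD EFinM !EFinD -!N2_fin//.
rewrite -!ge0_integralD//; try by (try apply: emeasurable_funD; exact: mN2).
all: try by move=> x _; rewrite -?EFinD lee_fin ?addr_ge0 ?sqr_ge0.
rewrite -ge0_integralZl//; first last.
- by move=> x _; rewrite -!EFinD lee_fin !addr_ge0 ?sqr_ge0.
- by apply: emeasurable_funD; [apply: emeasurable_funD|]; exact: mN2.
rewrite -ge0_integralD//; first last.
- by apply: measurable_funeM; apply: emeasurable_funD; [apply: emeasurable_funD|]; exact: mN2.
- by move=> x _; rewrite mule_ge0// -!EFinD lee_fin !addr_ge0 ?sqr_ge0.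
- exact: mN2.
- by move=> x _; rewrite lee_fin sqr_ge0.
apply: ge0_le_integral => //.
- by move=> x _; rewrite lee_fin sqr_ge0.
- exact: mN2.
- apply: emeasurable_funD; first exact: mN2.
  by apply: measurable_funeM; apply: emeasurable_funD; [apply: emeasurable_funD|]; exact: mN2.
move=> x _.
suff H : cabs ((\1_(eball (2 ^ (J + 1))) x)%:C * v x) ^+ 2 <=
   cabs ((\1_(eball (2 ^ J)) x)%:C * v x) ^+ 2 + c * (cabs (cutoff (J - 1) x * v x) ^+ 2 +
    cabs (cutoff J x * v x) ^+ 2 + cabs (cutoff (J + 1) x * v x) ^+ 2).
  by rewrite -lee_fin in H; exact: H.
rewrite !cabsM !exprMn -!mulrDl mulrA -mulrDl.
rewrite cE; rewrite ler_wpM2r ?sqr_ge0// !indicE !cabs_real.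
have [xJ|xJ] := boolP (x \in eball (2 ^ J)).
  have -> : x \in eball (2 ^ (J + 1)).
    rewrite inE /eball /=; rewrite inE /eball /= in xJ; apply: le_trans xJ _.
    by rewrite ler_eXz2l ?ltr1n//; lia.
  by rewrite lerDl mulr_ge0// !addr_ge0// sqr_ge0.
have [xJ1|_] := boolP (x \in eball (2 ^ (J + 1))); last first.
  by rewrite normr0 expr0n/= add0r mulr_ge0// !addr_ge0// sqr_ge0.
rewrite normr0 normr1 expr1n expr0n/= add0r.
have xb : 2 ^ J <= enorm x <= 2 ^ (J + 1).
  apply/andP; split; last by rewrite inE in xJ1.
  by rewrite ltW// ltNge; apply: contra xJ => h; rewrite inE.
have /(congr1 (@cabs R)) := sum_cutoff xb; rewrite /three !big_cons big_nil addr0.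
have -> : cabs (1 : R[i]) = 1 by rewrite -[1]/(1%:C) cabs_real normr1.
set a := cutoff _ x; set b := cutoff _ x; set d := cutoff _ x => abd.
have : 1 <= cabs a + cabs b + cabs d.
  by rewrite -abd -addrA (le_trans (ler_cabsD _ _))// lerD2l ler_cabsD.
move: (cabs a) (cabs b) (cabs d) => p q r pqr.
have : 1 <= (p + q + r) ^+ 2 by rewrite expr_ge1// (le_trans _ pqr).
have := sqr_ge0 (p - q); have := sqr_ge0 (q - r); have := sqr_ge0 (p - r).
by rewrite !expr2 => *; lra.
Qed.

Lemma low_cvg0 v : memL2 mu v -> low_energy v (2 ^ (- k%:Z)) @[k --> \oo] --> (0 : R).
Proof.
(* The extra indicator removes the origin, which lies in all the balls, so that the integrands tend
   to 0 at every point. *)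
move=> v2; pose h k xi := (\1_(~` [set (0 : E)]) xi)%:C *
  ((\1_(eball (2 ^ (- k%:Z))) xi)%:C * v xi) : R[i].
have mh k : cmeas (h k).
  apply: cmeas_indic; first by apply: measurableC; exact: measurable_origin.
  by have [] := memL2_low (2 ^ (- k%:Z)) v2.
have hE k : N2 mu (h k) = (low_energy v (2 ^ (- k%:Z)))%:E.
  have l2 := memL2_low (2 ^ (- k%:Z)) v2.
  rewrite /low_energy -N2_fin//; apply: ae_eq_N2 => //; first exact: l2.1.
  apply: filterS ae_neq0 => x x0 _; rewrite /h indicE mem_set ?mul1r//.
  by move=> /= xx; rewrite xx eqxx in x0.
suff : N2 mu (h k) @[k --> \oo] --> 0%E.
  under eq_fun do rewrite hE.
  by move=> /fine_cvgP[].
apply: (N2_dominated0 mh v2) => [k x|x].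
  rewrite /h !cabsM !cabs_real !indicE.
  do 2!case: (_ \in _); by rewrite ?normr0 ?normr1 ?mul0r ?mul1r ?mul0r ?cabs_ge0.
have [->|x0] := eqVneq x 0.
  apply: cvg_near_cst; apply: nearW => k.
  by rewrite /h indicE memNset ?mul0r ?cabs0//= => /(_ erefl).
have [J /andP[xJ _]] := dyadic_floor (enorm_gt0 x0).
apply: cvg_near_cst; near=> k.
rewrite /h [X in _ * (X%:C * _)]indicE memNset ?mul0r ?mulr0 ?cabs0//=.
rewrite /eball /= => xk; have := le_trans xJ xk.
rewrite ler_eXz2l ?ltr1n//; have : (`|J| < k)%N by near: k; exact: nbhs_infty_gt.
by lia.
Unshelve. all: by end_near. Qed.

End dyadic_energy.

(** * Convergence of the Littlewood-Paley series *)

Section series_convergence.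
Context {R : realType} (n : nat).
Local Notation E := 'rV[R]_n.
Local Notation mu := (@lebesgue_rV R n).
Implicit Types (u v w f g psi : E -> R[i]) (x xi : E).
(** The indices -p <= j < q, listed as the two halves of the sum in [dist_series_cvg]. *)
Definition int_window (p q : nat) : seq int :=
  [seq - k.+1%:Z | k <- index_iota 0 p] ++ [seq k%:Z | k <- index_iota 0 q].

Lemma mem_int_window p q (j : int) : (j \in int_window p q) = (- p%:Z <= j < q%:Z).
Proof.
rewrite mem_cat; apply/orP/idP => [[|] /mapP[k]|]; rewrite ?mem_index_iota.
- by move=> kp ->; lia.
- by move=> kq ->; lia.
case: j => k /andP[h1 h2].
  by right; apply/mapP; exists k => //; rewrite mem_index_iota; lia.
by left; apply/mapP; exists k; rewrite ?NegzE// mem_index_iota; lia.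
Qed.

Lemma int_window_uniq p q : uniq (int_window p q).
Proof.
rewrite cat_uniq !map_inj_uniq ?iota_uniq//=; first last.
- by move=> a b; lia.
- by move=> a b [].
rewrite andbT; apply/hasPn => j /mapP[k _ ->]; apply/negP => /mapP[l _]; lia.
Qed.

Lemma sum_int_window (V : nmodType) (F : int -> V) p q :
  \sum_(0 <= k < p) F (- k.+1%:Z) + \sum_(0 <= k < q) F k%:Z = \sum_(j <- int_window p q) F j.
Proof. by rewrite /int_window big_cat /= !big_map. Qed.

Hypothesis n0 : (0 < n)%N.
Variables (phi : E -> R[i]) (hphi : LP_cutoff phi).
Local Notation cutoff := (cutoff phi).

(* The points where the partial sums of the partition of unity over
   -m <= j < m may differ from 1. *)
Definition far (m : nat) : set E :=
  ~` [set xi | 2 ^ (1 - m%:Z) <= enorm xi <= 2 ^ (m%:Z - 2)].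

Lemma measurable_far m : measurable (far m).
Proof.
apply: measurableC.
rewrite (_ : [set _ | _] = @enorm R n @^-1` `[2 ^ (1 - m%:Z), 2 ^ (m%:Z - 2)]).
  by rewrite -[X in measurable X]setTI; exact: measurable_enorm.
by apply/seteqP; split => x; rewrite /= in_itv.
Qed.

Lemma far_cvg0 xi : xi != 0 -> \1_(far m) xi @[m --> \oo] --> (0 : R).
Proof.
move=> /enorm_gt0/dyadic_floor[J /andP[h1 h2]].
apply: cvg_near_cst; near=> m; rewrite indicE memNset//= => -[]; rewrite /=.
have : (`|J| + 3 < m)%N by near: m; exact: nbhs_infty_gt.
move=> Jm; apply/andP; split; [apply: le_trans h1|apply: le_trans (ltW h2) _];
  by rewrite ler_eXz2l ?ltr1n//; lia.
Unshelve. all: by end_near. Qed.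

Lemma partial_sum_defect (B : R) : (forall j xi, cabs (cutoff j xi) <= B) ->
  forall (p q m : nat) xi, (m <= p)%N -> (m <= q)%N -> xi != 0 ->
  cabs (\sum_(j <- int_window p q) cutoff j xi - 1) <= 3 * B * \1_(far m) xi.
Proof.
move=> cB p q m xi mp mq x0.
have [J /andP[h1 h2]] := dyadic_floor (enorm_gt0 x0).
rewrite (sum_cutoff_defect hphi (int_window_uniq p q) (J := J)); last first.
  by apply/andP; split => //; exact: ltW.
rewrite cabsN indicE; have [_|xm] := boolP (xi \in far m).
  have B0 : 0 <= B by apply: le_trans (cB 0 xi); exact: cabs_ge0.
  rewrite mulr1 /three !big_cons big_nil.
  have a : cabs (cutoff (J - 1) xi) <= B by [].
  have b : cabs (cutoff J xi) <= B by [].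
  have c : cabs (cutoff (J + 1) xi) <= B by [].
  have D z z' : cabs z <= B -> cabs (z + z') <= B + cabs z'.
    by move=> zB; apply: le_trans (ler_cabsD _ _) _; rewrite lerD2r.
  apply: (@le_trans _ _ (B + (B + B))); last by rewrite -subr_ge0 (_ : _ - _ = 0)//; ring.
  case: ifP => _; [apply: le_trans (D _ _ a) _; rewrite lerD2l|apply: ler_wpDl => //];
  (case: ifP => _; [apply: le_trans (D _ _ b) _; rewrite lerD2l|apply: ler_wpDl => //]);
  by case: ifP => _; rewrite ?addr0 ?cabs0.
move: xm; rewrite notin_setE /far /= => /contrapT/andP[x1 x2].
rewrite mulr0 big_seq_cond big_pred0 ?cabs0// => j.
apply/negbTE/negP => /andP[jJ]; rewrite mem_int_window.
(* Outside [far m] the shell index satisfies 1 - m <= J <= m - 2, so J - 1, J and J + 1 all belong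
   to the window and nothing is missing. *)
have J1 : 1 - m%:Z < J + 1 by rewrite -(@ltr_eXz2l R 2) ?ltr1n//; exact: le_lt_trans x1 h2.
have J2 : J <= m%:Z - 2 by rewrite -(@ler_eXz2l R 2) ?ltr1n//; exact: le_trans h1 x2.
by move: jJ; rewrite !inE; lia.
Qed.

(** Tested on psi, the error is the integral of the defect of the partition of unity against an
    integrable [h]. The defect is at most 3 B and lives on [far m], so dominated convergence
    applies; the bound depends only on some m below both p and q, which may therefore grow
    independently. *)
Lemma dist_series_LP u : memL2 mu u ->
  dist_series_cvg (fun j => LP_block phi j (dist_of u)) (dist_of u).
Proof.
move=> u2 psi sp; have p12 := memL12_schwartz sp.
have [w2 _ wI] := L2_fourierP u2; have [B B0 cB] := cutoff_bounded hphi n0.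
have f2 := memL2_fourier_inv p12.
pose h xi := L2_fourier u xi * fourier_inv psi xi.
have h1 : memL1 mu h by exact: memL1_L2M.
have c1 j : memL1 mu (fun xi => cutoff j xi * h xi).
  by apply: memL1M (cB j) => //; exact: cmeas_cutoff.
have sE p q : \sum_(0 <= k < p) LP_block phi (- k.+1%:Z) (dist_of u) psi +
    \sum_(0 <= k < q) LP_block phi k%:Z (dist_of u) psi - dist_of u psi =
    cint mu (fun xi => (\sum_(j <- int_window p q) cutoff j xi - 1) * h xi).
  rewrite (sum_int_window (fun j => LP_block phi j (dist_of u) psi)).
  rewrite -[dist_of u psi]/(cint mu _) -wI//.
  under eq_bigr do rewrite LP_block_pairing//.
  transitivity (\sum_(j <- int_window p q) cint mu (fun xi => cutoff j xi * h xi) - cint mu h).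
    by congr (_ - _); apply: eq_bigr => j _; apply: eq_cint => xi; rewrite /h; ring.
  rewrite -cint_sum// -cintB//; last exact: memL1_sum.
  by apply: eq_cint => xi; rewrite mulrBl mul1r mulr_suml.
pose G (m : nat) := (\int[mu]_xi (3 * B * (\1_(far m) xi * cabs (h xi)))%:E)%E.
have mf m : measurable_fun setT (fun xi => \1_(far m) xi * cabs (h xi)).
  apply: measurable_funM; last by apply: cmeas_cabs; exact: h1.1.
  by apply: measurable_indic; exact: measurable_far.
have G0 : G m @[m --> \oo] --> 0%E.
  pose k m xi := \1_(~` [set (0 : E)]) xi * (\1_(far m) xi * cabs (h xi)).
  have mk m : measurable_fun setT (k m).
    apply: measurable_funM => //; apply: measurable_indic.
    by apply: measurableC; exact: measurable_origin.
  have GE m : G m = ((3 * B)%:E * \int[mu]_xi (k m xi)%:E)%E.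
    rewrite /G -ge0_integralZl//; first last.
    - by rewrite lee_fin mulr_ge0.
    - by move=> x _; rewrite lee_fin /k !mulr_ge0 ?cabs_ge0// indicE ler0n.
    - exact/measurable_EFinP.
    apply: ae_eq_integral => //.
    - by apply/measurable_EFinP; apply: measurable_funM.
    - by apply: measurable_funeM; exact/measurable_EFinP.
    apply: filterS (ae_neq0 n0) => x x0 _.
    rewrite /k [X in _ = (_ * (X * _)%:E)%E]indicE mem_set ?mul1r ?EFinM//.
    by move=> /= xx; rewrite xx eqxx in x0.
  rewrite (_ : G = fun m => ((3 * B)%:E * \int[mu]_xi (k m xi)%:E)%E); last exact/funext.
  rewrite -[X in _ --> X](mule0 (3 * B)%:E); apply: cvgeZl => //.
  apply: (integral_dominated0 mk (memL1_cabs h1)).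
    move=> m x; rewrite /k !indicE; do 2!case: (_ \in _);
    by rewrite ?mul1r ?mul0r ?lexx ?cabs_ge0.
  move=> x; have [->|x0] := eqVneq x 0.
    apply: cvg_near_cst; apply: nearW => m.
    by rewrite /k indicE memNset ?mul0r//= => /(_ erefl).
  rewrite -[X in _ --> X](mulr0 (\1_(~` [set 0]) x)); apply: cvgMl_tmp.
  rewrite -[X in _ --> X](mul0r (cabs (h x))); apply: cvgMr_tmp; exact: far_cvg0.
have bound p q m : (m <= p)%N -> (m <= q)%N ->
    ((cabs (cint mu (fun xi => (\sum_(j <- int_window p q) cutoff j xi - 1) * h xi)))%:E
     <= 2%:E * G m)%E.
  move=> mp mq.
  have s1 : memL1 mu (fun xi => (\sum_(j <- int_window p q) cutoff j xi - 1) * h xi).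
    rewrite (_ : (fun _ => _) = fun xi =>
        \sum_(j <- int_window p q) cutoff j xi * h xi - h xi).
      by apply: memL1B => //; exact: memL1_sum.
    by apply/funext => xi; rewrite mulrBl mul1r mulr_suml.
  apply: le_trans (cabs_cint s1) _; apply: lee_wpmul2l => //.
  apply: ae_ge0_le_integral => //.
  - by move=> x _; rewrite lee_fin cabs_ge0.
  - by apply/measurable_EFinP; apply: cmeas_cabs; exact: s1.1.
  - by move=> x _; rewrite lee_fin !mulr_ge0 ?cabs_ge0// indicE ler0n.
  - by apply/measurable_EFinP; apply: measurable_funM.
  apply: filterS (ae_neq0 n0) => x x0 _; rewrite lee_fin cabsM mulrA.
  by rewrite ler_wpM2r ?cabs_ge0//; exact: partial_sum_defect.
apply/cvgr0Pnorm_lt => e e0.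
have : \forall m \near \oo, (G m < (e / 2)%:E)%E.
  by apply: (G0 (fun z => (z < (e / 2)%:E)%E)); apply: open_ereal_lt'; rewrite lte_fin divr_gt0.
move=> /filter_ex[m Gm].
exists ([set p | (m <= p)%N], [set q | (m <= q)%N]).
  by split; exact: nbhs_infty_ge.
move=> [p q] [/= mp mq]; rewrite sE ger0_norm ?cabs_ge0// -lte_fin.
apply: le_lt_trans (bound p q m mp mq) _.
rewrite (_ : e%:E = 2%:E * (e / 2)%:E)%E; first by rewrite lte_pmul2l.
by rewrite -EFinM mulrCA divff ?mulr1// pnatr_eq0.
Qed.

End series_convergence.

(** * Dyadic energies and decay *)

Section dyadic_sequences.
Context {R : realType}.
Implicit Types (s t : R) (j k : int).

Definition dyad t j : R := 2 `^ (t * j%:~R).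

Lemma dyad_gt0 t j : 0 < dyad t j.
Proof. exact: powR_gt0. Qed.

Lemma dyadD t j k : dyad t (j + k) = dyad t j * dyad t k.
Proof. by rewrite /dyad rmorphD/= mulrDr powRD// pnatr_eq0 implybT. Qed.

Lemma dyad_le t j k : 0 <= t -> j <= k -> dyad t j <= dyad t k.
Proof. by move=> t0 jk; rewrite ler_powR ?ler1n// ler_wpM2l// ler_int. Qed.

Lemma dyad_sqr s j : dyad (2 * s) j = dyad s j ^+ 2.
Proof. by rewrite /dyad -powR_mulrn ?powR_ge0// -powRrM; congr powR; ring. Qed.

Lemma dyad_add s t j : dyad (s + t) j = dyad s j * dyad t j.
Proof. by rewrite /dyad mulrDl powRD// pnatr_eq0 implybT. Qed.

Lemma dyad_powR t j : (2 ^ j) `^ t = dyad t j.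
Proof. by rewrite /dyad -powR_intmul// -powRrM mulrC. Qed.

Lemma dyad_small t (e : R) : 0 < t -> 0 < e -> exists N : int, forall j, j <= N -> dyad t j < e.
Proof.
move=> t0 e0; have l2 : 0 < t * ln (2 : R) by rewrite mulr_gt0// ln_gt0// ltr1n.
exists (Num.floor (ln e / (t * ln 2)) - 1) => j jN.
rewrite /dyad /powR pnatr_eq0/= -[ltRHS](lnK e0) ltr_expR mulrAC mulrC -ltr_pdivlMr//.
by apply: lt_le_trans (floor_le _); rewrite ltr_int (le_lt_trans jN)// gtrBl.
Qed.

Lemma dyad_gt1 t : 0 < t -> 1 < dyad t 1.
Proof.
move=> t0; rewrite /dyad mulr1 /powR pnatr_eq0/= -[ltLHS]expR0 ltr_expR.
by rewrite mulr_gt0 ?ln_gt0 ?ltr1n.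
Qed.

(** If s < t, then [dyad t j] is negligible against [dyad s j] as j tends to -oo. Every comparison
    of exponents in the sequel (maximality, minimality, the index) goes through this. *)
Lemma dyad_compare (c C s t : R) : 0 < c ->
  (forall N : int, exists2 j, j <= N & c * dyad s j <= C * dyad t j) -> t <= s.
Proof.
move=> c0 H; rewrite leNgt; apply/negP => st.
have ts : 0 < t - s by rewrite subr_gt0.
have C0 : 0 < C.
  have [j _ h] := H 0; have := lt_le_trans (mulr_gt0 c0 (dyad_gt0 s j)) h.
  by rewrite pmulr_lgt0// dyad_gt0.
have [N NP] := dyad_small ts (divr_gt0 c0 C0); have [j jN] := H N.
rewrite (_ : t = s + (t - s)); last by ring.
rewrite dyad_add mulrCA mulrC ler_pM2l ?dyad_gt0//; apply/negP; rewrite -ltNge.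
by rewrite mulrC -ltr_pdivlMr// NP.
Qed.

(** * Abstract sequences of ball energies [m] and block energies [X] *)

Section shells.
Variables (m X : int -> R).
Hypothesis le_m : forall i j, i <= j -> m i <= m j.
Hypothesis m_shell : forall j, m (j + 1) <= m j + 3 * (X (j - 1) + X j + X (j + 1)).

(** With G suitably large, m j - G 2^(tj) does not increase with j; going down towards -oo, where
    both terms tend to 0, shows that it is never positive. *)
Lemma shells_upper t (K : R) : 0 < t -> 0 <= K ->
  m (- k%:Z) @[k --> \oo] --> (0 : R) -> (forall j, X j <= K * dyad t j) ->
  exists C, forall j, m j <= C * dyad t j.
Proof.
move=> t0 K0 m0 XK; have d1 := dyad_gt1 t0; set a := dyad t 1 in d1.
(* G is fixed by G (a - 1) = 9 K a: the growth of G 2^(tj) over one step then matches the increase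
   of m, three times three blocks of size at most K a 2^(tj). *)
exists (9 * K * a / (a - 1)); set G := 9 * K * a / (a - 1).
have Gge0 : 0 <= G by rewrite divr_ge0 ?subr_ge0 ?(ltW d1)// !mulr_ge0// (le_trans _ (ltW d1)).
have step j : m (j + 1) - G * dyad t (j + 1) <= m j - G * dyad t j.
  rewrite lerBlDr; apply: le_trans (m_shell j) _; rewrite -[leRHS]addrA lerD2l.
  rewrite dyadD -/a (_ : - _ + _ = 9 * K * a * dyad t j); last first.
    rewrite (_ : 9 * K * a = G * (a - 1)); first by ring.
    by rewrite divfK// subr_eq0 gt_eqF.
  have le3 i : i <= j + 1 -> X i <= K * (a * dyad t j).
    move=> ij; apply: le_trans (XK i) _; rewrite ler_wpM2l//.
    by rewrite [leRHS]mulrC -dyadD dyad_le// ltW.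
  have x1 : X (j - 1) <= K * (a * dyad t j) by apply: le3; lia.
  have x2 : X j <= K * (a * dyad t j) by apply: le3; lia.
  have x3 : X (j + 1) <= K * (a * dyad t j) by apply: le3; lia.
  rewrite -!mulrA; move: x1 x2 x3; set y := K * _.
  by move: (X _) (X _) (X _) => x1 x2 x3 *; lra.
have stepk j (k : nat) : m j - G * dyad t j <= m (j - k%:Z) - G * dyad t (j - k%:Z).
  elim: k => [|k IH]; first by rewrite subr0.
  apply: le_trans IH _; have := step (j - k.+1%:Z).
  by rewrite (_ : j - k.+1%:Z + 1 = j - k%:Z)//; lia.
move=> j; rewrite -subr_le0; apply/ler_addgt0Pl => e e0; rewrite addr0.
have /cvgr0Pnorm_lt/(_ e e0)/filter_ex[N Ne] := m0.
apply: le_trans (stepk j (`|j| + N)%N) _; rewrite lerBlDr.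
have h : m (j - (`|j| + N)%N%:Z) <= m (- N%:Z) by apply: le_m; lia.
apply: le_trans h _; apply: (@le_trans _ _ e); last by rewrite lerDl mulr_ge0// ltW// dyad_gt0.
by apply: ltW; apply: le_lt_trans (ler_norm _) Ne.
Qed.

(** This is b + 1 uses of [m_shell], each adding at most 3 times 3 d. *)
Lemma shells_window (J : int) (b : nat) (d : R) :
  (forall i, J - b%:Z - 1 <= i <= J + 1 -> X i <= d) ->
  m (J + 1) <= m (J - b%:Z) + 9 * (b.+1)%:R * d.
Proof.
elim: b J => [|b IH] J Xd; apply: le_trans (m_shell J) _.
  rewrite subr0 lerD2l.
  have x1 : X (J - 1) <= d by apply: Xd; lia.
  have x2 : X J <= d by apply: Xd; lia.
  have x3 : X (J + 1) <= d by apply: Xd; lia.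
  by move: (X _) (X _) (X _) x1 x2 x3 => *; lra.
have Xd' i : J - 1 - b%:Z - 1 <= i <= J - 1 + 1 -> X i <= d by move=> h; apply: Xd; lia.
move: (IH (J - 1) Xd'); rewrite subrK (_ : J - 1 - b%:Z = J - b.+1%:Z); last by lia.
have x1 : X (J - 1) <= d by apply: Xd; lia.
have x2 : X J <= d by apply: Xd; lia.
have x3 : X (J + 1) <= d by apply: Xd; lia.
rewrite [in b.+2%:R]mulrS.
by move: (X _) (X _) (X _) (m _) (m _) (b.+1%:R) x1 x2 x3 => *; nra.
Qed.

(* The energy of a window of dyadic shells of fixed length below J is of order
   2^(tJ), hence so is that of one of the blocks. *)
Lemma shells_pigeonhole t (c C : R) (J0 : int) : 0 < t -> 0 < c ->
  (forall j, j <= J0 -> m j <= C * dyad t j) ->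
  (forall j, j <= J0 -> c * dyad t j <= m j) ->
  exists d (M : int) (jk : nat -> int), [/\ 0 < d,
    ((jk k)%:~R : R) @[k --> \oo] --> -oo,
    (forall k : nat, `|jk k - jk k.+1| <= M) &
    (forall k : nat, d * dyad t (jk k) <= X (jk k))].
Proof.
move=> t0 c0 mC cm.
have C0 : 0 < C.
  have := le_trans (cm J0 (lexx _)) (mC J0 (lexx _)).
  by rewrite ler_pM2r ?dyad_gt0//; exact: lt_le_trans.
have [N NP] := dyad_small t0 (divr_gt0 c0 (mulr_gt0 (ltr0n R 2) C0)).
(* The window is long enough for the energy below it to be at most half of the lower bound at its
   top. *)
pose b := `|N|%N; have bP : C * dyad t (- b%:Z) <= c / 2.
  have : dyad t (- b%:Z) < c / (2 * C) by apply: NP; rewrite /b; lia.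
  rewrite ltr_pdivlMr ?mulr_gt0// => h; rewrite ler_pdivlMr//.
  by apply: ltW; rewrite (_ : _ * 2 = dyad t (- b%:Z) * (2 * C))//; ring.
(* If all blocks of the window were below d 2^(t(J+1)), it would contribute at most a quarter of the
   lower bound; with the half from below this leaves 3/4, a contradiction. *)
pose d := c / (4 * 9 * b.+1%:R).
have d0 : 0 < d by rewrite divr_gt0// !mulr_gt0// ltr0n.
have /choice[i iP] : forall k : nat, exists i : int, J0 - k%:Z - b%:Z - 2 <= i <= J0 - k%:Z /\
    d * dyad t i <= X i.
  move=> k; pose J := J0 - k%:Z - 1; apply: contrapT => /forallNP H.
  have XJ (i : int) : J - b%:Z - 1 <= i <= J + 1 -> X i <= d * dyad t (J + 1).
    move=> /andP[h1 h2]; have Hi : J0 - k%:Z - b%:Z - 2 <= i <= J0 - k%:Z.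
      by rewrite /J in h1 h2; apply/andP; split; lia.
    have /not_andP[//|/negP] := H i.
    rewrite -ltNge => /ltW h; apply: le_trans h _; rewrite ler_wpM2l ?(ltW d0)//.
    by apply: dyad_le => //; exact: ltW.
  have h1 := shells_window XJ.
  have h2 : c * dyad t (J + 1) <= m (J + 1) by apply: cm; rewrite /J; lia.
  have h3 : m (J - b%:Z) <= C * dyad t (J - b%:Z) by apply: mC; rewrite /J; lia.
  have h4 : C * dyad t (J - b%:Z) <= c / 2 * dyad t (J + 1).
    rewrite dyadD [dyad t J * _]mulrC mulrA.
    apply: le_trans (_ : c / 2 * dyad t J <= _).
      by rewrite ler_wpM2r// ltW// dyad_gt0.
    by rewrite ler_wpM2l ?divr_ge0 ?(ltW c0)// dyad_le ?(ltW t0)//; lia.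
  have h5 : 9 * b.+1%:R * (d * dyad t (J + 1)) = c / 4 * dyad t (J + 1).
    have : b.+1%:R != 0 :> R by rewrite pnatr_eq0.
    by rewrite /d; move: (b.+1%:R) => y y0; field.
  rewrite h5 in h1; have := dyad_gt0 t (J + 1).
  move: h1 h2 h3 h4; move: (m _) (m _) (dyad t _) (C * _) => x y z w h1 h2 h3 h4 z0.
  have : c * z <= 3 / 4 * c * z by lra.
  rewrite ler_pM2r// => ?; lra.
(* Successive windows have length b + 2 and are shifted by 1, so the chosen indices are at most b +
   3 apart. *)
exists d, (b%:Z + 3), i; split => //; last by move=> k; case: (iP k).
  apply/cvgrNyPle => A.
  have [f fA] : exists f : int, f%:~R <= A by exists (Num.floor A); exact: floor_le.
  near=> k; have [/andP[_ ik] _] := iP k.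
  apply: le_trans (_ : (J0 - k%:Z)%:~R <= _); first by rewrite ler_int.
  apply: le_trans fA; rewrite ler_int.
  have : (`|J0 - f| < k)%N by near: k; exact: nbhs_infty_gt.
  by lia.
move=> k; have [/andP[h1 h2] _] := iP k; have [/andP[h3 h4] _] := iP k.+1; lia.
Unshelve. all: by end_near. Qed.

(** Below j the first block index with [jk k + 2 <= j] is also at least j - (M + 2), by minimality
    and the bound on the gaps. Monotonicity of m then transports the bound from jk k + 2 to j, at
    the cost of the factor 2^(t(M+2)). *)
Lemma shells_lower t (c B : R) (M : int) (jk : nat -> int) : 0 <= t -> 0 < c -> 0 < B ->
  (forall j, X j <= B * m (j + 2)) ->
  ((jk k)%:~R : R) @[k --> \oo] --> -oo ->
  (forall k : nat, `|jk k - jk k.+1| <= M) ->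
  (forall k : nat, c * dyad t (jk k) <= X (jk k)) ->
  exists2 d : R, 0 < d & exists J0 : int, forall j, j <= J0 -> d * dyad t j <= m j.
Proof.
move=> t0 c0 B0 Xm jkN gap cX.
exists (c / B / dyad t (M + 2)); first by rewrite !divr_gt0// dyad_gt0.
exists (jk 0%N + 2) => j j0.
have ex : exists k : nat, jk k + 2 <= j.
  have /cvgrNy_le/(_ (j - 2)%:~R)/filter_ex[k] := jkN.
  by rewrite ler_int => h; exists k; lia.
have [k jkj kmin] := ex_minnP ex.
have jM : j <= jk k + (M + 2).
  case: k jkj kmin => [|k] h kmin; first by have := gap 0%N; lia.
  have := gap k; have : ~~ (jk k + 2 <= j) by apply/negP => /kmin; rewrite ltnn.
  by lia.
apply: le_trans (le_m jkj).
have h : c * dyad t (jk k) <= B * m (jk k + 2) by apply: le_trans (cX k) (Xm _).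
apply: le_trans (_ : c / B * dyad t (jk k) <= _).
  rewrite -!mulrA ler_wpM2l ?(ltW c0)// ler_wpM2l ?invr_ge0 ?(ltW B0)//.
  by rewrite mulrC ler_pdivrMr ?dyad_gt0// -dyadD dyad_le.
by rewrite mulrAC ler_pdivrMr// (mulrC (m _)).
Qed.

(** The bound on m is known only near -oo, while the Besov condition concerns all j; for large j the
    total energy T suffices, because 2^(tj) is bounded below there. *)
Lemma shells_blocks t (B C T : R) (J0 : int) : 0 < t -> 0 < B ->
  (forall j, X j <= B * m (j + 2)) -> (forall j, 0 <= m j <= T) ->
  (forall j, j <= J0 -> m j <= C * dyad t j) ->
  exists2 K, 0 <= K & forall j, X j <= K * dyad t j.
Proof.
move=> t0 B0 Xm mT mC.
have T0 : 0 <= T by have /andP[/le_trans] := mT 0; exact.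
have C0 : 0 <= C.
  have /andP[h _] := mT J0; have := le_trans h (mC J0 (lexx _)).
  by rewrite pmulr_lge0 ?dyad_gt0.
have dg j := dyad_gt0 t j.
exists (B * C * dyad t 2 + B * T / dyad t (J0 - 2)).
  by rewrite addr_ge0// ?divr_ge0 ?mulr_ge0// ltW.
move=> j; apply: le_trans (Xm j) _; rewrite mulrDl.
have [jJ|jJ] := leP (j + 2) J0.
  apply: ler_wpDr; first by rewrite mulr_ge0 ?divr_ge0 ?mulr_ge0// ltW.
  rewrite -!mulrA ler_wpM2l ?(ltW B0)// (mulrC (dyad t 2)) -dyadD; exact: mC.
apply: ler_wpDl; first by rewrite !mulr_ge0// ltW.
rewrite -!mulrA ler_wpM2l ?(ltW B0)//.
apply: le_trans (_ : T <= _); first by have /andP[] := mT (j + 2).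
rewrite ler_peMr// mulrC ler_pdivlMr// mul1r dyad_le ?(ltW t0)//; lia.
Qed.

End shells.

End dyadic_sequences.

(** * Decay indicators along dyadic radii *)

Section decay_dictionary.
Context {R : realType} (n : nat).
Local Notation E := 'rV[R]_n.
Local Notation mu := (@lebesgue_rV R n).
Variables (u : E -> R[i]) (u2 : memL2 mu u).

Let v := L2_fourier u.
Let m (j : int) := low_energy v (2 ^ j).
Let v2 : memL2 mu v. Proof. by have [] := L2_fourierP u2. Qed.

Lemma decay_quotientE (r rho : R) :
  decay_quotient u r rho = ((rho `^ (2 * r + n%:R))^-1 * low_energy v rho)%:E.
Proof.
by rewrite /decay_quotient low_integral// -EFinM -powRN; congr ((_ `^ _) * _)%:E; ring.
Qed.

Lemma decay_sup_dyadic (r : R) : (decay_sup u r < +oo)%E ->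
  exists C (J0 : int), forall j, j <= J0 -> m j <= C * dyad (2 * r + n%:R) j.
Proof.
rewrite /decay_sup limf_esupE => /ereal_inf_lt[_ [V V0 <-] Vy].
have [C VC] : exists C : R, forall rho, V rho -> (decay_quotient u r rho <= C%:E)%E.
  have ub rho : V rho -> (decay_quotient u r rho <= ereal_sup (decay_quotient u r @` V))%E.
    by move=> Vr; apply: ereal_sup_ubound; exists rho.
  move: Vy ub; case: (ereal_sup _) => [C| |] // _ ub; first by exists C.
  by exists 0 => rho /ub /le_trans; apply; exact: leNye.
have [e /= e0 eV] := V0; have [J /andP[Je _]] := dyadic_floor e0.
exists C, (J - 1) => j jJ; have j0 := @exp2_gt0 R j.
have /VC : V (2 ^ j).
  apply: eV => //=; rewrite sub0r normrN gtr0_norm//; apply: lt_le_trans Je.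
  by rewrite ltr_eXz2l ?ltr1n//; lia.
rewrite decay_quotientE lee_fin dyad_powR mulrC ler_pdivrMr ?dyad_gt0//.
Qed.

(** A radius between 2^J and 2^(J+1) is compared with these endpoints. Both the energy and rho^t are
    monotone, the latter since t = 2 r + n is positive, and only a factor 2^t is lost. *)
Lemma dyadic_decay_sup (r C : R) : 0 < 2 * r + n%:R ->
  (forall j, m j <= C * dyad (2 * r + n%:R) j) -> (decay_sup u r < +oo)%E.
Proof.
set t := 2 * r + n%:R => t0 mC; apply: (@le_lt_trans _ _ (C * dyad t 1)%:E); last exact: ltry.
rewrite /decay_sup limf_esupE.
apply: (@le_trans _ _ (ereal_sup (decay_quotient u r @` [set rho | 0 < rho]))).
  by apply: ereal_inf_lbound; exists [set rho | 0 < rho] => //; exact: nbhs_right_gt.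
apply: ge_ereal_sup => _ [rho /= rho0 <-]; rewrite decay_quotientE lee_fin -/t.
have [J /andP[h1 h2]] := dyadic_floor rho0.
have l1 : low_energy v rho <= C * (dyad t J * dyad t 1).
  by rewrite -dyadD; apply: le_trans (mC (J + 1)); apply: le_low => //; exact: ltW.
have l2 : dyad t J <= rho `^ t.
  by rewrite -dyad_powR ge0_ler_powR ?nnegrE ?(ltW t0) ?(ltW rho0)// ltW// exp2_gt0.
have p0 : 0 < rho `^ t by exact: powR_gt0.
rewrite mulrC ler_pdivrMr//; apply: le_trans l1 _.
have C0 : 0 <= C.
  by have := le_trans (low_ge0 v (2 ^ 0)) (mC 0); rewrite pmulr_lge0// dyad_gt0.
by rewrite -mulrA ler_wpM2l// mulrC ler_wpM2l// ltW// dyad_gt0.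
Qed.

Lemma decay_inf_dyadic (r : R) : (0 < decay_inf u r)%E ->
  exists2 c : R, 0 < c & exists J0 : int,
    forall j, j <= J0 -> c * dyad (2 * r + n%:R) j <= m j.
Proof.
rewrite /decay_inf limf_einfE => /ereal_sup_gt[_ [V V0 <-] Vy].
have [c c0 VC] : exists2 c : R, 0 < c & forall rho, V rho -> (c%:E <= decay_quotient u r rho)%E.
  have lb rho : V rho -> (ereal_inf (decay_quotient u r @` V) <= decay_quotient u r rho)%E.
    by move=> Vr; apply: ereal_inf_lbound; exists rho.
  move: Vy lb; case: (ereal_inf _) => [c| |] // c0 lb; first by exists c; rewrite -?lte_fin.
  by exists 1 => // rho /lb; apply: le_trans; exact: leey.
exists c => //; have [e /= e0 eV] := V0; have [J /andP[Je _]] := dyadic_floor e0.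
exists (J - 1) => j jJ; have j0 := @exp2_gt0 R j.
have /VC : V (2 ^ j).
  apply: eV => //=; rewrite sub0r normrN gtr0_norm//; apply: lt_le_trans Je.
  by rewrite ltr_eXz2l ?ltr1n//; lia.
by rewrite decay_quotientE lee_fin dyad_powR mulrC ler_pdivlMr ?dyad_gt0.
Qed.

Lemma dyadic_decay_inf (r c : R) (J0 : int) : 0 < 2 * r + n%:R -> 0 < c ->
  (forall j, j <= J0 -> c * dyad (2 * r + n%:R) j <= m j) -> (0 < decay_inf u r)%E.
Proof.
set t := 2 * r + n%:R => t0 c0 mc; apply: (@lt_le_trans _ _ (c / dyad t 1)%:E).
  by rewrite lte_fin divr_gt0// dyad_gt0.
rewrite /decay_inf limf_einfE.
pose V : set R := [set rho | 0 < rho < 2 ^ J0].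
apply: (@le_trans _ _ (ereal_inf (decay_quotient u r @` V))); last first.
  apply: ereal_sup_ubound; exists V => //.
  have : \forall rho \near (0 : R)^'+, 0 < rho < 2 ^ J0.
    near=> rho; apply/andP; split; first by near: rho; exact: nbhs_right_gt.
    by near: rho; apply: nbhs_right_lt; exact: exp2_gt0.
  exact.
apply: le_ereal_inf_tmp => _ [rho /= /andP[rho0 rhoJ] <-]; rewrite decay_quotientE lee_fin -/t.
have [J /andP[h1 h2]] := dyadic_floor rho0.
have JJ : J <= J0 by apply: ltW; rewrite -(@ltr_eXz2l R 2) ?ltr1n//; exact: le_lt_trans h1 rhoJ.
have l1 : c * dyad t J <= low_energy v rho by apply: le_trans (mc J JJ) _; exact: le_low.
have l2 : rho `^ t <= dyad t J * dyad t 1.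
  rewrite -dyadD -dyad_powR ge0_ler_powR ?nnegrE ?(ltW t0) ?(ltW rho0) ?(ltW h2)//.
  by rewrite ltW// exp2_gt0.
have p0 : 0 < rho `^ t by exact: powR_gt0.
rewrite [leRHS]mulrC ler_pdivlMr//; apply: le_trans l1; rewrite -mulrA ler_wpM2l ?(ltW c0)//.
by rewrite mulrC ler_pdivrMr ?dyad_gt0.
Unshelve. all: by end_near. Qed.

(** * Sharp Besov condition, decay character and index *)

Section sharp_spaces.
Hypothesis n0 : (0 < n)%N.
Variables (phi : E -> R[i]) (hphi : LP_cutoff phi).
Let X (j : int) := block_energy phi v j.
Let kap : R := (2 * pi) ^- n.

Let kap_gt0 : 0 < kap.
Proof. by rewrite invr_gt0 exprn_gt0// mulr_gt0// pi_gt0. Qed.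

Let X_ge0 j : 0 <= X j.
Proof. by rewrite fine_ge0// N2_ge0. Qed.

Lemma block_normE j : dist_L2norm (LP_block phi j (dist_of u)) = (Num.sqrt (kap * X j))%:E.
Proof. exact: dist_L2norm_block. Qed.

(** Squaring passes from norms to energies and doubles the exponent s; [kap] is the Plancherel
    constant of the inverse transform. *)
Lemma block_norm_le (C s : R) j : 0 <= C ->
  (Num.sqrt (kap * X j) <= C * dyad s j) = (X j <= C ^+ 2 / kap * dyad (2 * s) j).
Proof.
move=> C0; have d0 : 0 <= C * dyad s j by rewrite mulr_ge0// ltW// dyad_gt0.
rewrite -[in LHS](@ler_pXn2r _ 2) ?nnegrE ?sqrtr_ge0// sqr_sqrtr ?mulr_ge0 ?(ltW kap_gt0)//.
by rewrite exprMn -dyad_sqr [in RHS]mulrAC ler_pdivlMr// [kap * _]mulrC.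
Qed.

Lemma block_norm_ge (c s : R) j : 0 <= c ->
  (c * dyad s j <= Num.sqrt (kap * X j)) = (c ^+ 2 / kap * dyad (2 * s) j <= X j).
Proof.
move=> c0; have d0 : 0 <= c * dyad s j by rewrite mulr_ge0// ltW// dyad_gt0.
rewrite -[in LHS](@ler_pXn2r _ 2) ?nnegrE ?sqrtr_ge0// sqr_sqrtr ?mulr_ge0 ?(ltW kap_gt0)//.
by rewrite exprMn -dyad_sqr [in RHS]mulrAC ler_pdivrMr// [kap * _]mulrC.
Qed.

(** Temperedness and the convergence of the series are supplied by [tempered_dist_of] and
    [dist_series_LP]; the finite supremum is, after squaring, the bound on the block energies. *)
Lemma besov_block_energy (s : R) : besov phi s (dist_of u) <->
  exists2 K : R, 0 <= K & forall j, X j <= K * dyad (2 * s) j.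
Proof.
have qE j : ((2 `^ (- (j%:~R * s)))%:E * dist_L2norm (LP_block phi j (dist_of u)))%E =
    ((dyad s j)^-1 * Num.sqrt (kap * X j))%:E.
  by rewrite block_normE -EFinM powRN [j%:~R * s]mulrC.
split=> [[_ _]|[K K0 XK]].
  set S := ereal_sup _ => Sy.
  have ub j : (((dyad s j)^-1 * Num.sqrt (kap * X j))%:E <= S)%E.
    by rewrite -qE; apply: ereal_sup_ubound; exists j.
  have S0 : (0 <= S)%E.
    apply: le_trans (ub 0); rewrite lee_fin mulr_ge0 ?sqrtr_ge0// invr_ge0.
    by rewrite ltW// dyad_gt0.
  have SE : S = (fine S)%:E by rewrite fineK// ge0_fin_numE.
  have C0 : 0 <= fine S by rewrite fine_ge0.
  exists (fine S ^+ 2 / kap); first by rewrite divr_ge0 ?sqr_ge0// ltW.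
  move=> j; rewrite -block_norm_le//; have := ub j.
  by rewrite SE lee_fin mulrC ler_pdivrMr ?dyad_gt0.
split; [exact: tempered_dist_of|exact: dist_series_LP|].
apply: (@le_lt_trans _ _ (Num.sqrt (K * kap))%:E); last exact: ltry.
apply: ge_ereal_sup => _ [j _ <-]; rewrite qE lee_fin mulrC ler_pdivrMr ?dyad_gt0//.
by rewrite block_norm_le ?sqrtr_ge0// sqr_sqrtr ?mulr_ge0 ?(ltW kap_gt0)// mulfK ?gt_eqF.
Qed.

Let le_m i j : i <= j -> m i <= m j.
Proof. by move=> ij; apply: le_low => //; rewrite ler_eXz2l ?ltr1n. Qed.

Let m_shell j : m (j + 1) <= m j + 3 * (X (j - 1) + X j + X (j + 1)).
Proof. exact: low_shell. Qed.

Let m_bounded j : 0 <= m j <= fine (N2 mu v).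
Proof. by rewrite low_ge0 low_bounded. Qed.

Lemma sharp_besov_energy (s : R) : 0 < s -> sharp_besov phi s (dist_of u) ->
  (exists C, forall j, m j <= C * dyad (2 * s) j) /\
  (exists2 c, 0 < c & exists J0 : int, forall j, j <= J0 -> c * dyad (2 * s) j <= m j).
Proof.
move=> s0 [/besov_block_energy[K K0 XK] [c [C [jk [[c0 C0] jkN [M gap] _ low_jk]]]]].
have s20 : 0 < 2 * s by rewrite mulr_gt0.
have [B B0 XB] := block_energy_le_low hphi n0 v2.
have H := shells_upper le_m m_shell s20 K0.
split; first exact: H (low_cvg0 n0 v2) XK.
have c'0 : 0 < c ^+ 2 / kap by rewrite divr_gt0// exprn_gt0.
apply: (shells_lower le_m (ltW s20) c'0 B0 XB jkN gap) => k.
by rewrite -block_norm_ge ?(ltW c0)// -lee_fin -block_normE; exact: low_jk.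
Qed.

Lemma energy_sharp_besov (s c C : R) (J0 : int) : 0 < s -> 0 < c ->
  (forall j, j <= J0 -> m j <= C * dyad (2 * s) j) ->
  (forall j, j <= J0 -> c * dyad (2 * s) j <= m j) ->
  sharp_besov phi s (dist_of u).
Proof.
move=> s0 c0 mC cm; have s20 : 0 < 2 * s by rewrite mulr_gt0.
have [B B0 XB] := block_energy_le_low hphi n0 v2.
have [K K0 XK] := shells_blocks s20 B0 XB m_bounded mC.
have [d [M [jk [d0 jkN gap dX]]]] := shells_pigeonhole m_shell s20 c0 mC cm.
split; first by apply/besov_block_energy; exists K.
(* The added 1 keeps the upper constant positive when K = 0. *)
exists (Num.sqrt (d * kap)), (Num.sqrt (K * kap) + 1), jk; split => //.
- by rewrite sqrtr_gt0 mulr_gt0// ltr_wpDl ?sqrtr_ge0.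
- by exists M.
- move=> j; rewrite block_normE lee_fin mulrDl; apply: ler_wpDr.
    by rewrite mul1r ltW// dyad_gt0.
  rewrite block_norm_le ?sqrtr_ge0// sqr_sqrtr ?mulr_ge0 ?(ltW kap_gt0)//.
  by rewrite mulfK ?gt_eqF.
- move=> k; rewrite block_normE lee_fin block_norm_ge ?sqrtr_ge0//.
  by rewrite sqr_sqrtr ?mulr_ge0 ?(ltW kap_gt0) ?(ltW d0)// mulfK ?gt_eqF.
Qed.

Lemma decay_character_sharp_besov (r : R) : is_decay_character u r ->
  0 < r + n%:R / 2 /\ sharp_besov phi (r + n%:R / 2) (dist_of u).
Proof.
move=> [rn [sup _] [inf _]].
have s0 : 0 < r + n%:R / 2 by move: rn; lra.
split => //; have tE : 2 * r + n%:R = 2 * (r + n%:R / 2) by field.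
have [C [J1 mC]] := decay_sup_dyadic sup; have [c c0 [J2 cm]] := decay_inf_dyadic inf.
rewrite tE in mC cm; apply: (@energy_sharp_besov _ c C (Num.min J1 J2)) => // j.
  by rewrite le_min => /andP[j1 _]; exact: mC.
by rewrite le_min => /andP[_ j2]; exact: cm.
Qed.

(** The exact order 2^(2sj) of the ball energies puts s - n/2 in both sets. Any other q in one of
    them gives a one-sided bound with exponent 2 q + n, and comparing it with the opposite bound at
    arbitrarily small scales places q on the right side. *)
Lemma sharp_besov_decay_character (s : R) : 0 < s -> sharp_besov phi s (dist_of u) ->
  is_decay_character u (s - n%:R / 2).
Proof.
move=> s0 sb; have s20 : 0 < 2 * s by rewrite mulr_gt0.
have [[C mC] [c c0 [J0 cm]]] := sharp_besov_energy s0 sb.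
have tE : 2 * (s - n%:R / 2) + n%:R = 2 * s by field.
split; first by rewrite ltrBrDr addNr.
- split; first by apply: (@dyadic_decay_sup _ C); rewrite tE.
  move=> q /= /decay_sup_dyadic[D [J1 mD]].
  have : 2 * q + n%:R <= 2 * s; last by lra.
  apply: (@dyad_compare _ c D) => // N; pose j := Num.min N (Num.min J0 J1).
  have [jN j0 j1] : [/\ j <= N, j <= J0 & j <= J1].
    by rewrite /j !ge_min !lexx !orbT.
  by exists j => //; apply: le_trans (cm j j0) (mD j j1).
- split; first by apply: (@dyadic_decay_inf _ c J0); rewrite ?tE.
  move=> q /= /decay_inf_dyadic[d d0 [J1 dm]].
  have : 2 * s <= 2 * q + n%:R; last by lra.
  apply: (@dyad_compare _ d C) => // N; pose j := Num.min N J1.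
  have [jN j1] : j <= N /\ j <= J1 by rewrite /j !ge_min !lexx !orbT.
  by exists j => //; apply: le_trans (dm j j1) (mC j).
Qed.

(** The large blocks along [jk] exclude a larger exponent: membership with exponent q bounds them by
    a multiple of 2^(2qj) at indices tending to -oo. *)
Lemma sharp_besov_index (s : R) : 0 < s -> sharp_besov phi s (dist_of u) ->
  s%:E = besov_index phi u.
Proof.
move=> s0 sb; apply/eqP; rewrite eq_le; apply/andP; split.
  by apply: ereal_sup_ubound; exists s => //=; split; [exact: ltW|case: sb].
apply: ge_ereal_sup => _ [q [q0 /besov_block_energy[K K0 XK]] <-]; rewrite lee_fin.
have [_ [c [C [jk [[c0 C0] jkN _ _ low_jk]]]]] := sb.
have : 2 * q <= 2 * s; last by rewrite ler_pM2l.
apply: (@dyad_compare _ (c ^+ 2 / kap) K); first by rewrite divr_gt0// exprn_gt0.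
move=> N; have /cvgrNy_le/(_ N%:~R)/filter_ex[k] := jkN.
rewrite ler_int => kN; exists (jk k) => //; apply: le_trans (XK (jk k)).
by rewrite -block_norm_ge ?(ltW c0)// -lee_fin -block_normE; exact: low_jk.
Qed.

End sharp_spaces.

End decay_dictionary.

Theorem proposition4p3 (R : realType) (n : nat) (hn : (0 < n)%N)
    (phi : 'rV[R]_n -> R[i]) (hphi : LP_cutoff phi)
    (u0 : 'rV[R]_n -> R[i]) (hu0 : L2 u0) :
  ((exists r : R, is_decay_character u0 r) <->
   (exists2 s : R, 0 < s & sharp_besov phi s (dist_of u0))) /\
  (forall r s : R, is_decay_character u0 r ->
     0 < s -> sharp_besov phi s (dist_of u0) ->
     s%:E = besov_index phi u0 /\ (r + n%:R / 2)%:E = besov_index phi u0).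
Proof.
have u2 : memL2 (@lebesgue_rV R n) u0 by exact/L2_memL2.
split.
  split=> [[r /(decay_character_sharp_besov u2 hn hphi)[s0 sb]]|[s s0 sb]].
    by exists (r + n%:R / 2).
  by exists (s - n%:R / 2); exact: sharp_besov_decay_character sb.
(* Both s and r + n/2 are now exponents of sharp Besov membership, so each equals the index. *)
move=> r s /(decay_character_sharp_besov u2 hn hphi)[r0 rb] s0 sb.
by split; exact: sharp_besov_index.
Qed.
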